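(* Let $W$ be a Gaussian white noise on $\mathbb R\times[0,1]^{\mathbb N}$ with intensity $\mathrm{Leb}_1\otimes P$ ($P$ the law of an i.i.d. uniform$[0,1]$ sequence), $W_l(dx,dy_1,\ldots,dy_l):=W(dx,dy_1,\ldots,dy_l,[0,1]^{\mathbb N})$, $\psi_0(x):=e^{-x}$, $\psi_l(x):=\frac{x^l}{l!}e^{-x}$. Define, for $u\in\mathbb R$, $$Z_1(u):=-\int_{\mathbb R\times[0,1]}\Big(\mathbf 1_{\{y\le \exp(-e^{-(x-u)})\}}-\exp(-e^{-(x-u)})\Big)W_1(dx,dy),$$ $$X_k(u):=\int_{\mathbb R\times[0,1]^{k+1}}\Big(\mathbf 1_{\{y_1\cdots y_{k+1}<\psi_0(e^{-(x-u)})<y_1\cdots y_k\}}-\psi_k(e^{-(x-u)})\Big)W_{k+1}(dx,dy_1,\ldots,dy_{k+1}),\quad k\in\mathbb N,$$ and $Z_l(u):=Z_1(u)-\sum_{k=1}^{l-1}X_k(u)$ for $l\in\mathbb N$. Then each $Z_l=(Z_l(u))_{u\in\mathbb R}$ is a centered stationary Gaussian process with $$\mathrm{Cov}(Z_l(u),Z_l(v))=\log(1+e^{-|u-v|})-\sum_{k=1}^{l-1}\frac{(2k-1)!\,e^{-|u-v|k}}{(k!)^2(1+e^{-|u-v|})^{2k}},\quad u,v\in\mathbb R,$$ and, for $l\in\mathbb N$, $n\in\mathbb N_0$, $u,v\in\mathbb R$, $$\mathbb E Z_l(u)Z_{l+n}(v)=\log(1+e^{-|u-v|})-\sum_{k=1}^{l-1}\frac{(2k-1)!\,e^{-|u-v|k}}{(k!)^2(1+e^{-|u-v|})^{2k}}+\sum_{r=0}^{n-1}\sum_{i=0}^{l-1}\Big(\frac{1}{l+r}\binom{l+r}{i}\big((1-e^{u-v})_+\big)^{l+r-i}e^{(u-v)i}-\frac{1}{l+r+i}\binom{l+r+i}{i}\frac{e^{(u-v)i}}{(1+e^{u-v})^{l+r+i}}\Big).$$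 Moreover, for each $l$, the process $Z_l$ has a version whose sample paths are Hölder continuous with exponent $\alpha$ for each $\alpha\in(0,1/2)$.
   Context: A Gaussian white noise $W$ on a measure space with intensity $\mu$ assigns to each set $A$ of finite $\mu$-measure a centered normal random variable $W(A)$ with $\mathbb E W(A)W(B)=\mu(A\cap B)$; integrals of deterministic square-integrable functions against $W$ are Wiener integrals. $\mathrm{Leb}_1$ is Lebesgue measure on $\mathbb R$. $x_+=\max(x,0)$. *)

(* Defs.v *)
From HB Require Import structures.
From mathcomp Require Import all_boot all_order all_algebra.
From mathcomp Require Import all_classical all_reals all_analysis.
Set Implicit Arguments. Unset Strict Implicit. Unset Printing Implicit Defensive.
Import Order.TTheory GRing.Theory Num.Theory.
Local Open Scope classical_set_scope.
Local Open Scope ring_scope.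

(* The sequence space R^N (carrying [0,1]^N) with its product sigma-algebra, *)
(* generated by the coordinate maps.                                         *)
Definition seq_space (R : realType) : Type := nat -> R.
HB.instance Definition _ (R : realType) := gen_eqMixin (seq_space R).
HB.instance Definition _ (R : realType) := gen_choiceMixin (seq_space R).
HB.instance Definition _ (R : realType) :=
  isPointed.Build (seq_space R) (fun _ => 0).

Definition coord_sets (R : realType) : set (set (seq_space R)) :=
  [set A | exists (i : nat) (B : set R),
     measurable B /\ A = (fun f : seq_space R => f i) @^-1` B].

Definition seqR (R : realType) := g_sigma_algebraType (@coord_sets R).

Definition iid_uniform (R : realType) (P : probability (seqR R) R) : Prop :=
  forall (n : nat) (B : nat -> set R), (forall i, measurable (B i)) ->
    P [set f : seqR R | forall i, (i < n)%N -> B i (f i)] =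
    (\prod_(i < n) lebesgue_measure (B i `&` `[0%R, 1%R]))%E.

Definition gaussian_rv (R : realType) (d : measure_display) (Om : measurableType d)
  (Prob : probability Om R) (X : Om -> R) (m s2 : R) : Prop :=
  measurable_fun setT X /\
  forall B : set R, measurable B ->
    Prob (X @^-1` B) =
    (if s2 == 0 then \d_m B else normal_prob m (Num.sqrt s2) B).

Definition noise_comb (R : realType) (S Om : Type) (W : set S -> Om -> R)
  (s : seq (R * set S)) (w : Om) : R :=
  \sum_(q <- s) q.1 * W q.2 w.

Definition step_fun (R : realType) (S : Type) (s : seq (R * set S)) (p : S) : R :=
  \sum_(q <- s) q.1 * indic q.2 p.

Definition finite_sets (R : realType) (d' : measure_display) (S : measurableType d')
  (mu : {measure set S -> \bar R}) (s : seq (R * set S)) : Prop :=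
  forall q, q \in s -> measurable q.2 /\ (mu q.2 < +oo)%E.

(* Gaussian white noise on S with intensity mu: for sets A of finite
   mu-measure, W(A) is a centered jointly Gaussian family with
   E W(A) W(B) = mu (A `&` B); equivalently every finite linear combination
   sum c_i W(A_i) is centered Gaussian with variance sum c_i c_j mu(A_i & A_j). *)
Definition gaussian_white_noise (R : realType) (d : measure_display)
  (Om : measurableType d) (Prob : probability Om R)
  (d' : measure_display) (S : measurableType d')
  (mu : {measure set S -> \bar R}) (W : set S -> Om -> R) : Prop :=
  forall s : seq (R * set S), finite_sets mu s ->
    gaussian_rv Prob (noise_comb W s) 0
      (\sum_(q <- s) \sum_(q' <- s) q.1 * q'.1 * fine (mu (q.2 `&` q'.2))).

Definition wiener_integral (R : realType) (d : measure_display)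
  (Om : measurableType d) (Prob : probability Om R)
  (d' : measure_display) (S : measurableType d')
  (mu : {measure set S -> \bar R}) (W : set S -> Om -> R)
  (f : S -> R) (I : Om -> R) : Prop :=
  [/\ measurable_fun setT f,
      (\int[mu]_p ((f p) ^+ 2)%:E < +oo)%E,
      measurable_fun setT I &
      forall g : nat -> seq (R * set S),
        (forall n, finite_sets mu (g n)) ->
        (fun n => (\int[mu]_p ((step_fun (g n) p - f p) ^+ 2)%:E)%E) @ \oo --> 0%E ->
        (fun n => (\int[Prob]_w ((noise_comb W (g n) w - I w) ^+ 2)%:E)%E)
          @ \oo --> 0%E].

Definition psi (R : realType) (l : nat) (x : R) : R :=
  x ^+ l / (l`!)%:R * expR (- x).

(* 1_{y <= exp(-e^{-(x-u)})} - exp(-e^{-(x-u)}),  y = y_1 = p.2 0 *)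
Definition Z1_integrand (R : realType) (u : R) (p : R * seqR R) : R :=
  let t := expR (- expR (- (p.1 - u))) in
  (if p.2 0%N <= t then 1 else 0) - t.

(* 1_{y_1...y_{k+1} < psi_0(e^{-(x-u)}) < y_1...y_k} - psi_k(e^{-(x-u)}),
   with y_j = p.2 (j-1) *)
Definition X_integrand (R : realType) (k : nat) (u : R) (p : R * seqR R) : R :=
  let t := expR (- (p.1 - u)) in
  (if (\prod_(i < k.+1) p.2 i < psi 0 t) && (psi 0 t < \prod_(i < k) p.2 i)
   then 1 else 0) - psi k t.

(* Z_l(u) = Z_1(u) - sum_{k=1}^{l-1} X_k(u),  where Z_1(u) = - I1(u) and
   I1(u) is the Wiener integral of Z1_integrand u. *)
Definition Zproc (R : realType) (Om : Type) (I1 : R -> Om -> R)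
  (X : nat -> R -> Om -> R) (l : nat) (u : R) (w : Om) : R :=
  - I1 u w - \sum_(1 <= k < l) X k u w.

Definition cov_l (R : realType) (l : nat) (u v : R) : R :=
  ln (1 + expR (- `|u - v|))
  - \sum_(1 <= k < l)
      ((2 * k - 1)`!%:R * expR (- `|u - v| * k%:R))
      / ((k`!%:R) ^+ 2 * (1 + expR (- `|u - v|)) ^+ (2 * k)).

Definition cross_cov (R : realType) (l n : nat) (u v : R) : R :=
  cov_l l u v
  + \sum_(0 <= r < n) \sum_(0 <= i < l)
      ( (l + r)%:R^-1 * 'C(l + r, i)%:R
          * (Num.max (1 - expR (u - v)) 0) ^+ (l + r - i) * expR ((u - v) * i%:R)
        - (l + r + i)%:R^-1 * 'C(l + r + i, i)%:R
          * expR ((u - v) * i%:R) / (1 + expR (u - v)) ^+ (l + r + i)).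

Definition gaussian_process (R : realType) (d : measure_display)
  (Om : measurableType d) (Prob : probability Om R) (Z : R -> Om -> R) : Prop :=
  forall s : seq (R * R), exists m s2 : R,
    0 <= s2 /\ gaussian_rv Prob (fun w => \sum_(q <- s) q.1 * Z q.2 w) m s2.

Definition centered (R : realType) (d : measure_display)
  (Om : measurableType d) (Prob : probability Om R) (Z : R -> Om -> R) : Prop :=
  forall u, (\int[Prob]_w (Z u w)%:E = 0)%E.

(* for a centered Gaussian process, (strict) stationarity is shift-invariance
   of the covariance *)
Definition stationary_cov (R : realType) (d : measure_display)
  (Om : measurableType d) (Prob : probability Om R) (Z : R -> Om -> R) : Prop :=
  forall h u v, (\int[Prob]_w (Z (u + h) w * Z (v + h) w)%:E =
                \int[Prob]_w (Z u w * Z v w)%:E)%E.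

Definition locally_hoelder (R : realType) (f : R -> R) (a : R) : Prop :=
  forall T : R, 0 < T -> exists C : R, forall s t : R,
    `|s| <= T -> `|t| <= T -> `|f s - f t| <= C * `|s - t| `^ a.

(* Main.v *)
(** Write [S k = y_1 ... y_k]. The indicators defining [X_k] telescope, so that almost
    everywhere the kernel of [Z_l(u)] is [P (S l < e^{-t}) - 1_{S l < e^{-t}}] with
    [t = e^{-(x-u)}]. Since [- ln y_i] is exponential, [- ln (S k)] is the [k]-th point of a
    Poisson process, and [P (S l < e^{-t})] is a Poisson distribution function. By the Wiener
    isometry and Fubini, the covariance of [Z_l(u)] and [Z_m(v)] is the [x]-integral of the
    covariance of two such indicators. Substituting [s = e^{-x}] this is a finite sum of
    integrals of [s^k e^{-cs}] against [ds / s]: the terms with [k > 0] are Gamma integrals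
    and the terms with [k = 0] combine into Frullani integrals, which produce the logarithm.

    The covariance formula gives [E (Z_l(u) - Z_l(v))^2 <= 2 |u - v|]. The increments being
    Gaussian, the increments over dyadic intervals of length [2^-n] eventually stay below
    [8 (n+1) 2^{-n/2}] by Borel-Cantelli, and dyadic chaining yields the Hoelder version. *)
Require Import Defs.
From HB Require Import structures.
From mathcomp Require Import all_boot all_order all_algebra.
From mathcomp Require Import finmap.
From mathcomp Require Import all_classical all_reals all_analysis.
From mathcomp Require Import measurable_realfun ring lra zify.
Set Implicit Arguments. Unset Strict Implicit. Unset Printing Implicit Defensive.
Import Order.TTheory GRing.Theory Num.Theory.
Import numFieldNormedType.Exports.
Local Open Scope classical_set_scope.
Local Open Scope ring_scope.

Import HBNNSimple.

(** * Gaussian random variables *)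

(** The noise is known only through the one-dimensional laws of its finite linear combinations, and
    the integrals only through L2 approximation by step functions. So every Gaussian fact is derived
    for a single variable: variances by an L2 limit of normal laws, covariances from variances by
    polarization, means from the equality of the laws of [I] and [- I].

    For fixed [x] the covariance of two indicators is a joint probability minus a product, and both
    tend to 1 as [x] tends to infinity, so neither is integrable alone. Each is renormalized by the
    same multiple of one double exponential, whose rate is chosen case by case so that the right
    logarithm remains. The joint probability has two shapes: for [u <= v] it is a genuine two-time
    Poisson probability, for [v < u] one event contains the other.

    The integration yields double sums over an [l] by [l + n] rectangle. Over its square part the
    product gives a harmonic sum plus diagonal terms, by the identity behind the problem of points;
    the joint probability gives the same harmonic sum. The harmonic sums cancel and the diagonal
    terms are those of [cov_l]. *)

Lemma ge0_integral_density (d : measure_display) (T : measurableType d) (R : realType)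
    (mu nu : {measure set T -> \bar R}) (g : T -> R) :
  measurable_fun setT g -> (forall x, 0 <= g x) ->
  (forall A, measurable A -> nu A = \int[mu]_(x in A) (g x)%:E)%E ->
  forall f : T -> \bar R, measurable_fun setT f -> (forall x, 0 <= f x)%E ->
  (\int[nu]_x f x = \int[mu]_x (f x * (g x)%:E))%E.
Proof.
move=> mg g0 nuE f mf f0.
have simple (h : {nnsfun T >-> R}) :
    (\int[nu]_x (h x)%:E = \int[mu]_x ((h x)%:E * (g x)%:E))%E.
  under eq_integral do rewrite fimfunE -fsumEFin//.
  rewrite ge0_integral_fsum//; last 2 first.
    by move=> r; exact/measurable_EFinP/measurableT_comp.
    by move=> r x _; rewrite EFinM nnfun_muleindic_ge0.
  under [RHS]eq_integral.
    move=> x _; rewrite fimfunE -fsumEFin// ge0_mule_fsuml; last first.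
      by move=> r; rewrite EFinM nnfun_muleindic_ge0.
    over.
  rewrite ge0_integral_fsum//; last 2 first.
    move=> r; apply/emeasurable_funM; last exact/measurable_EFinP.
    by apply/measurable_EFinP/measurable_funM.
    by move=> r x _; rewrite mule_ge0 ?lee_fin// -lee_fin EFinM nnfun_muleindic_ge0.
  apply: eq_fsbigr => r _.
  have [r0|r0] := ltP r 0.
    rewrite preimage_nnfun0// !integral0_eq// => x _.
      by rewrite indicE in_set0 mulr0 mul0e.
    by rewrite indicE in_set0 mulr0.
  rewrite integralZl_indic_nnsfun// integral_indic// setIT nuE//.
  rewrite integral_mkcond -ge0_integralZl; last 4 first.
    by [].
    apply/(measurable_restrictT _ _).1 => //; exact/measurable_funTS/measurable_EFinP.
    by move=> x _; rewrite erestrict_ge0// => *; rewrite lee_fin.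
    by rewrite lee_fin.
  apply: eq_integral => x _; rewrite patchE indicE; case: ifPn => xA.
    by rewrite mulr1.
  by rewrite mule0 mulr0 mul0e.
pose h := nnsfun_approx measurableT mf.
have fE x : f x = limn (fun n => (h n x)%:E).
  by apply/esym/cvg_lim => //; exact: cvg_nnsfun_approx.
have ndh x : {homo (fun n => h n x) : n m / (n <= m)%N >-> n <= m}.
  by move=> n m nm; have /lefP := nd_nnsfun_approx measurableT mf nm; exact.
under eq_integral do rewrite fE.
rewrite (monotone_convergence nu measurableT (g' := fun n x => (h n x)%:E)); last 3 first.
- by move=> n; exact/measurable_EFinP.
- by move=> n x _; rewrite lee_fin.
- by move=> x _ n m nm; rewrite lee_fin; exact: ndh.
under eq_fun do rewrite simple.
rewrite -(monotone_convergence mu measurableT (g' := fun n x => (h n x)%:E * (g x)%:E)%E); last 3 first.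
- by move=> n; apply: emeasurable_funM; exact/measurable_EFinP.
- by move=> n x _; rewrite mule_ge0 ?lee_fin.
- by move=> x _ n m nm; rewrite lee_wpmul2r ?lee_fin//; exact: ndh.
apply: eq_integral => x _.
apply/cvg_lim => //.
under eq_fun do rewrite muleC.
rewrite muleC; apply: cvgeZl => //; exact: cvg_nnsfun_approx.
Qed.

Section normal_calculus.
Variable R : realType.
Implicit Types s x : R.
Local Notation mu := (@lebesgue_measure R).

(** Integration by parts in closed form: the integrand is the derivative of
    [- (s ^+ 2) * x * normal_fun 0 s x]. On [[0, b]] the second moment therefore differs from
    [s ^+ 2] times the mass only by a boundary term at [b]. *)
Lemma integral_itv_sqr_normal_fun s (b : R) : 0 < s -> 0 < b ->
  (\int[mu]_(x in `[0%R, b]) ((x ^+ 2 - s ^+ 2) * normal_fun 0 s x)%:E =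
   (- (s ^+ 2) * b * normal_fun 0 s b)%:E)%E.
Proof.
move=> s0 b0.
pose F x := - (s ^+ 2) * x * normal_fun 0 s x.
have F' x : is_derive x (1 : R) F ((x ^+ 2 - s ^+ 2) * normal_fun 0 s x).
  rewrite /F /normal_fun; apply: is_derive_eq.
  rewrite /GRing.scale /= subr0; field.
  by rewrite gt_eqF.
have cf : continuous (fun x => (x ^+ 2 - s ^+ 2) * normal_fun 0 s x).
  move=> x.
  have : derivable (fun x => (x ^+ 2 - s ^+ 2) * normal_fun 0 s x) x 1 by rewrite /normal_fun.
  by move=> /derivable1_diffP/differentiable_continuous.
rewrite (@continuous_FTC2 _ _ F)//.
- by rewrite /F mulr0 mul0r -EFinB subr0.
- exact: continuous_subspaceT.
- have cF : continuous F.
    by move=> x; apply/differentiable_continuous/derivable1_diffP.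
  by split => //; [exact/cvg_at_right_filter/cF|exact/cvg_at_left_filter/cF].
- by move=> x _; rewrite derive1E; exact: derive_val.
Qed.

(** Since [expR y >= y], the value is at most [2 * s ^+ 2 / n]. This removes the boundary term of
    the integration by parts. *)
Lemma cvg_id_normal_fun s : 0 < s -> (fun n : nat => n%:R * normal_fun 0 s n%:R : R) @ \oo --> (0 : R).
Proof.
move=> s0.
apply: (@squeeze_cvgr _ _ _ _ (cst 0) (fun n : nat => 2 * s ^+ 2 * n%:R^-1)); last 2 first.
- exact: cvg_cst.
- rewrite -(mulr0 (2 * s ^+ 2)); apply: cvgMr. apply/gtr0_cvgV0; [by exists 1%N => // n /=; rewrite ltr0n|exact: cvgr_idn].
near=> n.
have n0 : 0 < n%:R :> R by rewrite ltr0n; near: n; exists 1%N.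
rewrite mulr_ge0 ?normal_fun_ge0//=.
rewrite ler_pdivlMr//.
have : normal_fun 0 s n%:R <= (n%:R ^+ 2 / (s ^+ 2 *+ 2))^-1.
  rewrite /normal_fun subr0 mulNr expRN lef_pV2 ?posrE ?expR_gt0//.
    by rewrite (le_trans _ (expR_ge1Dx _))// lerDr.
  by rewrite divr_gt0// ?exprn_gt0// mulrn_wgt0// exprn_gt0.
rewrite invf_div ler_pdivlMr ?exprn_gt0// => H.
by rewrite (mulr_natl (s ^+ 2)) (le_trans _ H)// mulrAC -expr2 mulrC.
Unshelve. all: by end_near. Qed.
End normal_calculus.

Section normal_moment.
Variable R : realType.
Implicit Types s x : R.
Local Notation mu := (@lebesgue_measure R).

Lemma integral_sqr_normal_pdf s : 0 < s ->
  (\int[mu]_x (x ^+ 2 * normal_pdf 0 s x)%:E = (s ^+ 2)%:E)%E.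
Proof.
move=> s0; have s0' : s != 0 by rewrite gt_eqF.
pose p := normal_pdf (0 : R) s.
have cp : continuous p by exact: continuous_normal_pdf.
have symp : p =1 p \o -%R.
  by move=> x; rewrite /p normal_pdfE//= /normal_fun !subr0 sqrrN.
have p0 x : 0 <= p x by exact: normal_pdf_ge0.
have csp : continuous (fun x => x ^+ 2 * p x).
  by move=> x; apply: cvgM; [exact: exprn_continuous|exact: cp].
have msp := continuous_measurable_fun csp.
have mp := continuous_measurable_fun cp.
have setE : [set x : R | (0 <= x)%R] = `[0%R, +oo[%classic.
  by apply/seteqP; split => x /=; rewrite in_itv/= andbT.
have half : (\int[mu]_(x in `[0%R, +oo[) (p x)%:E = (2^-1)%:E)%E.
  have := integral_normal_pdf (0 : R) s; rewrite ge0_symfun_integralT// setE => H.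
  have : (2^-1%:E * (2 * \int[mu]_(x in `[0%R, +oo[) (p x)%:E) = 2^-1%:E * 1)%E.
    by rewrite H.
  by rewrite muleA -EFinM mulVf// mul1e mule1.
rewrite ge0_symfun_integralT//; last 2 first.
- by move=> x; rewrite mulr_ge0// sqr_ge0.
- by move=> x /=; rewrite sqrrN; congr (_ * _); exact: symp.
rewrite setE.
have L1 := ge0_cvgn_integral (mu := mu) (fun x => mulr_ge0 (sqr_ge0 x) (p0 x)) msp.
suff L2 : (\int[mu]_(x in `[0%R, n%:R]) (x ^+ 2 * p x)%:E)%E @[n --> \oo] -->
    ((s ^+ 2)%:E * (2^-1)%:E)%E.
  rewrite (cvg_unique _ L1 L2)// -!EFinM; congr EFin.
  by rewrite mulrC -mulrA mulVf// mulr1.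
rewrite -half.
have L3 : ((s ^+ 2)%:E * \int[mu]_(x in `[0%R, n%:R]) (p x)%:E -
  (s ^+ 2 * normal_peak s * (n%:R * normal_fun 0 s n%:R))%:E)%E @[n --> \oo] -->
  ((s ^+ 2)%:E * \int[mu]_(x in `[0%R, +oo[) (p x)%:E - (s ^+ 2 * normal_peak s * 0)%:E)%E.
  apply: cvgeB; first by rewrite fin_num_adde_defl.
    by apply: cvgeZl => //; exact: (ge0_cvgn_integral (mu := mu) p0 mp).
  apply: cvg_EFin; first exact: nearW.
  by apply: cvgMr; exact: cvg_id_normal_fun.
rewrite mulr0 sube0 in L3.
apply: cvg_trans L3; apply: near_eq_cvg; near=> n.
have n0 : 0 < n%:R :> R by rewrite ltr0n; near: n; exists 1%N.
have icp (g : R -> R) : continuous g -> mu.-integrable `[0%R, n%:R] (EFin \o g).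
  by move=> cg; apply: continuous_compact_integrable; [exact: segment_compact|exact: continuous_subspaceT].
have := integral_itv_sqr_normal_fun s0 n0.
move=> /(congr1 (fun z => ((normal_peak s)%:E * z)%E)).
have cf : continuous (fun x => (x ^+ 2 - s ^+ 2) * normal_fun 0 s x).
  move=> x; have : derivable (fun x => (x ^+ 2 - s ^+ 2) * normal_fun 0 s x) x 1 by rewrite /normal_fun.
  by move=> /derivable1_diffP/differentiable_continuous.
rewrite -integralZl//; last exact: icp.
have -> : (\int[mu]_(x in `[0%R, n%:R]) ((normal_peak s)%:E * ((x ^+ 2 - s ^+ 2) * normal_fun 0 s x)%:E) =
    \int[mu]_(x in `[0%R, n%:R]) ((x ^+ 2 * p x)%:E - (s ^+ 2 * p x)%:E))%E.
  apply: eq_integral => x _; rewrite -EFinM -EFinB /p normal_pdfE//; congr EFin; ring.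
rewrite integralB_EFin//; [|exact: icp csp|]; last first.
  apply: (icp (fun x => s ^+ 2 * p x)) => x; apply: cvgM; [exact: cvg_cst|exact: cp].
have fin1 : (\int[mu]_(x in `[0%R, n%:R]) (s ^+ 2 * p x)%:E)%E \is a fin_num.
  apply: integrable_fin_num => //.
  by apply: (icp (fun x => s ^+ 2 * p x)) => x; apply: cvgM; [exact: cvg_cst|exact: cp].
move=> /eqP; rewrite sube_eq ?fin_num_adde_defr//; last first.
  by apply: integrable_fin_num => //; exact: icp csp.
move=> /eqP ->.
rewrite addeC -integralZl//; last exact: icp.
by congr (_ + _)%E; rewrite -EFinN -EFinM; congr EFin; ring.
Unshelve. all: by end_near. Qed.
End normal_moment.

Lemma emeasurable_normal_pdf (R : realType) (m s : R) (B : set (measurableTypeR R)) :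
  measurable_fun B (fun x : measurableTypeR R => (normal_pdf m s x)%:E).
Proof.
apply: measurable_funTS; exact: (measurable_int _ (integrable_normal_pdf m s)).
Qed.

Lemma ge0_integral_law (R : realType) (d : measure_display) (Om : measurableType d)
    (Prob : probability Om R) (X : Om -> measurableTypeR R)
    (nu : {measure set (measurableTypeR R) -> \bar R}) :
  measurable_fun setT X ->
  (forall B : set (measurableTypeR R), measurable B -> Prob (X @^-1` B) = nu B) ->
  forall f : measurableTypeR R -> \bar R, measurable_fun setT f -> (forall x, 0 <= f x)%E ->
  (\int[Prob]_w f (X w) = \int[nu]_x f x)%E.
Proof.
move=> mX XE f mf f0.
pose X' : {mfun Om >-> measurableTypeR R} := HB.pack X (isMeasurableFun.Build _ _ _ _ X mX).
rewrite -[LHS]/(\int[Prob]_w (f \o X') w)%E -(@ge0_integral_distribution _ _ _ _ _ Prob X')//.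
by apply: eq_measure_integral => A mA _; exact: XE.
Qed.

Lemma gaussian_rv_second_moment (R : realType) (d : measure_display) (Om : measurableType d)
  (Prob : probability Om R) (X : Om -> R) (s2 : R) : 0 <= s2 ->
  gaussian_rv Prob X 0 s2 -> (\int[Prob]_w ((X w) ^+ 2)%:E = s2%:E)%E.
Proof.
move=> s20 [mX PX].
have msq : measurable_fun [set: measurableTypeR R] (fun x : measurableTypeR R => ((x : R) ^+ 2)%:E).
  by apply/measurable_EFinP; exact: exprn_measurable.
have sq0 (x : measurableTypeR R) : (0 <= ((x : R) ^+ 2)%:E)%E by rewrite lee_fin sqr_ge0.
have [s0|s0] := eqVneq s2 0.
  rewrite (@ge0_integral_law _ _ _ Prob X (\d_(0 : measurableTypeR R)) mX _ _ msq)//.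
    by rewrite integral_dirac// diracT mul1e expr0n s0.
  by move=> B mB; rewrite PX// s0 eqxx.
have sp : 0 < Num.sqrt s2 by rewrite sqrtr_gt0 lt_neqAle eq_sym s0.
rewrite (@ge0_integral_law _ _ _ Prob X (normal_prob 0 (Num.sqrt s2)) mX _ _ msq)//; last first.
  by move=> A mA; rewrite PX// (negbTE s0).
rewrite (@ge0_integral_density _ _ _ lebesgue_measure _ (normal_pdf 0 (Num.sqrt s2)))//.
- by rewrite -[in RHS](sqr_sqrtr s20) -integral_sqr_normal_pdf.
- exact: measurable_normal_pdf.
- exact: normal_pdf_ge0.
Qed.

(** The bound involves [t2] and not [s2] because the increments of the process have variances,
    possibly zero, that are only bounded from above. *)
Lemma gaussian_rv_tail (R : realType) (d : measure_display) (Om : measurableType d)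
  (Prob : probability Om R) (X : Om -> R) (s2 t2 a : R) : 0 <= s2 -> s2 <= t2 -> 0 < t2 -> 0 < a ->
  gaussian_rv Prob X 0 s2 ->
  (Prob [set w | (a <= `|X w|)%R] <= (Num.sqrt 2 * expR (- (a ^+ 2 / (4 * t2))))%:E)%E.
Proof.
move=> s20 st t20 a0 [mX PX].
have mB : measurable [set x : R | a <= `|x|].
  rewrite -[X in measurable X]setTI.
  apply: (measurable_fun_le (f := cst a) (g := fun x : R => `|x|)) => //; exact: normr_measurable.
rewrite -[X in Prob X]/(X @^-1` [set x | a <= `|x|]) PX//.
have [s0|s0] := eqVneq s2 0.
  rewrite diracE memNset/= ?normr0; first by rewrite lee_fin mulr_ge0 ?sqrtr_ge0 ?expR_ge0.
  by apply/negP; rewrite -ltNge.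
have sp : 0 < s2 by rewrite lt_neqAle eq_sym s0.
pose s := Num.sqrt s2.
have s_gt0 : 0 < s by rewrite sqrtr_gt0.
have s2E : s ^+ 2 = s2 by rewrite sqr_sqrtr.
pose c := Num.sqrt 2 * expR (- (a ^+ 2 / (4 * t2))).
have c0 : 0 <= c by rewrite mulr_ge0 ?sqrtr_ge0 ?expR_ge0.
pose s' := Num.sqrt 2 * s.
have s'0 : 0 < s' by rewrite mulr_gt0 ?sqrtr_gt0.
have s'2E : s' ^+ 2 = 2 * s2 by rewrite exprMn sqr_sqrtr// s2E.
(* Half of the exponent pays for the tail, the other half is a Gaussian density of
   variance [2 * s2]. *)
have le_pdf x : a <= `|x| -> normal_pdf 0 s x <= c * normal_pdf 0 s' x.
  move=> ax; rewrite !normal_pdfE ?gt_eqF// /c.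
  have -> : normal_peak s = Num.sqrt 2 * normal_peak s'.
    rewrite /normal_peak; have -> : s' ^+ 2 * pi *+ 2 = 2 * (s ^+ 2 * pi *+ 2) by rewrite s2E s'2E; ring.
    by rewrite sqrtrM// invfM mulrA mulfV ?mul1r.
  rewrite -!mulrA ler_wpM2l ?sqrtr_ge0// mulrCA ler_wpM2l ?normal_peak_ge0//.
  rewrite /normal_fun !subr0 -expRD ler_expR s2E s'2E.
  have ax2 : a ^+ 2 <= x ^+ 2 by rewrite -(@real_normK _ x) ?num_real// lerXn2r// nnegrE ltW.
  have : a ^+ 2 / (4 * t2) <= x ^+ 2 / (4 * s2).
    apply: ler_pM; rewrite ?sqr_ge0 ?invr_ge0 ?(mulr_ge0 _ (ltW t20))//.
    by rewrite lef_pV2 ?posrE ?mulr_gt0// ler_pM2l.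
  rewrite -?expr2; have -> : - x ^+ 2 / (2 * s2 *+ 2) = - (x ^+ 2 / (4 * s2)).
    by field; rewrite gt_eqF.
  have -> : - x ^+ 2 / (s2 *+ 2) = - (x ^+ 2 / (4 * s2)) - (x ^+ 2 / (4 * s2)).
    by field; rewrite gt_eqF.
  lra.
rewrite /normal_prob.
apply: (@le_trans _ _ (\int[lebesgue_measure]_(x in [set x : R | (a <= `|x|)%R]) (c%:E * (normal_pdf 0 s' x)%:E))%E).
  apply: ge0_le_integral => //=.
  - by move=> x _; rewrite lee_fin normal_pdf_ge0.
  - exact: emeasurable_normal_pdf.
  - by apply: measurable_funeM; exact: emeasurable_normal_pdf.
rewrite ge0_integralZl//=; last 2 first.
  exact: emeasurable_normal_pdf.
  by move=> x _; rewrite lee_fin normal_pdf_ge0.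
rewrite -[leRHS]mule1 lee_wpmul2l//.
have : (normal_prob 0 s' [set x : R | (a <= `|x|)%R] <= 1)%E by exact: probability_le1.
exact.
Qed.

Lemma chebyshev_sq (R : realType) (d : measure_display) (Om : measurableType d)
    (mu : {measure set Om -> \bar R}) (D : Om -> R) (e : R) :
  measurable_fun setT D -> 0 < e ->
  (mu [set w | (e <= `|D w|)%R] <= (e ^- 2)%:E * \int[mu]_w ((D w) ^+ 2)%:E)%E.
Proof.
move=> mD e0.
have e20 : 0 < e ^+ 2 by rewrite exprn_gt0.
have mD2 : measurable_fun setT (fun w => ((D w) ^+ 2)%:E).
  by apply/measurable_EFinP; exact: measurable_funX.
have := @le_integral_abse _ _ _ mu _ measurableT _ _ mD2 e20.
rewrite setTI.
have -> : [set w | ((e ^+ 2)%:E <= `|(D w ^+ 2)%:E|)%E] = [set w | (e <= `|D w|)%R].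
  apply/seteqP; split => w /=; by rewrite lee_fin normrX ler_sqr// nnegrE ltW.
have -> : (\int[mu]_w `|(D w ^+ 2)%:E|%E = \int[mu]_w (D w ^+ 2)%:E)%E.
  by apply: eq_integral => w _; rewrite gee0_abs// lee_fin sqr_ge0.
by rewrite muleC -lee_pdivlMr// muleC.
Qed.

Section normal_limits.
Variable R : realType.

(** Dominated convergence of the densities: once [v n] lies between [s2 / 2] and [2 * s2], the
    density is at most twice the one of variance [2 * s2], because the peak at [s2 / 2] is twice the
    peak at [2 * s2]. *)
Lemma cvg_normal_prob (v : nat -> R) (s2 : R) (B : set (measurableTypeR R)) :
  0 < s2 -> v @ \oo --> s2 -> measurable B ->
  (fun n => normal_prob 0 (Num.sqrt (v n)) B) @ \oo --> normal_prob 0 (Num.sqrt s2) B.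
Proof.
move=> s20 vs mB.
have [N _ vN] : \forall n \near \oo, s2 / 2 < v n < 2 * s2.
  near=> n; apply/andP; split; near: n.
    by apply: (cvgr_gt _ vs); lra.
  by apply: (cvgr_lt _ vs); lra.
rewrite -(cvg_shiftn N).
have s0 : 0 < Num.sqrt (2 * s2) by rewrite sqrtr_gt0 mulr_gt0.
have pi2 : 0 < pi *+ 2 :> R by rewrite mulrn_wgt0// pi_gt0.
have pdfE (w x : R) : 0 < w -> normal_pdf 0 (Num.sqrt w) x =
    (Num.sqrt (w * (pi *+ 2)))^-1 * expR (- x ^+ 2 / (w * 2)).
  move=> w0; rewrite normal_pdfE ?gt_eqF ?sqrtr_gt0//.
  by rewrite /normal_peak /normal_fun subr0 sqr_sqrtr ?ltW// -mulrnAr (mulr_natr w 2).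
have vb n : s2 / 2 < v (n + N)%N < 2 * s2 by apply: vN; rewrite /= leq_addl.
have vp n : 0 < v (n + N)%N.
  by have /andP[+ _] := vb n; apply: lt_trans; rewrite divr_gt0.
have [] := @dominated_convergence _ _ R lebesgue_measure B mB
  (fun n x => (normal_pdf 0 (Num.sqrt (v (n + N)%N)) x)%:E)
  (fun x => (normal_pdf 0 (Num.sqrt s2) x)%:E)
  (fun x => (2 * normal_pdf 0 (Num.sqrt (2 * s2)) x)%:E).
- by move=> n; exact: emeasurable_normal_pdf.
- exact: emeasurable_normal_pdf.
- apply: aeW => x _; apply: cvg_EFin; first exact: nearW.
  rewrite pdfE//; under eq_fun do rewrite pdfE//.
  have vs' : (fun n => v (n + N)%N) @ \oo --> s2 by rewrite (cvg_shiftn N).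
  apply: cvgM.
    apply: cvgV; first by rewrite gt_eqF// sqrtr_gt0 mulr_gt0.
    apply: (cvg_comp (fun n => v (n + N)%N * (pi *+ 2)) Num.sqrt); last exact: sqrt_continuous.
    by apply: cvgM => //; exact: cvg_cst.
  apply: (cvg_comp (fun n => - x ^+ 2 / (v (n + N)%N * 2)) expR); last exact: continuous_expR.
  apply: cvgM; first exact: cvg_cst.
  apply: cvgV; first by rewrite gt_eqF// mulr_gt0.
  by apply: cvgM => //; exact: cvg_cst.
- rewrite (_ : (fun x => _) = (fun x => 2%:E * (normal_pdf 0 (Num.sqrt (2 * s2)) x)%:E)%E); last first.
    by apply/funext => x; rewrite EFinM.
  by apply: integrableZl => //; apply: (integrableS measurableT) => //; exact: integrable_normal_pdf.
- apply: aeW => x n _ /=; rewrite lee_fin ger0_norm ?normal_pdf_ge0//.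
  have /andP[v1 v2] := vb n.
  rewrite !pdfE ?mulr_gt0// mulrA; apply: ler_pM; rewrite ?expR_ge0 ?invr_ge0 ?sqrtr_ge0//.
    have -> : 2 * s2 * (pi *+ 2) = 2 ^+ 2 * ((s2 / 2) * (pi *+ 2)) by field.
    rewrite (sqrtrM (s2 / 2 * (pi *+ 2)) (sqr_ge0 2)) sqrtr_sqr ger0_norm// invfM mulrA mulfV// mul1r.
    rewrite lef_pV2 ?posrE ?sqrtr_gt0 ?mulr_gt0 ?divr_gt0//.
    by rewrite ler_wsqrtr// ler_pM2r// ltW.
  rewrite ler_expR !mulNr lerN2 ler_wpM2l ?sqr_ge0//.
  by rewrite lef_pV2 ?posrE ?mulr_gt0// ler_pM2r// ltW.
by move=> _ _.
Unshelve. all: by end_near. Qed.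

(** The density is bounded by its peak. This continuity of the distribution function lets a
    threshold be shifted by a small amount when passing to a limit law. *)
Lemma normal_prob_ray_le (s a e : R) : 0 < s -> 0 < e ->
  (normal_prob 0 s `](a - e)%R, +oo[ <= normal_prob 0 s `]a, +oo[ + (normal_peak s * e)%:E)%E.
Proof.
move=> s0 e0.
have -> : `]a - e, +oo[%classic = `]a - e, a]%classic `|` `]a, +oo[%classic :> set (measurableTypeR R).
  by rewrite -itv_bndbnd_setU// bnd_simp lerBlDr lerDl ltW.
rewrite addeC (le_trans (measureU2 _ _ _))// leeD2r//.
rewrite /normal_prob.
apply: (@le_trans _ _ (\int[lebesgue_measure]_(x in `](a - e)%R, a]) (cst (normal_peak s)%:E) x)%E).
  apply: ge0_le_integral => //=.
  - by move=> x _; rewrite lee_fin normal_pdf_ge0.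
  - exact: emeasurable_normal_pdf.
  - by move=> x _; rewrite lee_fin normal_pdf_ub// gt_eqF.
rewrite integral_cst//= lebesgue_measure_itv/= lte_fin ltrBlDr ltrDl e0 -EFinB -EFinM lee_fin.
by rewrite opprB addrC subrK.
Qed.
End normal_limits.

Lemma measure_eq_rays (R : realType) (m1 m2 : {measure set (measurableTypeR R) -> \bar R}) :
  (forall a : R, m1 `]a, +oo[%classic < +oo)%E ->
  (forall a : R, m1 `]a, +oo[%classic = m2 `]a, +oo[%classic) ->
  forall B, measurable B -> m1 B = m2 B.
Proof.
move=> fin m12 B mB.
apply: (@measure_unique _ R (measurableTypeR R) [set A | exists x : R, A = `]x, +oo[%classic]
  (fun n => `]- n%:R, +oo[%classic) _ _ _ _ m1 m2 _ _ B mB) => //.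
- exact: RGenOInfty.measurableE.
- move=> _ _ [x ->] [y ->]; exists (Num.max x y).
  by apply/seteqP; split => z /=; rewrite !in_itv/= !andbT gt_max => /andP//.
- by move=> n; exists (- n%:R).
- apply/seteqP; split => // x _; exists (Num.truncn `|x|).+1 => //=.
  rewrite in_itv/= andbT ltrNl (le_lt_trans (ler_norm _))// normrN.
  by exact: truncnS_gt.
- by move=> _ [x ->]; exact: m12.
Qed.

(** The limit law is identified on rays: Chebyshev compares [I] and [I_ n] at slightly shifted
    thresholds, and the normal distribution function is insensitive to the shift. The case [s2 = 0]
    is separate since the law is then a Dirac mass; there [I] vanishes almost surely. *)
Lemma gaussian_rv_L2_limit (R : realType) (d : measure_display) (Om : measurableType d)
    (Prob : probability Om R) (I_ : nat -> Om -> R) (v : nat -> R) (I : Om -> R) (s2 : R) :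
  (forall n, 0 <= v n) -> (forall n, gaussian_rv Prob (I_ n) 0 (v n)) ->
  measurable_fun setT I -> v @ \oo --> s2 ->
  (fun n => \int[Prob]_w ((I_ n w - I w) ^+ 2)%:E)%E @ \oo --> 0%E ->
  gaussian_rv Prob I 0 s2.
Proof.
move=> v0 gI mI vs II; split => //.
have mI_ n : measurable_fun setT (I_ n) by case: (gI n).
have mD n : measurable_fun setT (fun w => I_ n w - I w) by exact: measurable_funB.
have s20 : 0 <= s2 by rewrite -(cvg_lim _ vs)//; apply: limr_ge; [apply/cvg_ex; exists s2|exact: nearW].
have [s0|sN0] := eqVneq s2 0.
  have I0 : (\int[Prob]_w ((I w) ^+ 2)%:E = 0)%E.
    apply/eqP; rewrite eq_le integral_ge0 ?andbT; last by move=> w _; rewrite lee_fin sqr_ge0.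
    (* This sequence dominates the second moment of [I], because
       [2 * (x - y) ^+ 2 + 2 * x ^+ 2 - y ^+ 2] is the square of [2 * x - y]. *)
    have lim0 : (2%:E * \int[Prob]_w ((I_ n w - I w) ^+ 2)%:E + 2%:E * (v n)%:E)%E @[n --> \oo] --> 0%E.
      rewrite [X in _ --> X](_ : _ = (2%:E * 0 + 2%:E * s2%:E)%E); last by rewrite s0 !mule0 adde0.
      apply: cvgeD; first by rewrite s0 !mule0.
        exact: cvgeZl.
      by apply: cvgeZl => //; apply: cvg_EFin => //; exact: nearW.
    rewrite -(cvg_lim _ lim0)//; apply: lime_ge; first by apply/cvg_ex; exists 0%E.
    apply: nearW => n.
    rewrite -(gaussian_rv_second_moment (v0 n) (gI n)).
    rewrite -!ge0_integralZl//=; last 4 first.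
    - by apply/measurable_EFinP; exact: measurable_funX.
    - by move=> w _; rewrite lee_fin sqr_ge0.
    - by apply/measurable_EFinP; exact: measurable_funX.
    - by move=> w _; rewrite lee_fin sqr_ge0.
    rewrite -ge0_integralD//=; last 4 first.
    - by move=> w _; rewrite -EFinM lee_fin mulr_ge0// sqr_ge0.
    - by apply: measurable_funeM; apply/measurable_EFinP; exact: measurable_funX.
    - by move=> w _; rewrite -EFinM lee_fin mulr_ge0// sqr_ge0.
    - by apply: measurable_funeM; apply/measurable_EFinP; exact: measurable_funX.
    apply: ge0_le_integral => //=.
    - by move=> w _; rewrite lee_fin sqr_ge0.
    - by apply/measurable_EFinP; exact: measurable_funX.
    - by apply: emeasurable_funD; apply: measurable_funeM; apply/measurable_EFinP; exact: measurable_funX.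
    - move=> w _; rewrite -!EFinM -EFinD lee_fin -subr_ge0.
      rewrite (_ : _ - _ = (2 * I_ n w - I w) ^+ 2) ?sqr_ge0//; ring.
  have : (\int[Prob]_w `|((I w) ^+ 2)%:E| = 0)%E.
    by rewrite -I0; apply: eq_integral => w _; rewrite gee0_abs// lee_fin sqr_ge0.
  have msq : measurable_fun setT (fun w => ((I w) ^+ 2)%:E).
    by apply/measurable_EFinP; exact: measurable_funX.
  move=> /(ae_eq_integral_abs _ measurableT msq) H.
  move=> B mB.
  have mIB : measurable (I @^-1` B) by rewrite -[X in measurable X]setTI; exact: mI.
  have mI0 : measurable [set w | I w != 0].
    rewrite (_ : [set w | _] = I @^-1` (~` [set 0])).
      by rewrite -[X in measurable X]setTI; apply: mI => //; apply: measurableC.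
    by apply/seteqP; split => w /=; move=> /eqP.
  have PN : Prob [set w | I w != 0] = 0%E.
    move: H => [N [mN N0 sub]].
    apply/eqP; rewrite eq_le measure_ge0 andbT -N0 le_measure ?inE//.
    move=> w /= Iw; apply: sub => /= /(_ Logic.I) [] /eqP; rewrite mulf_eq0 orbb.
    by rewrite (negbTE Iw).
  rewrite diracE; have [B0|B0] := boolP (0 \in B).
    have -> : Prob (I @^-1` B) = (1 - Prob (~` (I @^-1` B)))%E.
      by rewrite probability_setC// oppeB// ?fin_num_adde_defl// addeA subee// add0e.
    suff -> : Prob (~` (I @^-1` B)) = 0%E by rewrite sube0.
    apply/eqP; rewrite eq_le measure_ge0 andbT -PN le_measure ?inE//; first exact: measurableC.
    move=> w /= IB; apply/eqP => Iw0; apply: IB; rewrite Iw0; exact/set_mem.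
  apply/eqP; rewrite eq_le measure_ge0 andbT -[leRHS]PN le_measure ?inE//.
  by move=> w /= IB; apply/eqP => Iw0; move/negP: B0; apply; rewrite inE -Iw0.
have sp : 0 < s2 by rewrite lt_neqAle eq_sym sN0.
pose s := Num.sqrt s2.
have s_gt0 : 0 < s by rewrite sqrtr_gt0.
have mpre (J : Om -> R) (a : R) : measurable_fun setT J -> measurable (J @^-1` `]a, +oo[).
  by move=> mJ; rewrite -[X in measurable X]setTI; exact: mJ.
(* If [J] exceeds [a], then [K] exceeds [a - e] or the two differ by at least [e]. It serves with
   [I] and [I_ n] in both roles, for the upper and the lower bound. *)
have union (J K : Om -> R) (a e : R) : measurable_fun setT J -> measurable_fun setT K -> 0 < e ->
   (Prob (J @^-1` `]a, +oo[) <= Prob (K @^-1` `](a - e)%R, +oo[) +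
      (e ^- 2)%:E * \int[Prob]_w ((K w - J w) ^+ 2)%:E)%E.
  move=> mJ mK e0.
  have mKJ : measurable_fun setT (fun w => K w - J w) by exact: measurable_funB.
  apply: (@le_trans _ _ (Prob (K @^-1` `](a - e)%R, +oo[) + Prob [set w | (e <= `|K w - J w|)%R])%E); last first.
    by apply: leeD2l; exact: chebyshev_sq.
  have mE : measurable [set w | (e <= `|K w - J w|)%R].
    rewrite -[X in measurable X]setTI.
    by apply: (measurable_fun_le (f := cst e) (g := fun w => `|K w - J w|)) => //; exact: measurableT_comp.
  apply: (@le_trans _ _ (Prob (K @^-1` `](a - e)%R, +oo[ `|` [set w | (e <= `|K w - J w|)%R]))).
    apply: le_measure; rewrite ?inE//; [exact: mpre|exact: measurableU (mpre _ _ mK) mE|].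
    move=> w /=; rewrite !in_itv/= !andbT => aJ.
    have [eK|eK] := leP e `|K w - J w|; [by right|left].
    have := ler_norm (J w - K w); rewrite distrC; lra.
  exact: (measureU2 Prob (mpre _ _ mK) mE).
have lim_ray a : (fun n => Prob (I_ n @^-1` `]a, +oo[)) @ \oo --> normal_prob 0 s `]a, +oo[.
  have := @cvg_normal_prob R v s2 `]a, +oo[%classic sp vs (measurable_itv _).
  apply: cvg_trans; apply: near_eq_cvg; near=> n.
  case: (gI n) => _ ->; last exact: measurable_itv.
  rewrite gt_eqF//; near: n; exact: (cvgr_gt _ vs).
have limD e : ((e ^- 2)%:E * \int[Prob]_w ((I_ n w - I w) ^+ 2)%:E)%E @[n --> \oo] --> 0%E.
  by rewrite -(mule0 (e ^- 2)%:E); apply: cvgeZl.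
have limD' e : ((e ^- 2)%:E * \int[Prob]_w ((I w - I_ n w) ^+ 2)%:E)%E @[n --> \oo] --> 0%E.
  apply: cvg_trans (limD e); apply: near_eq_cvg; apply: nearW => n; congr (_ * _)%E.
  by apply: eq_integral => w _; rewrite -sqrrN opprB.
have fray a : normal_prob 0 s `]a, +oo[ \is a fin_num by exact: fin_num_measure.
have ray a : Prob (I @^-1` `]a, +oo[) = normal_prob 0 s `]a, +oo[.
  have fI : Prob (I @^-1` `]a, +oo[) \is a fin_num by apply: fin_num_measure; exact: mpre.
  apply/eqP; rewrite eq_le; apply/andP; split; apply/lee_addgt0Pr => e e0.
    (* Shifting the ray by [e'] costs at most [normal_peak s * e'], that is [e]. *)
    pose e' := e / normal_peak s.
    have pk : 0 < normal_peak s by rewrite normal_peak_gt0// gt_eqF.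
    have e'0 : 0 < e' by rewrite divr_gt0.
    apply: (@le_trans _ _ (normal_prob 0 s `](a - e')%R, +oo[)); last first.
      by rewrite (le_trans (normal_prob_ray_le _ s_gt0 e'0))// leeD2l// lee_fin /e' mulrC divfK// gt_eqF.
    have L : (Prob (I_ n @^-1` `](a - e')%R, +oo[) + (e' ^- 2)%:E * \int[Prob]_w ((I_ n w - I w) ^+ 2)%:E)%E @[n --> \oo]
       --> (normal_prob 0 s `](a - e')%R, +oo[ + 0)%E.
      by apply: cvgeD => //; rewrite fin_num_adde_defl.
    rewrite -[leRHS]adde0 -(cvg_lim _ L)//; apply: lime_ge; first by apply/cvg_ex; eexists; exact: L.
    by apply: nearW => n; exact: union.
  pose e' := e / normal_peak s.
  have pk : 0 < normal_peak s by rewrite normal_peak_gt0// gt_eqF.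
  have e'0 : 0 < e' by rewrite divr_gt0.
  have L : (Prob (I @^-1` `]a, +oo[) + (e' ^- 2)%:E * \int[Prob]_w ((I w - I_ n w) ^+ 2)%:E)%E @[n --> \oo]
       --> (Prob (I @^-1` `]a, +oo[) + 0)%E.
    by apply: cvgeD; [rewrite fin_num_adde_defl|exact: cvg_cst|].
  have L2 : (normal_prob 0 s `](a + e')%R, +oo[ <= Prob (I @^-1` `]a, +oo[))%E.
    rewrite -[leRHS]adde0 -(cvg_lim _ L)// -(cvg_lim _ (lim_ray (a + e')))//.
    apply: lee_lim; [by apply/cvg_ex; eexists; exact: lim_ray|by apply/cvg_ex; eexists; exact: L|].
    apply: nearW => n; have := union (I_ n) I (a + e') e' (mI_ n) mI e'0.
    by rewrite addrK.
  have := normal_prob_ray_le (a + e') s_gt0 e'0; rewrite addrK => /le_trans; apply.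
  by rewrite leeD// lee_fin /e' mulrC divfK// gt_eqF.
pose X' : {mfun Om >-> measurableTypeR R} := HB.pack I (isMeasurableFun.Build _ _ _ (measurableTypeR R) I mI).
move=> B mB; have := @measure_eq_rays R (distribution Prob X') (normal_prob 0 s) _ _ B mB.
apply => a; last exact: ray.
by rewrite (le_lt_trans (probability_le1 _ _))// ?ltry//.
Unshelve. all: by end_near. Qed.

(** * Square-integrable functions and Wiener integrals *)

Section square_integrable.
Context (R : realType) (d : measure_display) (T : measurableType d).
Implicit Types (mu : {measure set T -> \bar R}) (f g : T -> R).

Lemma measurable_EFin_sq f : measurable_fun setT f ->
  measurable_fun setT (fun x => ((f x) ^+ 2)%:E).
Proof. by move=> mf; apply/measurable_EFinP; exact: measurable_funX. Qed.

Lemma integral_sq_ge0 mu f : (0 <= \int[mu]_x ((f x) ^+ 2)%:E)%E.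
Proof. by apply: integral_ge0 => x _; rewrite lee_fin sqr_ge0. Qed.

Lemma integral_sq_le_lin mu (f g h : T -> R) (a b : R) : 0 <= a -> 0 <= b ->
  measurable_fun setT f -> measurable_fun setT g -> measurable_fun setT h ->
  (forall x, (h x) ^+ 2 <= a * (f x) ^+ 2 + b * (g x) ^+ 2) ->
  (\int[mu]_x ((h x) ^+ 2)%:E <=
    a%:E * \int[mu]_x ((f x) ^+ 2)%:E + b%:E * \int[mu]_x ((g x) ^+ 2)%:E)%E.
Proof.
move=> a0 b0 mf mg mh le.
rewrite -!ge0_integralZl//=; [|exact: measurable_EFin_sq|by move=> x _; rewrite lee_fin sqr_ge0
  |exact: measurable_EFin_sq|by move=> x _; rewrite lee_fin sqr_ge0].
rewrite -ge0_integralD//=; last 4 first.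
- by move=> x _; rewrite -EFinM lee_fin mulr_ge0// sqr_ge0.
- by apply: measurable_funeM; exact: measurable_EFin_sq.
- by move=> x _; rewrite -EFinM lee_fin mulr_ge0// sqr_ge0.
- by apply: measurable_funeM; exact: measurable_EFin_sq.
apply: ge0_le_integral => //=.
- by move=> x _; rewrite lee_fin sqr_ge0.
- exact: measurable_EFin_sq.
- by apply: emeasurable_funD; apply: measurable_funeM; exact: measurable_EFin_sq.
by move=> x _; rewrite -!EFinM -EFinD lee_fin.
Qed.

Lemma L2_linear mu f g (c : R) : measurable_fun setT f -> measurable_fun setT g ->
  (\int[mu]_x ((f x) ^+ 2)%:E < +oo)%E -> (\int[mu]_x ((g x) ^+ 2)%:E < +oo)%E ->
  (\int[mu]_x ((f x + c * g x) ^+ 2)%:E < +oo)%E.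
Proof.
move=> mf mg f2 g2.
have mh : measurable_fun setT (fun x => f x + c * g x).
  by apply: measurable_funD => //; exact: measurable_funM.
apply: (le_lt_trans (@integral_sq_le_lin mu f g _ 2 (2 * c ^+ 2) _ _ mf mg mh _)) => //.
- by rewrite mulr_ge0// sqr_ge0.
- move=> x; rewrite -subr_ge0 (_ : _ - _ = (f x - c * g x) ^+ 2) ?sqr_ge0//; ring.
- apply: lte_add_pinfty; first by apply: lte_mul_pinfty.
  by apply: lte_mul_pinfty => //; rewrite lee_fin mulr_ge0// sqr_ge0.
Qed.

Lemma L2_cvg0_linear mu (f g : nat -> T -> R) (c : R) :
  (forall n, measurable_fun setT (f n)) -> (forall n, measurable_fun setT (g n)) ->
  (\int[mu]_x ((f n x) ^+ 2)%:E)%E @[n --> \oo] --> 0%E ->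
  (\int[mu]_x ((g n x) ^+ 2)%:E)%E @[n --> \oo] --> 0%E ->
  (\int[mu]_x ((f n x + c * g n x) ^+ 2)%:E)%E @[n --> \oo] --> 0%E.
Proof.
move=> mf mg f0 g0.
apply: (@squeeze_cvge _ _ _ _ (cst 0%E) _ (fun n => 2%:E * \int[mu]_x ((f n x) ^+ 2)%:E +
   (2 * c ^+ 2)%:E * \int[mu]_x ((g n x) ^+ 2)%:E)%E); last 2 first.
- exact: cvg_cst.
- rewrite [X in _ --> X](_ : _ = 2%:E * 0 + (2 * c ^+ 2)%:E * 0)%E; last by rewrite !mule0 adde0.
  by apply: cvgeD; [rewrite !mule0|exact: cvgeZl|exact: cvgeZl].
apply: nearW => n; rewrite integral_sq_ge0/=; apply: integral_sq_le_lin => //.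
- by rewrite mulr_ge0// sqr_ge0.
- by apply: measurable_funD => //; exact: measurable_funM.
- move=> x; rewrite -subr_ge0 (_ : _ - _ = (f n x - c * g n x) ^+ 2) ?sqr_ge0//; ring.
Qed.

(** The triangle inequality of the L2 norm is replaced by its weighted square form, with factors
    [1 + e] and [1 + e^-1], applied once in each direction. *)
Lemma L2_cvg_sq mu (f : nat -> T -> R) (g : T -> R) :
  (forall n, measurable_fun setT (f n)) -> measurable_fun setT g ->
  (forall n, \int[mu]_x ((f n x) ^+ 2)%:E < +oo)%E ->
  (\int[mu]_x ((g x) ^+ 2)%:E < +oo)%E ->
  (\int[mu]_x ((f n x - g x) ^+ 2)%:E)%E @[n --> \oo] --> 0%E ->
  (fine (\int[mu]_x ((f n x) ^+ 2)%:E)%E) @[n --> \oo] --> fine (\int[mu]_x ((g x) ^+ 2)%:E)%E.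
Proof.
move=> mf mg f2 g2 fg.
set F := fine (\int[mu]_x ((g x) ^+ 2)%:E)%E.
pose v n := fine (\int[mu]_x ((f n x) ^+ 2)%:E)%E.
pose D n := fine (\int[mu]_x ((f n x - g x) ^+ 2)%:E)%E.
have D2 n : (\int[mu]_x ((f n x - g x) ^+ 2)%:E < +oo)%E.
  have := L2_linear (-1) (mf n) mg (f2 n) g2.
  by under eq_integral do rewrite mulN1r.
have mD n : measurable_fun setT (fun x => f n x - g x) by exact: measurable_funB.
have FE : (\int[mu]_x ((g x) ^+ 2)%:E)%E = F%:E.
  by rewrite fineK// ge0_fin_numE// integral_sq_ge0.
have vE n : (\int[mu]_x ((f n x) ^+ 2)%:E)%E = (v n)%:E.
  by rewrite fineK// ge0_fin_numE// integral_sq_ge0.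
have DE n : (\int[mu]_x ((f n x - g x) ^+ 2)%:E)%E = (D n)%:E.
  by rewrite fineK// ge0_fin_numE// integral_sq_ge0.
have F0 : 0 <= F by rewrite -lee_fin -FE integral_sq_ge0.
have v0 n : 0 <= v n by rewrite -lee_fin -vE integral_sq_ge0.
have D0 n : 0 <= D n by rewrite -lee_fin -DE integral_sq_ge0.
have le1 n e : 0 < e -> v n <= (1 + e) * F + (1 + e^-1) * D n.
  move=> e0; rewrite -lee_fin EFinD !EFinM -vE -FE -DE.
  apply: integral_sq_le_lin => //; rewrite ?addr_ge0 ?invr_ge0 ?(ltW e0)//.
  move=> x; rewrite -subr_ge0 (_ : _ - _ = e^-1 * (e * g x - (f n x - g x)) ^+ 2).
    by rewrite mulr_ge0 ?sqr_ge0// invr_ge0 ltW.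
  by field; rewrite gt_eqF.
have le2 n e : 0 < e -> F <= (1 + e) * v n + (1 + e^-1) * D n.
  move=> e0; rewrite -lee_fin EFinD !EFinM -vE -FE -DE.
  apply: integral_sq_le_lin => //; rewrite ?addr_ge0 ?invr_ge0 ?(ltW e0)//.
  move=> x; rewrite -subr_ge0 (_ : _ - _ = e^-1 * (e * f n x + (f n x - g x)) ^+ 2).
    by rewrite mulr_ge0 ?sqr_ge0// invr_ge0 ltW.
  by field; rewrite gt_eqF.
have Dlim : D @ \oo --> (0 : R).
  by apply: (@fine_cvg _ _ _ _ _ 0).
apply/cvgrPdist_le => h h0.
(* This makes [e * (F + h + 1) <= h / 4]. The first inequality then yields [v n <= F + h], and with
   it [e * v n] in the second inequality is at most [h / 4]. *)
pose e := Num.min 1 (h / (4 * (F + h + 1))).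
have q0 : 0 < h / (4 * (F + h + 1)) by rewrite divr_gt0// mulr_gt0//; lra.
have e0 : 0 < e by rewrite lt_min ltr01.
have eF : e * (F + h + 1) <= h / 4.
  apply: (@le_trans _ _ (h / (4 * (F + h + 1)) * (F + h + 1))).
    by rewrite ler_pM2r ?ge_min ?lexx ?orbT//; lra.
  by rewrite le_eqVlt; apply/orP; left; apply/eqP; field; rewrite gt_eqF//; lra.
have K0 : 0 < 1 + e^-1 by rewrite addr_gt0// invr_gt0.
near=> n.
have Dn : (1 + e^-1) * D n <= h / 4.
  rewrite mulrC -ler_pdivlMr//; near: n.
  by apply: (cvgr_le _ Dlim); rewrite !divr_gt0.
have h1 := le1 n e e0; have h2 := le2 n e e0.
rewrite (mulrDl 1 e) mul1r in h1; rewrite (mulrDl 1 e) mul1r in h2.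
rewrite -/(v n).
have eF1 : e * F + e * h + e <= h / 4 by move: eF; rewrite !mulrDr mulr1.
have eh0 : 0 <= e * h by rewrite mulr_ge0// ltW.
have eF0 : 0 <= e * F by rewrite mulr_ge0// ltW.
have vn : v n <= F + h by lra.
have : e * v n <= e * F + e * h by rewrite -mulrDr ler_pM2l.
rewrite ler_norml; lra.
Unshelve. all: by end_near. Qed.

Lemma L2_mul_integrable mu f g : measurable_fun setT f -> measurable_fun setT g ->
  (\int[mu]_x ((f x) ^+ 2)%:E < +oo)%E -> (\int[mu]_x ((g x) ^+ 2)%:E < +oo)%E ->
  mu.-integrable setT (fun x => (f x * g x)%:E).
Proof.
move=> mf mg f2 g2.
have i2 (h : T -> R) : measurable_fun setT h -> (\int[mu]_x ((h x) ^+ 2)%:E < +oo)%E ->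
    mu.-integrable setT (fun x => ((h x) ^+ 2)%:E).
  move=> mh h2; apply/integrableP; split; first exact: measurable_EFin_sq.
  by under eq_integral do rewrite gee0_abs ?lee_fin ?sqr_ge0//.
apply: (le_integrable measurableT _ _ (integrableD measurableT (i2 _ mf f2) (i2 _ mg g2))).
  by apply/measurable_EFinP; exact: measurable_funM.
move=> x _ /=; rewrite lee_fin normrM [leRHS]ger0_norm ?addr_ge0 ?sqr_ge0//.
rewrite -(@real_normK _ (f x)) ?num_real// -(@real_normK _ (g x)) ?num_real//.
rewrite -subr_ge0 (_ : _ - _ = ((`|f x| - `|g x|) ^+ 2 + `|f x| ^+ 2 + `|g x| ^+ 2) / 2); last by field.
by rewrite divr_ge0// !addr_ge0// sqr_ge0.
Qed.

(** Transfers the isometry from squares to products. The factors [1] and [-1] are kept explicit to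
    match the linear combinations of [isonormal_linear]. *)
Lemma L2_polarization mu f g : measurable_fun setT f -> measurable_fun setT g ->
  (\int[mu]_x ((f x) ^+ 2)%:E < +oo)%E -> (\int[mu]_x ((g x) ^+ 2)%:E < +oo)%E ->
  (\int[mu]_x (f x * g x)%:E = (4^-1)%:E * (\int[mu]_x ((f x + 1 * g x) ^+ 2)%:E -
     \int[mu]_x ((f x + (-1) * g x) ^+ 2)%:E))%E.
Proof.
move=> mf mg f2 g2.
have i2 (c : R) : mu.-integrable setT (EFin \o (fun x => (f x + c * g x) ^+ 2)).
  apply/integrableP; split.
    by apply: measurable_EFin_sq; apply: measurable_funD => //; exact: measurable_funM.
  under eq_integral do rewrite gee0_abs ?lee_fin ?sqr_ge0//.
  exact: L2_linear.
rewrite -integralB_EFin// -integralZl//=; last exact: integrableB (i2 1) (i2 (-1)).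
by apply: eq_integral => x _; rewrite -EFinB -EFinM; congr EFin; field.
Qed.
End square_integrable.

(** * Step functions and their density in L2 *)

Section step_functions.
Context (R : realType) (d : measure_display) (S : measurableType d)
  (mu : {measure set S -> \bar R}).
Implicit Types (s t : seq (R * set S)) (f : S -> R).

Definition scale_comb (c : R) s : seq (R * set S) := [seq (c * q.1, q.2) | q <- s].

Lemma step_fun_cat s t p : step_fun (s ++ t) p = step_fun s p + step_fun t p.
Proof. by rewrite /step_fun big_cat. Qed.

Lemma step_fun_scale c s p : step_fun (scale_comb c s) p = c * step_fun s p.
Proof. by rewrite /step_fun big_map mulr_sumr; apply: eq_bigr => q _; rewrite mulrA. Qed.

Lemma noise_comb_cat (Om : Type) (W : set S -> Om -> R) s t w :
  noise_comb W (s ++ t) w = noise_comb W s w + noise_comb W t w.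
Proof. by rewrite /noise_comb big_cat. Qed.

Lemma noise_comb_scale (Om : Type) (W : set S -> Om -> R) c s w :
  noise_comb W (scale_comb c s) w = c * noise_comb W s w.
Proof. by rewrite /noise_comb big_map mulr_sumr; apply: eq_bigr => q _; rewrite mulrA. Qed.

Lemma finite_sets_cat s t : finite_sets mu s -> finite_sets mu t -> finite_sets mu (s ++ t).
Proof. by move=> hs ht q; rewrite mem_cat => /orP[/hs|/ht]. Qed.

Lemma finite_sets_scale c s : finite_sets mu s -> finite_sets mu (scale_comb c s).
Proof. by move=> hs q /mapP[r /hs rs ->]. Qed.

Lemma measurable_step_fun s : finite_sets mu s -> measurable_fun setT (step_fun s).
Proof.
elim: s => [_|q s ih hs].
  by rewrite (_ : step_fun _ = cst 0)//; apply/funext => p; rewrite /step_fun big_nil.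
rewrite (_ : step_fun _ = (fun p => q.1 * \1_(q.2) p + step_fun s p)); last first.
  by apply/funext => p; rewrite /step_fun big_cons.
apply: measurable_funD.
  apply: measurable_funM => //; apply: measurable_indic.
  by have [] := hs q (mem_head _ _).
by apply: ih => r rs; apply: hs; rewrite inE rs orbT.
Qed.

(** The right-hand side is the variance that [gaussian_white_noise] assigns to [noise_comb W s]:
    this is the isometry for step functions. *)
Lemma integral_step_sq s : finite_sets mu s ->
  (\int[mu]_p ((step_fun s p) ^+ 2)%:E =
   (\sum_(q <- s) \sum_(q' <- s) q.1 * q'.1 * fine (mu (q.2 `&` q'.2)))%:E)%E.
Proof.
move=> hs.
have fin q q' : q \in s -> q' \in s -> measurable (q.2 `&` q'.2) /\ (mu (q.2 `&` q'.2) < +oo)%E.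
  move=> /hs[mq qoo] /hs[mq' _]; split; first exact: measurableI.
  by apply: le_lt_trans qoo; apply: le_measure (@subIsetl _ _ _); rewrite inE//; exact: measurableI.
have ind q q' : q \in s -> q' \in s ->
   mu.-integrable setT (fun p => (q.1 * q'.1 * \1_(q.2 `&` q'.2) p)%:E).
  move=> qs q's; have [m f] := fin _ _ qs q's.
  under eq_fun do rewrite EFinM.
  apply: integrableZl => //; apply/integrableP; split; first exact/measurable_EFinP/measurable_indic.
  under eq_integral do rewrite gee0_abs ?lee_fin//.
  by rewrite integral_indic// setIT.
pose q (i : 'I_(size s)) := nth (0, set0) s i.
have qs i : q i \in s by exact: mem_nth.
transitivity (\int[mu]_p (\sum_i \sum_j ((q i).1 * (q j).1 * \1_((q i).2 `&` (q j).2) p)%:E))%E.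
  apply: eq_integral => p _.
  under [RHS]eq_bigr do rewrite sumEFin.
  rewrite sumEFin; congr EFin.
  rewrite /step_fun (big_nth (0, set0)) big_mkord expr2 mulr_suml; apply: eq_bigr => i _.
  by rewrite mulr_sumr; apply: eq_bigr => j _; rewrite indicI/= mulrACA.
rewrite integral_sum//; last first.
  by move=> i; apply: integrable_sum => // j _; exact: ind.
rewrite [in RHS](big_nth (0, set0)) big_mkord -sumEFin; apply: eq_bigr => i _.
rewrite integral_sum//; last by move=> j; exact: ind.
rewrite [in RHS](big_nth (0, set0)) big_mkord -sumEFin; apply: eq_bigr => j _.
have [m f] := fin _ _ (qs i) (qs j).
under eq_integral do rewrite EFinM.
rewrite integralZl//; last first.
  apply/integrableP; split; first exact/measurable_EFinP/measurable_indic.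
  under eq_integral do rewrite gee0_abs ?lee_fin//.
  by rewrite integral_indic// setIT.
by rewrite integral_indic// setIT [RHS]EFinM fineK// ge0_fin_numE.
Qed.

(** The value [0] is dropped because its level set may have infinite measure; every other level set
    has finite measure by Chebyshev. *)
Lemma nnsfun_step (h : {nnsfun S >-> R}) : (\int[mu]_x ((h x) ^+ 2)%:E < +oo)%E ->
  exists s, finite_sets mu s /\ forall p, step_fun s p = h p.
Proof.
move=> h2.
pose A := range h `\ 0.
have finA : finite_set A by apply: finite_setD; exact: fimfunP.
exists [seq (r, h @^-1` [set r]) | r <- fset_set A]; split.
  move=> q /mapP[r]; rewrite in_fset_set// => /set_mem [_ r0] ->/=.
  split => //.
  have r0' : 0 < `|r| by rewrite normr_gt0; apply/eqP.
  have := @chebyshev_sq R d S mu h `|r| (measurable_funP h) r0'.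
  move=> H; apply: (@le_lt_trans _ _ (mu [set w | (`|r| <= `|h w|)%R])).
    apply: le_measure; rewrite ?inE//.
      rewrite -[X in measurable X]setTI.
      by apply: (measurable_fun_le (f := cst `|r|) (g := fun w => `|h w|)) => //; exact: measurableT_comp.
    by move=> w /= ->.
  by apply: (le_lt_trans H); apply: lte_mul_pinfty.
move=> p; rewrite /step_fun big_map/= -fsbig_finite// [in RHS]fimfunE.
rewrite (fsbig_widen A (range h))//.
  by move=> x [].
move=> r [rh /= /not_andP[//|/contrapT ->]] /=.
by rewrite mul0r.
Qed.

(** The positive and negative parts are approximated from below separately. The error is then at
    most [f ^+ 2] in square, which is what dominated convergence needs. *)
Lemma L2_step_dense f : measurable_fun setT f -> (\int[mu]_p ((f p) ^+ 2)%:E < +oo)%E ->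
  exists g : nat -> seq (R * set S), (forall n, finite_sets mu (g n)) /\
   (\int[mu]_p ((step_fun (g n) p - f p) ^+ 2)%:E)%E @[n --> \oo] --> 0%E.
Proof.
move=> mf f2.
have pos (h : S -> R) : measurable_fun setT h -> (forall x, 0 <= h x <= `|f x|) ->
   exists s : nat -> seq (R * set S), [/\ forall n, finite_sets mu (s n),
     forall p, step_fun (s n) p @[n --> \oo] --> h p & forall n p, 0 <= step_fun (s n) p <= h p].
  move=> mh h0.
  have mEh : measurable_fun setT (EFin \o h) by exact/measurable_EFinP.
  have Eh0 x : (0 <= (EFin \o h) x)%E by rewrite lee_fin; case/andP: (h0 x).
  pose a := nnsfun_approx measurableT mEh.
  have ah n x : a n x <= h x.
    rewrite -lee_fin /a nnsfun_approxE; apply: (le_approx n (fun x _ => Eh0 x)) => //.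
  have a2 n : (\int[mu]_x ((a n x) ^+ 2)%:E < +oo)%E.
    apply: le_lt_trans f2; apply: ge0_le_integral => //.
    - by move=> x _; rewrite lee_fin sqr_ge0.
    - exact: measurable_EFin_sq.
    - exact: measurable_EFin_sq.
    move=> x _; rewrite lee_fin -(@real_normK _ (f x)) ?num_real// lerXn2r ?nnegrE//.
    by rewrite (le_trans (ah n x))//; case/andP: (h0 x).
  have /choice[s sP] : forall n, exists s, finite_sets mu s /\ forall p, step_fun s p = a n p.
    by move=> n; exact: nnsfun_step.
  exists s; split => [n|p|n p].
  - by case: (sP n).
  - rewrite (_ : (fun n => _) = (fun n => fine ((EFin \o (fun n => a n p)) n))); last first.
      by apply/funext => n; rewrite (sP n).2.
    apply: (@fine_cvg _ _ _ _ _ (h p)).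
    exact: (cvg_nnsfun_approx measurableT mEh (fun x _ => Eh0 x)).
  - by rewrite (sP n).2 ah andbT.
have [| |s [fs cs bs]] := pos (fun x => Num.max (f x) 0).
- exact: measurable_maxr.
- by move=> x; rewrite le_max lexx orbT/= ge_max ler_norm normr_ge0.
have [| |t [ft ct bt]] := pos (fun x => Num.max (- f x) 0).
- by apply: measurable_maxr => //; exact: measurable_funN.
- by move=> x; rewrite le_max lexx orbT/= ge_max normr_ge0 andbT -normrN ler_norm.
pose g n := s n ++ scale_comb (-1) (t n).
have fg n : finite_sets mu (g n) by apply: finite_sets_cat => //; exact: finite_sets_scale.
exists g; split => //.
have gE n p : step_fun (g n) p = step_fun (s n) p - step_fun (t n) p.
  by rewrite step_fun_cat step_fun_scale mulN1r.
have [] := @dominated_convergence _ _ R mu setT measurableT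
  (fun n p => ((step_fun (g n) p - f p) ^+ 2)%:E) (cst 0%E) (fun p => ((f p) ^+ 2)%:E).
- move=> n; apply: measurable_EFin_sq; apply: measurable_funB => //; exact: measurable_step_fun (fg n).
- exact: measurable_cst.
- apply: aeW => p _.
  have : (step_fun (g n) p - f p) ^+ 2 @[n --> \oo] --> (Num.max (f p) 0 - Num.max (- f p) 0 - f p) ^+ 2.
    under eq_fun do rewrite gE.
    apply: (cvg_comp (fun n => step_fun (s n) p - step_fun (t n) p - f p) (fun x => x ^+ 2)); last exact: exprn_continuous.
    by apply: cvgB; [exact: cvgB|exact: cvg_cst].
  rewrite (_ : _ ^+ 2 = 0); last first.
    by case: (ltP (f p) 0) => h; rewrite /Num.max; do ?case: ifPn => ?; rewrite ?(mulr0) //; nra.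
  by move=> H; apply: cvg_EFin => //; exact: nearW.
- apply/integrableP; split; first exact: measurable_EFin_sq.
  by under eq_integral do rewrite gee0_abs ?lee_fin ?sqr_ge0//.
- apply: aeW => p n _; rewrite gee0_abs ?lee_fin ?sqr_ge0// gE.
  have := bs n p; have := bt n p; rewrite /Num.max.
  move: (step_fun (s n) p) (step_fun (t n) p) (f p) => a b c.
  by do ?case: ifPn; rewrite -?leNgt => *; nra.
by rewrite integral_cst// mul0e => _ _.
Qed.
End step_functions.

(** * Wiener integrals as an isonormal family *)

Section wiener.
Context (R : realType) (d : measure_display) (Om : measurableType d)
  (Prob : probability Om R) (d' : measure_display) (S : measurableType d')
  (mu : {measure set S -> \bar R}) (W : set S -> Om -> R).
Hypothesis HW : gaussian_white_noise Prob mu W.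

(** Existential counterpart of [wiener_integral]: one approximating sequence is exhibited. In this
    form the relation is stable under linear combinations, as approximating sequences can be
    concatenated, whereas an arbitrary approximation of a sum does not split into approximations of
    its terms. *)
Definition L2_isonormal (f : S -> R) (I : Om -> R) : Prop :=
  [/\ measurable_fun setT f, (\int[mu]_p ((f p) ^+ 2)%:E < +oo)%E,
      measurable_fun setT I &
      exists g : nat -> seq (R * set S),
      [/\ forall n, finite_sets mu (g n),
        (\int[mu]_p ((step_fun (g n) p - f p) ^+ 2)%:E)%E @[n --> \oo] --> 0%E &
        (\int[Prob]_w ((noise_comb W (g n) w - I w) ^+ 2)%:E)%E @[n --> \oo] --> 0%E]].

Lemma wiener_isonormal f I : wiener_integral Prob mu W f I -> L2_isonormal f I.
Proof.
move=> [mf f2 mI H]; split => //.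
by have [g [fg gf]] := L2_step_dense mf f2; exists g; split => //; exact: H.
Qed.

Lemma isonormal0 : L2_isonormal (cst 0) (cst 0).
Proof.
split; [exact: measurable_cst| |exact: measurable_cst|].
  by under eq_integral do rewrite /= expr0n /=; rewrite integral0.
exists (fun _ => [::]); split => //.
  under eq_fun do under eq_integral do rewrite /step_fun big_nil /= subr0 expr0n /=.
  by rewrite integral0; exact: cvg_cst.
under eq_fun do under eq_integral do rewrite /noise_comb big_nil /= subr0 expr0n /=.
by rewrite integral0; exact: cvg_cst.
Qed.

Lemma isonormal_linear f g I J c : L2_isonormal f I -> L2_isonormal g J ->
  L2_isonormal (fun p => f p + c * g p) (fun w => I w + c * J w).
Proof.
move=> [mf f2 mI [s [fs sf sI]]] [mg g2 mJ [t [ft tg tJ]]].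
split.
- by apply: measurable_funD => //; exact: measurable_funM.
- exact: L2_linear.
- by apply: measurable_funD => //; exact: measurable_funM.
have mnc n u : finite_sets mu u -> measurable_fun setT (noise_comb W u) by move=> /HW[].
exists (fun n => s n ++ scale_comb c (t n)); split.
- by move=> n; apply: finite_sets_cat => //; exact: finite_sets_scale.
- have := @L2_cvg0_linear R _ _ mu (fun n p => step_fun (s n) p - f p) (fun n p => step_fun (t n) p - g p) c.
  move=> /(_ _ _ sf tg) H; apply: cvg_trans (H _ _).
  + apply: near_eq_cvg; apply: nearW => n; apply: eq_integral => p _.
    by rewrite step_fun_cat step_fun_scale; congr (_ ^+ 2)%:E; ring.
  + by move=> n; apply: measurable_funB => //; exact: measurable_step_fun (fs n).
  + by move=> n; apply: measurable_funB => //; exact: measurable_step_fun (ft n).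
- have := @L2_cvg0_linear R _ _ Prob (fun n w => noise_comb W (s n) w - I w) (fun n w => noise_comb W (t n) w - J w) c.
  move=> /(_ _ _ sI tJ) H; apply: cvg_trans (H _ _).
  + apply: near_eq_cvg; apply: nearW => n; apply: eq_integral => w _.
    by rewrite noise_comb_cat noise_comb_scale; congr (_ ^+ 2)%:E; ring.
  + by move=> n; apply: measurable_funB => //; case: (HW (fs n)).
  + by move=> n; apply: measurable_funB => //; case: (HW (ft n)).
Qed.

Lemma isonormal_gaussian f I : L2_isonormal f I ->
  gaussian_rv Prob I 0 (fine (\int[mu]_p ((f p) ^+ 2)%:E)%E).
Proof.
move=> [mf f2 mI [g [fg gf gI]]].
apply: (@gaussian_rv_L2_limit _ _ _ _ (fun n => noise_comb W (g n))
  (fun n => fine (\int[mu]_p ((step_fun (g n) p) ^+ 2)%:E)%E)) => //.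
- by move=> n; rewrite fine_ge0// integral_sq_ge0.
- by move=> n; rewrite integral_step_sq//=; exact: HW.
- apply: L2_cvg_sq => //.
  + by move=> n; exact: measurable_step_fun (fg n).
  + by move=> n; rewrite integral_step_sq// ltry.
Qed.

Lemma isonormal_sq f I : L2_isonormal f I ->
  (\int[Prob]_w ((I w) ^+ 2)%:E = \int[mu]_p ((f p) ^+ 2)%:E)%E.
Proof.
move=> H; rewrite (gaussian_rv_second_moment _ (isonormal_gaussian H)).
  by case: H => ? f2 _ _; rewrite fineK// ge0_fin_numE// integral_sq_ge0.
by rewrite fine_ge0// integral_sq_ge0.
Qed.

Lemma isonormal_mul f g I J : L2_isonormal f I -> L2_isonormal g J ->
  (\int[Prob]_w (I w * J w)%:E = \int[mu]_p (f p * g p)%:E)%E.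
Proof.
move=> fI gJ.
have [mf f2 mI _] := fI; have [mg g2 mJ _] := gJ.
have I2 := isonormal_sq fI; have J2 := isonormal_sq gJ.
have I2oo : (\int[Prob]_w ((I w) ^+ 2)%:E < +oo)%E by rewrite I2.
have J2oo : (\int[Prob]_w ((J w) ^+ 2)%:E < +oo)%E by rewrite J2.
rewrite (L2_polarization mI mJ I2oo J2oo) (L2_polarization mf mg f2 g2).
by rewrite (isonormal_sq (isonormal_linear 1 fI gJ)) (isonormal_sq (isonormal_linear (-1) fI gJ)).
Qed.

(** Both [I] and [- I] are centered Gaussian with the same variance, so they have the same law, and
    the positive and negative parts of [I] have equal integrals. These are finite because
    [x <= x ^+ 2 + 1]. *)
Lemma isonormal_centered f I : L2_isonormal f I -> (\int[Prob]_w (I w)%:E = 0)%E.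
Proof.
move=> fI; have [mf f2 mI _] := fI.
have : L2_isonormal (fun p => 0 + -1 * f p) (fun w => 0 + -1 * I w).
  exact: (isonormal_linear (-1) isonormal0 fI).
move=> fI'.
have E2 : (\int[mu]_p ((0 + -1 * f p) ^+ 2)%:E = \int[mu]_p ((f p) ^+ 2)%:E)%E.
  by apply: eq_integral => p _; rewrite add0r mulN1r sqrrN.
have [mI' G'] := isonormal_gaussian fI'; have [_ G] := isonormal_gaussian fI.
rewrite E2 in G'.
pose X' : {mfun Om >-> measurableTypeR R} :=
  HB.pack I (isMeasurableFun.Build _ _ _ (measurableTypeR R) I mI).
pose m (x : measurableTypeR R) := (Num.max (x : R) 0)%:E.
have mm : measurable_fun setT m.
  by apply/measurable_EFinP; apply: measurable_maxr.
have m0 x : (0 <= m x)%E by rewrite lee_fin le_max lexx orbT.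
have L1 := @ge0_integral_law R _ _ Prob I (distribution Prob X') mI (fun B mB => erefl) m mm m0.
have L2 := @ge0_integral_law R _ _ Prob (fun w => 0 + -1 * I w) (distribution Prob X') mI'
   (fun B mB => etrans (G' B mB) (esym (G B mB))) m mm m0.
have fin : (\int[Prob]_w m (I w) < +oo)%E.
  apply: (@le_lt_trans _ _ (\int[Prob]_w ((I w) ^+ 2 + 1)%:E)%E).
    apply: ge0_le_integral => //.
    - exact: (measurableT_comp mm).
    - by apply/measurable_EFinP; apply: measurable_funD => //; exact: measurable_funX.
    move=> w _; rewrite lee_fin ge_max; apply/andP; split; nra.
  under eq_integral do rewrite EFinD.
  rewrite ge0_integralD//=; last 2 first.
  - by move=> w _; rewrite lee_fin sqr_ge0.
  - exact: measurable_EFin_sq.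
  rewrite integral_cst//= probability_setT mule1 (isonormal_sq fI).
  by rewrite lte_add_pinfty// ltry.
rewrite integralE.
have -> : (\int[Prob]_w (fun w => (I w)%:E)^\+ w = \int[Prob]_w m (I w))%E.
  by apply: eq_integral => w _; rewrite funeposE /m EFin_max.
have -> : (\int[Prob]_w (fun w => (I w)%:E)^\- w = \int[Prob]_w m (I w))%E.
  rewrite L1 -L2; apply: eq_integral => w _.
  by rewrite funenegE /m add0r mulN1r EFin_max.
by rewrite subee// ge0_fin_numE// integral_ge0.
Qed.
End wiener.

(** * The covariance integrals *)

Section points.
Variable R : comNzRingType.
Implicit Types a p : R.

(** Two players win a round with weights [a] and [p], and the first to win [l.+1] rounds wins the
    match. The two families of terms are the chances of the two players, by the number [i] of rounds
    won by the loser. *)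
Lemma problem_of_points (a p : R) (l : nat) : a + p = 1 ->
  \sum_(i < l.+1) 'C(i + l, i)%:R * (p ^+ l.+1 * a ^+ i + a ^+ l.+1 * p ^+ i) = 1.
Proof.
move=> ap.
(* The chance that the player of weight [y] wins [n.+1] rounds before the other one wins [m].
   Unequal targets are needed since conditioning on the first round lowers just one of them. *)
pose T (x y : R) (m n : nat) := \sum_(i < m) 'C(i + n, i)%:R * (y ^+ n.+1 * x ^+ i).
have Tn0 x y n : T x y 0%N n = 0 by rewrite /T big_ord0.
(* First-round analysis; on coefficients it is the rule of Pascal. *)
have rec x y m n : x + y = 1 -> T x y m.+1 n.+1 = x * T x y m n.+1 + y * T x y m.+1 n.
  move=> xy; rewrite /T big_ord_recl [in X in _ = _ + y * X]big_ord_recl /= !bin0.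
  rewrite mulrDr addrA [x * _ + _]addrC -addrA; congr (_ + _); first by rewrite exprS; ring.
  rewrite !mulr_sumr -big_split; apply: eq_bigr => i _ /=.
  rewrite /bump /= add1n addSn binS natrD -addSnnS; rewrite !exprS.
  ring.
have base x y m : x + y = 1 -> T x y m.+1 0%N + x ^+ m.+1 = 1.
  move=> xy; elim: m => [|m ih]; rewrite /T big_ord_recr/=.
    by rewrite big_ord0 add0r bin0 !expr0 expr1 mul1r mulr1 addrC.
  rewrite -addrA (_ : _ + x ^+ m.+2 = x ^+ m.+1); first exact: ih.
  by rewrite addn0 binn mul1r expr1 (exprS x m.+1) -mulrDl addrC xy mul1r.
have two m n : T a p m.+1 n + T p a n.+1 m = 1.
  have pa : p + a = 1 by rewrite addrC.
  elim: m n => [|m ihm] n.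
    by rewrite addrC {2}/T big_ord_recr big_ord0/= add0r bin0 mul1r expr0 mulr1; exact: base.
  elim: n => [|n ihn].
    rewrite {2}/T big_ord_recr big_ord0/= add0r bin0 mul1r expr0 mulr1; exact: base.
  rewrite rec// [T p a _ _]rec//.
  transitivity (a * (T a p m.+1 n.+1 + T p a n.+2 m) + p * (T a p m.+2 n + T p a n.+1 m.+1)).
    ring.
  by rewrite ihm ihn !mulr1.
rewrite -[RHS](two l l) -big_split; apply: eq_bigr => i _ /=.
by rewrite mulrDr.
Qed.
End points.

Section product_sum.
Variable R : realFieldType.

(** For [i + j] positive this is the integral of [psi i s * psi j (s / q)] against [ds / s]. The
    divergent pair [i = j = 0] gets the value 0 because the inverse of 0 is 0. *)
Definition pair_coef (q : R) (i j : nat) : R :=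
  (i + j)%:R^-1 * 'C(i + j, i)%:R * q ^+ i / (1 + q) ^+ (i + j).

(** After absorbing the factor [(i + k.+1)%:R^-1] into the binomial coefficient, the sum is
    [k.+1%:R^-1] times the problem of points with weights [q / (1 + q)] and [1 / (1 + q)]. *)
Lemma pair_coef_edge (q : R) k : 0 < q ->
  \sum_(i < k.+1) (pair_coef q i k.+1 + pair_coef q k.+1 i) = k.+1%:R^-1.
Proof.
move=> q0; have q1 : 1 + q != 0 by rewrite gt_eqF// addr_gt0.
have := @problem_of_points R (q / (1 + q)) (1 + q)^-1 k.
rewrite -[X in _ / _ + X]mul1r -mulrDl [q + 1]addrC mulfV// => /(_ erefl) H.
rewrite -[RHS]mulr1 -[X in _ = _ * X]H mulr_sumr; apply: eq_bigr => i _.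
have C1 : (i + k.+1)%:R^-1 * 'C(i + k.+1, i)%:R = k.+1%:R^-1 * 'C(i + k, i)%:R :> R.
  have n0 : (i + k.+1)%:R != 0 :> R by rewrite pnatr_eq0 addnS.
  have k0 : k.+1%:R != 0 :> R by rewrite pnatr_eq0.
  apply: (mulfI n0); apply: (mulfI k0).
  rewrite mulVKf// mulrCA mulVKf//.
  rewrite -!natrM; congr (_%:R).
  rewrite -[in LHS](@bin_sub (i + k.+1) i) ?leq_addr// addKn.
  rewrite -[in RHS](@bin_sub (i + k) i) ?leq_addr// addKn.
  by rewrite addnS -mul_bin_diag.
rewrite /pair_coef C1 [(k.+1 + i)%N]addnC.
have -> : 'C(i + k.+1, k.+1) = 'C(i + k.+1, i).
  by rewrite -[RHS](@bin_sub (i + k.+1) i) ?leq_addr// addKn.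
rewrite C1 !expr_div_n !exprVn exprD; field.
by rewrite !expf_neq0//= addrC natr1 pnatr_eq0.
Qed.

(** Enlarging the square by one row and one column adds an edge, worth a harmonic term, and a
    corner, which is the diagonal term of the covariance. *)
Lemma sum_pair_coef (q : R) l : 0 < q ->
  \sum_(i < l) \sum_(j < l) pair_coef q i j =
  \sum_(1 <= k < l) (k%:R^-1 + ((2 * k - 1)`!)%:R * q ^+ k / ((k`!)%:R ^+ 2 * (1 + q) ^+ (2 * k))).
Proof.
move=> q0; elim: l => [|l ih]; first by rewrite big_ord0 big_geq.
rewrite big_ord_recr/=; under eq_bigr do rewrite big_ord_recr/=.
rewrite big_split/= ih [X in _ + X = _]big_ord_recr/=.
(* The first corner is the pair [(0, 0)], whose coefficient is 0, so the sum on the right starts at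
   1. *)
case: l ih => [_|k _].
  by rewrite !big_ord0 !big_geq// !add0r /pair_coef invr0 !mul0r.
rewrite [RHS]big_nat_recr//= -addrA; congr (_ + _).
rewrite addrA -big_split/= pair_coef_edge//; congr (_ + _).
rewrite /pair_coef addnn -mul2n.
have kf0 : (k.+1)`!%:R != 0 :> R by rewrite pnatr_eq0 -lt0n fact_gt0.
have k0 : (2 * k.+1)%:R != 0 :> R by rewrite pnatr_eq0.
have q1 : (1 + q) ^+ (2 * k.+1) != 0 by rewrite expf_neq0// gt_eqF// addr_gt0.
have : ('C(2 * k.+1, k.+1) * ((k.+1)`! * (k.+1)`!) = (2 * k.+1) * (2 * k.+1 - 1)`!)%N.
  have := @bin_fact (2 * k.+1) k.+1; rewrite mul2n -addnn addnK leq_addr => /(_ isT) ->.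
  by rewrite addSn /= subn1 /= factS.
move: kf0 k0 q1; move: ((k.+1)`!) (2 * k.+1)%N => f N f0 N0 q1.
move=> /(congr1 (fun n : nat => n%:R : R)); rewrite !natrM => E.
have -> : 'C(N, k.+1)%:R = N%:R * (N - 1)`!%:R / (f%:R ^+ 2) :> R.
  by rewrite -E expr2 mulfK// mulf_neq0.
by field; rewrite f0 q1 N0.
Qed.
End product_sum.

(** * Gamma integrals in logarithmic scale *)

Section exp_bounds.
Variable R : realType.

(** Apply [expR z >= z] to [z = y / k.+1] and raise to the power [k.+1]. *)
Lemma expRN_le_exprV (k : nat) (y : R) : 0 < y -> expR (- y) <= (k.+1%:R / y) ^+ k.+1.
Proof.
move=> y0; rewrite expRN -[k.+1%:R / y]invf_div exprVn.
rewrite lef_pV2 ?posrE ?expR_gt0 ?exprn_gt0 ?divr_gt0//.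
have yE : y = k.+1%:R * (y / k.+1%:R) by rewrite mulrC divfK// pnatr_eq0.
rewrite [in leRHS]yE expRM_natl.
rewrite lerXn2r ?nnegrE ?expR_ge0 ?divr_ge0 ?(ltW y0)//.
by rewrite (le_trans _ (expR_ge1Dx _))// lerDr.
Qed.

Lemma cvg_psi_infty (i : nat) (t : nat -> R) : t @ \oo --> +oo ->
  (fun n => psi i (t n)) @ \oo --> (0 : R).
Proof.
move=> ty.
apply: (@squeeze_cvgr _ _ _ _ (cst 0) (fun n => (i.+1%:R ^+ i.+1) * (t n)^-1)); last 2 first.
- exact: cvg_cst.
- rewrite -(mulr0 (i.+1%:R ^+ i.+1)); apply: cvgMr.
  by apply/gtr0_cvgV0 => //; near=> n; near: n; by move/cvgryPgt: ty; apply.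
near=> n.
have t0 : 0 < t n by near: n; by move/cvgryPgt: ty; apply.
rewrite /psi mulr_ge0 ?expR_ge0 ?divr_ge0 ?exprn_ge0 ?(ltW t0)//=.
apply: (@le_trans _ _ (t n ^+ i * expR (- t n))).
  rewrite ler_wpM2r ?expR_ge0// ler_piMr ?exprn_ge0 ?(ltW t0)//.
  by rewrite invf_le1 ?ltr0n ?fact_gt0// ler1n fact_gt0.
apply: (le_trans (ler_wpM2l _ (expRN_le_exprV i t0))); first by rewrite exprn_ge0// ltW.
rewrite expr_div_n mulrCA ler_wpM2l ?exprn_ge0// exprS invfM mulrCA mulfV ?mulr1//.
by rewrite expf_neq0// gt_eqF.
Unshelve. all: by end_near. Qed.

Lemma is_derive_exprS (n : nat) (t : R) :
  is_derive t (1 : R) (fun x : R => x ^+ n.+1) (n.+1%:R * t ^+ n).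
Proof.
elim: n => [|n ih]; first by rewrite mul1r expr0; exact: is_derive_id.
rewrite [X in is_derive _ _ X](_ : _ = (fun x => x * x ^+ n.+1)); last first.
  by apply/funext => x; rewrite exprS.
apply: is_derive_eq; rewrite /GRing.scale/= !exprS -[in RHS]natr1; ring.
Qed.

Lemma is_derive_psi0 (t : R) : is_derive t (1 : R) (psi 0) (- psi 0 t).
Proof.
rewrite [X in is_derive _ _ X](_ : _ = (fun x => expR (- x))); last first.
  by apply/funext => x; rewrite /psi expr0 fact0 divr1 mul1r.
apply: is_derive_eq; rewrite /psi expr0 fact0 divr1 mul1r /GRing.scale/=; ring.
Qed.

Lemma is_derive_psiS (n : nat) (t : R) : is_derive t (1 : R) (psi n.+1) (psi n t - psi n.+1 t).
Proof.
have nf : n`!%:R != 0 :> R by rewrite pnatr_eq0 -lt0n fact_gt0.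
have n1 : n.+1%:R != 0 :> R by rewrite pnatr_eq0.
have dX := is_derive_exprS n t.
rewrite /psi; apply: is_derive_eq; rewrite /GRing.scale/= -/(n.+1`!) factS natrM exprS.
by field; rewrite nf addrC natr1 n1.
Qed.

Definition poisson_cdf (n : nat) (t : R) : R := \sum_(k < n) psi k t.

(** The derivative of [psi k.+1] is [psi k - psi k.+1], so the sum telescopes. Hence [poisson_cdf]
    is an explicit antiderivative for Gamma integrals. *)
Lemma is_derive_poisson_cdf (n : nat) (t : R) :
  is_derive t (1 : R) (poisson_cdf n.+1) (- psi n t).
Proof.
elim: n => [|n ih].
  rewrite (_ : poisson_cdf 1 = psi 0); first exact: is_derive_psi0.
  by apply/funext => x; rewrite /poisson_cdf big_ord1.
rewrite (_ : poisson_cdf n.+2 = poisson_cdf n.+1 \+ psi n.+1); last first.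
  by apply/funext => x; rewrite /poisson_cdf big_ord_recr.
have := is_derive_psiS n t => ?.
by apply: is_derive_eq; rewrite addrA addNr add0r.
Qed.

Lemma cvg_poisson_cdf_infty n (t : nat -> R) : t @ \oo --> +oo ->
  (fun k => poisson_cdf n (t k)) @ \oo --> (0 : R).
Proof.
move=> ty; elim: n => [|n ih].
  rewrite (_ : (fun k => _) = cst 0); first exact: cvg_cst.
  by apply/funext => k; rewrite /poisson_cdf big_ord0.
rewrite (_ : (fun k => _) = (fun k => poisson_cdf n (t k) + psi n (t k))); last first.
  by apply/funext => k; rewrite /poisson_cdf big_ord_recr.
by rewrite -[X in _ --> X](addr0 0); apply: cvgD => //; exact: cvg_psi_infty.
Qed.

Lemma poisson_cdf0 n : poisson_cdf n.+1 0 = 1 :> R.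
Proof.
rewrite /poisson_cdf big_ord_recl big1 ?addr0.
  by rewrite /psi expr0 fact0 oppr0 expR0 divr1 mulr1.
by move=> i _; rewrite /psi expr0n/= !mul0r.
Qed.

Lemma ge0_integralT_FTC (f F : R -> R) (a b : R) : (forall x, 0 <= f x) -> continuous f ->
  (forall x, is_derive x (1 : R) F (f x)) ->
  F n%:R @[n --> \oo] --> b -> F (- n%:R) @[n --> \oo] --> a ->
  (\int[lebesgue_measure]_x (f x)%:E = (b - a)%:E)%E.
Proof.
move=> f0 cf dF Fb Fa.
pose A n : set R := `[- n.+1%:R, n.+1%:R]%classic.
have UA : \bigcup_n A n = setT.
  apply/seteqP; split => // x _; exists (Num.truncn `|x|) => //.
  rewrite /A/= in_itv/= -ler_norml; apply: ltW; exact: truncnS_gt.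
have mf : measurable_fun setT (EFin \o f) by apply/measurable_EFinP; exact: continuous_measurable_fun.
have L1 : (\int[lebesgue_measure]_(x in A n) (f x)%:E)%E @[n --> \oo] --> (\int[lebesgue_measure]_x (f x)%:E)%E.
  rewrite -UA; apply: ge0_nondecreasing_set_cvg_integral => //.
  - apply/nondecreasing_seqP => n; apply/subsetPset => x; rewrite /A/= !in_itv/= => /andP[h1 h2].
    by rewrite (le_trans _ h1) ?(le_trans h2)// ?lerN2 ler_nat.
  - by move=> n; exact: measurable_itv.
  - by move=> n; apply: measurable_funTS mf.
  - by move=> n x _; rewrite lee_fin.
have FE n : (\int[lebesgue_measure]_(x in A n) (f x)%:E = (F n.+1%:R - F (- n.+1%:R))%:E)%E.
  have cF : continuous F by move=> x; apply/differentiable_continuous/derivable1_diffP.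
  rewrite (@continuous_FTC2 _ _ F)//.
  - by rewrite (@lt_trans _ _ 0)// ?oppr_lt0 ltr0n.
  - exact: continuous_subspaceT.
  - by split => //; [exact/cvg_at_right_filter/cF|exact/cvg_at_left_filter/cF].
  - by move=> x _; rewrite derive1E; exact: derive_val.
apply: (cvg_unique _ L1) => //.
rewrite (_ : (fun n => _) = (fun n => (F n.+1%:R - F (- n.+1%:R))%:E)); last exact/funext.
apply: cvg_EFin; first exact: nearW.
apply: cvgB; first by rewrite (cvg_shiftS (fun n => F n%:R)).
by rewrite (cvg_shiftS (fun n => F (- n%:R))).
Qed.

Lemma integral_gumbel_moment (j : nat) (c u : R) : 0 < c ->
  (\int[lebesgue_measure]_x ((expR (- (x - u))) ^+ j.+1 * expR (- (c * expR (- (x - u)))))%:E =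
   (j`!%:R / c ^+ j.+1)%:E)%E.
Proof.
move=> c0.
have c0' : c != 0 by rewrite gt_eqF.
have jf : j`!%:R != 0 :> R by rewrite pnatr_eq0 -lt0n fact_gt0.
(* By the chain rule the inner derivative of [c * expR (- (x - u))] supplies the missing sign and
   the extra power. [F] runs from 0 at minus infinity to its prefactor at plus infinity. *)
pose F x := (j`!%:R / c ^+ j.+1) * poisson_cdf j.+1 (c * expR (- (x - u))).
have cQ : continuous (poisson_cdf j.+1).
  move=> t; apply/differentiable_continuous/derivable1_diffP.
  by have := is_derive_poisson_cdf j t => ?.
have dF x : is_derive x (1:R) F ((expR (- (x - u))) ^+ j.+1 * expR (- (c * expR (- (x - u))))).
  rewrite /F.
  have := is_derive_poisson_cdf j (c * expR (- (x - u))) => ?.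
  apply: is_derive_eq; rewrite /GRing.scale/= /psi exprMn !exprS.
  by field; rewrite expf_neq0// jf c0'.
have cf : continuous (fun x => (expR (- (x - u))) ^+ j.+1 * expR (- (c * expR (- (x - u))))).
  have ce : continuous (fun x : R => expR (- (x - u))).
    move=> x; have : derivable (fun x : R => expR (- (x - u))) x 1 by [].
    by move=> /derivable1_diffP/differentiable_continuous.
  move=> x; apply: cvgM.
    by apply: (cvg_comp (fun x => expR (- (x - u))) (fun y => y ^+ j.+1)); [exact: ce|exact: exprn_continuous].
  apply: (cvg_comp (fun x => expR (- (x - u))) (fun y => expR (- (c * y)))); first exact: ce.
  have : derivable (fun y : R => expR (- (c * y))) (expR (- (x - u))) 1 by [].
  by move=> /derivable1_diffP/differentiable_continuous.
have L1 : F n%:R @[n --> \oo] --> (j`!%:R / c ^+ j.+1).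
  have Lt : (fun n : nat => c * expR (- (n%:R - u))) @ \oo --> (0 : R).
    rewrite -[X in _ --> X](mulr0 c); apply: cvgMr.
    apply: (cvg_comp (fun n : nat => n%:R - u) (fun x => expR (- x))); last exact: cvgr_expR.
    exact: (cvg_comp _ _ cvgr_idn (cvg_addrr (- u))).
  rewrite -[X in _ --> X]mulr1 /F; apply: cvgMr; rewrite -[X in _ --> X](poisson_cdf0 j).
  exact: (cvg_comp _ _ Lt (cQ 0)).
have L2 : F (- n%:R) @[n --> \oo] --> (0 : R).
  rewrite -[X in _ --> X](mulr0 (j`!%:R / c ^+ j.+1)) /F; apply: cvgMr.
  apply: cvg_poisson_cdf_infty; apply/cvgryPgt => A; near=> n.
  rewrite -ltr_pdivrMl// (lt_le_trans _ (expR_ge1Dx _))//.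
  rewrite opprD !opprK -ltrBlDl -ltrBlDr; near: n; exact: nbhs_infty_gtr.
rewrite -[in RHS](subr0 (_ / _)).
by apply: (@ge0_integralT_FTC _ F).
Unshelve. all: by end_near. Qed.
End exp_bounds.

(** * Frullani integrals *)

Section frullani.
Variable R : realType.
Local Notation mu := (@lebesgue_measure R).

Lemma integral_mul_indic (D : set R) (f : R -> R) :
  (\int[mu]_x (\1_D x * f x)%:E = \int[mu]_(x in D) (f x)%:E)%E.
Proof.
rewrite [RHS]integral_mkcond; apply: eq_integral => x _.
by rewrite patchE indicE; case: ifP => _; rewrite ?mul1r ?mul0r.
Qed.

Definition has_integral (f : R -> R) (v : R) : Prop :=
  mu.-integrable setT (EFin \o f) /\ (\int[mu]_x (f x)%:E = v%:E)%E.

Lemma has_integral_ge0 (f : R -> R) (v : R) : measurable_fun setT f -> (forall x, 0 <= f x) ->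
  (\int[mu]_x (f x)%:E = v%:E)%E -> has_integral f v.
Proof.
move=> mf f0 fv; split => //; apply/integrableP; split; first exact/measurable_EFinP.
under eq_integral do rewrite /= ger0_norm//.
by rewrite fv ltry.
Qed.

Lemma has_integralD f g a b : has_integral f a -> has_integral g b ->
  has_integral (fun x => f x + g x) (a + b).
Proof.
move=> [fi fa] [gi gb]; split; first exact: (integrableD measurableT fi gi).
rewrite EFinD -fa -gb -integralD_EFin//.
Qed.

Lemma has_integralZ c f a : has_integral f a -> has_integral (fun x => c * f x) (c * a).
Proof.
move=> [fi fa]; split; first exact: (integrableZl measurableT c fi).
rewrite EFinM -fa -integralZl//.
Qed.

Lemma has_integral_sum n (f : 'I_n -> R -> R) (a : 'I_n -> R) :
  (forall i, has_integral (f i) (a i)) ->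
  has_integral (fun x => \sum_i f i x) (\sum_i a i).
Proof.
elim: n f a => [|n ih] f a h.
  rewrite big_ord0 (_ : (fun x => _) = cst 0); last by apply/funext => x; rewrite big_ord0.
  by split; [exact: integrable0|rewrite integral0].
rewrite big_ord_recl (_ : (fun x => _) = (fun x => f ord0 x + \sum_i f (lift ord0 i) x)).
  by apply: has_integralD => //; apply: ih => i.
by apply/funext => x; rewrite big_ord_recl.
Qed.

Lemma measurable_gumbel_fun (c u : R) (j : nat) :
  measurable_fun setT (fun x : R => (expR (- (x - u))) ^+ j * expR (- (c * expR (- (x - u))))).
Proof.
have m1 : measurable_fun setT (fun x : R => expR (- (x - u))).
  by apply: measurableT_comp => //; apply: measurable_funN; apply: measurable_funB.
apply: measurable_funM; first exact: measurable_funX.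
by apply: measurableT_comp => //; apply: measurable_funN; exact: measurable_funM.
Qed.

Lemma has_integral_gumbel_moment (j : nat) (c u : R) : 0 < c ->
  has_integral (fun x => (expR (- (x - u))) ^+ j.+1 * expR (- (c * expR (- (x - u)))))
    (j`!%:R / c ^+ j.+1).
Proof.
move=> c0; apply: has_integral_ge0; [exact: measurable_gumbel_fun| |exact: integral_gumbel_moment].
by move=> x; rewrite mulr_ge0// ?exprn_ge0// expR_ge0.
Qed.

(** The difference of exponentials is an integral over [t] in [[a, b]]. After Tonelli, the integral
    in [x] is the case [j = 0] of [integral_gumbel_moment] and equals [t^-1], whose integral is the
    logarithm. *)
Lemma has_integral_frullani_lt (a b u : R) : 0 < a -> a < b ->
  has_integral (fun x => expR (- (a * expR (- (x - u)))) - expR (- (b * expR (- (x - u)))))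
   (ln (b / a)).
Proof.
move=> a0 ab; have b0 : 0 < b by exact: lt_trans ab.
pose e (x : R) := expR (- (x - u)).
have e0 x : 0 < e x by exact: expR_gt0.
have me : measurable_fun setT e.
  by apply: measurableT_comp => //; apply: measurable_funN; apply: measurable_funB.
apply: has_integral_ge0.
- by apply: measurable_funB; apply: measurableT_comp => //; apply: measurable_funN; exact: measurable_funM.
- by move=> x; rewrite subr_ge0 ler_expR lerN2 ler_pM2r ?expR_gt0// ltW.
have inner x : ((expR (- (a * e x)) - expR (- (b * e x)))%:E =
    \int[mu]_t (\1_`[a, b] t * (e x * expR (- (t * e x))))%:E)%E.
  rewrite integral_mul_indic.
  pose F (t : R) := - expR (- (t * e x)).
  have dF t : is_derive t (1:R) F (e x * expR (- (t * e x))).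
    by rewrite /F; apply: is_derive_eq; rewrite /GRing.scale/=; ring.
  have cF : continuous F by move=> t; apply/differentiable_continuous/derivable1_diffP.
  rewrite (@continuous_FTC2 _ _ F)//.
  - by rewrite /F -EFinB opprK addrC.
  - apply: continuous_subspaceT => t.
    have : derivable (fun t : R => e x * expR (- (t * e x))) t 1 by [].
    by move=> /derivable1_diffP/differentiable_continuous.
  - by split => //; [exact/cvg_at_right_filter/cF|exact/cvg_at_left_filter/cF].
  - by move=> t _; rewrite derive1E; exact: derive_val.
under eq_integral do rewrite -/(e _) inner.
pose G (z : R * R) := (\1_`[a, b] z.2 * (e z.1 * expR (- (z.2 * e z.1))))%:E.
have mG : measurable_fun setT G.
  apply/measurable_EFinP; apply: measurable_funM.
    by apply: measurableT_comp => //; exact: measurable_indic.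
  have m1 : measurable_fun setT (fun z : R * R => e z.1) by exact: measurableT_comp.
  apply: measurable_funM => //.
  by apply: measurableT_comp => //; apply: measurable_funN; apply: measurable_funM.
have G0 z : (0 <= G z)%E by rewrite lee_fin !mulr_ge0// ?expR_ge0// ltW.
rewrite (@fubini_tonelli _ _ _ _ R mu mu G mG G0).
have inner2 t : (\int[mu]_x (G (x, t)) = (\1_`[a, b] t * t^-1)%:E)%E.
  rewrite /G /= indicE; case: (boolP (t \in _)) => /= tab; last first.
    by under eq_integral do rewrite mul0r; rewrite integral0 mul0r.
  move: tab; rewrite inE/= in_itv/= => /andP[at_ _].
  have t0 : 0 < t by exact: lt_le_trans at_.
  rewrite mul1r -[in RHS](expr1 t) -[in RHS](mul1r (_^-1)).
  have := @integral_gumbel_moment R 0 t u t0; rewrite fact0 expr1 => <-.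
  by apply: eq_integral => x _; rewrite mul1r expr1.
under eq_integral do rewrite inner2.
rewrite integral_mul_indic.
have dln (t : R) : 0 < t -> is_derive t (1 : R) (@ln R) t^-1 by move=> t0; exact: is_derive1_ln.
have cln (t : R) : 0 < t -> {for t, continuous (@ln R)}.
  by move=> t0; apply/differentiable_continuous/derivable1_diffP; case: (dln t t0).
rewrite (@continuous_FTC2 _ _ (@ln R))//.
- by rewrite -EFinB ln_div ?posrE.
- apply: continuous_in_subspaceT => t; rewrite inE/= in_itv/= => /andP[at_ _].
  by apply: cvgV; rewrite ?gt_eqF ?(lt_le_trans a0 at_)//; exact: cvg_id.
- split.
  + by move=> t; rewrite in_itv/= => /andP[at_ _]; case: (dln t (lt_trans a0 at_)).
  + exact/cvg_at_right_filter/cln.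
  + exact/cvg_at_left_filter/cln.
- move=> t; rewrite in_itv/= => /andP[at_ _]; rewrite derive1E.
  by have := dln t (lt_trans a0 at_) => ?; exact: derive_val.
Qed.

Lemma has_integral_frullani (a b u : R) : 0 < a -> 0 < b ->
  has_integral (fun x => expR (- (b * expR (- (x - u)))) - expR (- (a * expR (- (x - u)))))
   (- ln (b / a)).
Proof.
move=> a0 b0; have [ab|ba|->] := ltgtP a b.
- have := has_integralZ (-1) (has_integral_frullani_lt u a0 ab).
  rewrite mulN1r; congr has_integral; apply/funext => x; ring.
- have := has_integral_frullani_lt u b0 ba.
  by rewrite -lnV ?posrE ?divr_gt0// invf_div.
- rewrite mulfV ?gt_eqF// ln1 oppr0 (_ : (fun x => _) = cst 0).
    by split; [exact: integrable0|rewrite integral0].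
  by apply/funext => x; rewrite subrr.
Qed.
End frullani.

(** * Renormalized integrals of Poisson probabilities *)

Section poisson_covariance_integral.
Variable R : realType.
Implicit Types (u c q : R).

(** The integral of [s ^+ j * expR (- (c * s))] against [ds / s]; for [j = 0] it is the Frullani
    value relative to the reference rate [c0]. *)
Definition gumbel_value (c0 : R) (j : nat) (c : R) : R :=
  if j is k.+1 then k`!%:R / c ^+ k.+1 else - ln (c / c0).

(* The functions s^0 e^{-cs} are not integrable against dx = ds/s; subtracting
   w e^{-c0 s} with the right total weight w makes every combination integrable. *)
Definition renormalized_integral (c0 u : R) (F : R -> R) (w V : R) : Prop :=
  has_integral (fun x => F x - w * expR (- (c0 * expR (- (x - u))))) V.

Lemma renormalized_gumbel c0 u j c : 0 < c0 -> 0 < c ->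
  renormalized_integral c0 u (fun x => (expR (- (x - u))) ^+ j * expR (- (c * expR (- (x - u)))))
    (j == 0%N)%:R (gumbel_value c0 j c).
Proof.
move=> c00 c1; rewrite /renormalized_integral; case: j => [|j] /=.
  have := has_integral_frullani u c00 c1; congr has_integral.
  by apply/funext => x; rewrite expr0 !mul1r.
have := has_integral_gumbel_moment j u c1; congr has_integral.
by apply/funext => x; rewrite mul0r subr0.
Qed.

Lemma renormalizedZ c0 u k F w V : renormalized_integral c0 u F w V ->
  renormalized_integral c0 u (fun x => k * F x) (k * w) (k * V).
Proof.
move=> /(has_integralZ k); congr has_integral; apply/funext => x; ring.
Qed.

Lemma renormalized_sum c0 u n (F : 'I_n -> R -> R) (w V : 'I_n -> R) :
  (forall i, renormalized_integral c0 u (F i) (w i) (V i)) ->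
  renormalized_integral c0 u (fun x => \sum_i F i x) (\sum_i w i) (\sum_i V i).
Proof.
move=> h; have := has_integral_sum h; congr has_integral; apply/funext => x.
by rewrite mulr_suml -sumrB.
Qed.

Lemma renormalized_sub c0 u F G w V V' : renormalized_integral c0 u F w V ->
  renormalized_integral c0 u G w V' -> has_integral (fun x => F x - G x) (V - V').
Proof.
move=> hF /(has_integralZ (-1)) hG; have := has_integralD hF hG.
by rewrite mulN1r; congr has_integral; apply/funext => x; ring.
Qed.

(** Expanding the product, just the term [i = j = 0] fails to be integrable and it has coefficient
    1, hence the weight 1. *)
Lemma renormalized_cdf_mul c0 u c l m : 0 < c0 -> 0 < c ->
  renormalized_integral c0 u
    (fun x => poisson_cdf l.+1 (expR (- (x - u))) * poisson_cdf m.+1 (c * expR (- (x - u)))) 1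
    (\sum_(i < l.+1) \sum_(j < m.+1) c ^+ j / (i`!%:R * j`!%:R) * gumbel_value c0 (i + j) (1 + c)).
Proof.
move=> c00 c1.
have := @renormalized_sum c0 u l.+1 (fun i x => \sum_(j < m.+1) c ^+ j / (i`!%:R * j`!%:R) *
   ((expR (- (x - u))) ^+ (i + j) * expR (- ((1 + c) * expR (- (x - u))))))
   (fun i => \sum_(j < m.+1) c ^+ j / (i`!%:R * j`!%:R) * (i + j == 0)%N%:R)
   (fun i => \sum_(j < m.+1) c ^+ j / (i`!%:R * j`!%:R) * gumbel_value c0 (i + j) (1 + c)).
have -> : \sum_(i < l.+1) \sum_(j < m.+1) c ^+ j / (i`!%:R * j`!%:R) * (i + j == 0)%N%:R = 1.
  rewrite big_ord_recl big_ord_recl /= !big1 ?addr0.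
  - by rewrite expr0 fact0; field.
  - by move=> i _; rewrite big1// => j _; rewrite mulr0.
  - by move=> j _; rewrite mulr0.
have -> : (fun x => \sum_(i < l.+1) \sum_(j < m.+1) c ^+ j / (i`!%:R * j`!%:R) *
   ((expR (- (x - u))) ^+ (i + j) * expR (- ((1 + c) * expR (- (x - u)))))) =
  (fun x => poisson_cdf l.+1 (expR (- (x - u))) * poisson_cdf m.+1 (c * expR (- (x - u)))).
  apply/funext => x; rewrite /poisson_cdf mulr_suml; apply: eq_bigr => i _.
  rewrite mulr_sumr; apply: eq_bigr => j _.
  rewrite /psi exprMn exprD invfM.
  have -> : expR (- ((1 + c) * expR (- (x - u)))) = expR (- expR (- (x - u))) * expR (- (c * expR (- (x - u)))).
    by rewrite -expRD; congr expR; ring.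
  ring.
apply => i; apply: renormalized_sum => j; apply: renormalizedZ.
by apply: renormalized_gumbel => //; rewrite addr_gt0.
Qed.

Lemma gumbel_value_pair c0 c i j : 0 < c -> (i + j)%N != 0%N ->
  c ^+ j / (i`!%:R * j`!%:R) * gumbel_value c0 (i + j) (1 + c) = pair_coef c^-1 i j.
Proof.
move=> cp ij.
have c0' : c != 0 by rewrite gt_eqF.
have c1 : 1 + c != 0 by rewrite gt_eqF// addr_gt0.
have fi : i`!%:R != 0 :> R by rewrite pnatr_eq0 -lt0n fact_gt0.
have fj : j`!%:R != 0 :> R by rewrite pnatr_eq0 -lt0n fact_gt0.
rewrite /pair_coef.
have -> : 1 + c^-1 = (1 + c) / c by field.
have E : 'C(i + j, i)%:R = (i + j)`!%:R / (i`!%:R * j`!%:R) :> R.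
  have := @bin_fact (i + j) i (leq_addr _ _); rewrite addKn => <-.
  by rewrite !natrM mulfK// mulf_neq0.
rewrite E expr_div_n exprVn; case: (i + j)%N ij (exprD c i j) => [//|k] _ ->.
rewrite /gumbel_value factS natrM.
have k0 : k.+1%:R != 0 :> R by rewrite pnatr_eq0.
by field; rewrite fi fj !expf_neq0// addrC natr1 k0.
Qed.

Lemma sum_gumbel_value_pair c0 c l m : 0 < c0 -> 0 < c ->
  \sum_(i < l.+1) \sum_(j < m.+1) c ^+ j / (i`!%:R * j`!%:R) * gumbel_value c0 (i + j) (1 + c) =
  \sum_(i < l.+1) \sum_(j < m.+1) pair_coef c^-1 i j - ln ((1 + c) / c0).
Proof.
move=> c00 cp.
transitivity (\sum_(i < l.+1) \sum_(j < m.+1) (pair_coef c^-1 i j - (i + j == 0)%N%:R * ln ((1 + c) / c0))).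
  apply: eq_bigr => i _; apply: eq_bigr => j _.
  have [ij0|ij] := eqVneq (i + j)%N 0%N; last by rewrite gumbel_value_pair// mul0r subr0.
  move: ij0 => /eqP; rewrite addn_eq0 => /andP[/eqP -> /eqP ->].
  by rewrite expr0 fact0 /pair_coef invr0 !mul0r sub0r /gumbel_value /=; field.
under eq_bigr do rewrite sumrB.
rewrite sumrB; congr (_ - _).
rewrite big_ord_recl big_ord_recl /= !big1 ?addr0 ?mul1r//.
- by move=> *; rewrite mul0r.
- by move=> *; rewrite mul0r.
Qed.

(** For [j] positive and [q] in [[0, 1]] this is [j%:R^-1] times the chance of [i] successes in [j]
    trials: given [j] points up to the later time, each falls before the earlier one with
    probability [q]. For [i > j] the binomial coefficient makes the truncated [j - i] harmless. *)
Definition bin_coef q (i j : nat) : R := j%:R^-1 * 'C(j, i)%:R * (1 - q) ^+ (j - i) * q ^+ i.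

(** For [s <= t], the probability that a unit-rate Poisson process has fewer than [l] points up to
    [s] and fewer than [m] up to [t]; [i] and [j] count the points up to [s] and [t]. *)
Definition joint_tail (l m : nat) (s t : R) : R :=
  expR (- t) * \sum_(i < l) \sum_(j < m) 'C(j, i)%:R / j`!%:R * s ^+ i * (t - s) ^+ (j - i).

(** All terms decay with the same rate [c], so taking [c] as the reference rate makes the logarithm
    of the term [j = 0] vanish. *)
Lemma renormalized_joint u c l m : 1 <= c ->
  renormalized_integral c u (fun x => joint_tail l.+1 m.+1 (expR (- (x - u))) (c * expR (- (x - u)))) 1
   (\sum_(i < l.+1) \sum_(j < m.+1) bin_coef c^-1 i j).
Proof.
move=> c1; have cp : 0 < c by rewrite (lt_le_trans _ c1).
have c0' : c != 0 by rewrite gt_eqF.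
have := @renormalized_sum c u l.+1 (fun i x => \sum_(j < m.+1) 'C(j, i)%:R / j`!%:R * (c - 1) ^+ (j - i) *
   ((expR (- (x - u))) ^+ j * expR (- (c * expR (- (x - u))))))
   (fun i => \sum_(j < m.+1) 'C(j, i)%:R / j`!%:R * (c - 1) ^+ (j - i) * (j == 0 :> nat)%:R)
   (fun i => \sum_(j < m.+1) 'C(j, i)%:R / j`!%:R * (c - 1) ^+ (j - i) * gumbel_value c j c).
have -> : \sum_(i < l.+1) \sum_(j < m.+1) 'C(j, i)%:R / j`!%:R * (c - 1) ^+ (j - i) * (j == 0 :> nat)%:R = 1.
  rewrite big_ord_recl big_ord_recl /= !big1 ?addr0.
  - by rewrite invr1 expr0 !mulr1.
  - move=> i _; rewrite big_ord_recl big1 /=; last by move=> j _; rewrite mulr0.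
    by rewrite bin0n /= !mul0r addr0.
  - by move=> j _; rewrite mulr0.
have -> : (fun x => \sum_(i < l.+1) \sum_(j < m.+1) 'C(j, i)%:R / j`!%:R * (c - 1) ^+ (j - i) *
   ((expR (- (x - u))) ^+ j * expR (- (c * expR (- (x - u)))))) =
   (fun x => joint_tail l.+1 m.+1 (expR (- (x - u))) (c * expR (- (x - u)))).
  apply/funext => x; rewrite /joint_tail mulr_sumr; apply: eq_bigr => i _.
  rewrite mulr_sumr; apply: eq_bigr => j _.
  have [ij|ji] := leqP i j; last by rewrite bin_small// !mul0r mulr0.
  have -> : c * expR (- (x - u)) - expR (- (x - u)) = (c - 1) * expR (- (x - u)) by ring.
  have -> : expR (- (x - u)) ^+ j = expR (- (x - u)) ^+ i * expR (- (x - u)) ^+ (j - i).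
    by rewrite -exprD subnKC.
  by rewrite exprMn; ring.
have -> : \sum_(i < l.+1) \sum_(j < m.+1) 'C(j, i)%:R / j`!%:R * (c - 1) ^+ (j - i) * gumbel_value c j c =
  \sum_(i < l.+1) \sum_(j < m.+1) bin_coef c^-1 i j.
  apply: eq_bigr => i _; apply: eq_bigr => j _; rewrite /bin_coef.
  have [ij|ji] := leqP i j; last by rewrite bin_small// !(mul0r, mulr0).
  case: {j}(nat_of_ord j) ij => [|j] ij.
    by rewrite /gumbel_value mulfV// ln1 oppr0 mulr0 invr0 !mul0r.
  have -> : 1 - c^-1 = (c - 1) / c by field.
  rewrite /gumbel_value factS natrM expr_div_n exprVn.
  have -> : c ^+ j.+1 = c ^+ i * c ^+ (j.+1 - i) by rewrite -exprD subnKC.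
  have jf : j`!%:R != 0 :> R by rewrite pnatr_eq0 -lt0n fact_gt0.
  have k0 : j.+1%:R != 0 :> R by rewrite pnatr_eq0.
  by field; rewrite jf !expf_neq0// addrC natr1 k0.
apply => i; apply: renormalized_sum => j; apply: renormalizedZ.
exact: renormalized_gumbel.
Qed.

Lemma renormalized_cdf u l :
  renormalized_integral 1 u (fun x => poisson_cdf l.+1 (expR (- (x - u)))) 1 (\sum_(i < l.+1) i%:R^-1).
Proof.
have := @renormalized_sum 1 u l.+1 (fun i x => i`!%:R^-1 *
   ((expR (- (x - u))) ^+ i * expR (- (1 * expR (- (x - u))))))
   (fun i => i`!%:R^-1 * (i == 0 :> nat)%:R)
   (fun i => i`!%:R^-1 * gumbel_value 1 i 1).
have -> : \sum_(i < l.+1) (i`!%:R^-1 * (i == 0 :> nat)%:R) = 1 :> R.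
  by rewrite big_ord_recl big1 /= ?addr0 ?invr1 ?mul1r// => i _; rewrite mulr0.
have -> : \sum_(i < l.+1) (i`!%:R^-1 * gumbel_value 1 i 1) = \sum_(i < l.+1) i%:R^-1.
  apply: eq_bigr => i _; case: {i}(nat_of_ord i) => [|i].
    by rewrite /gumbel_value invr1 mulr1 ln1 oppr0 mulr0 invr0.
  have jf : i`!%:R != 0 :> R by rewrite pnatr_eq0 -lt0n fact_gt0.
  by rewrite /gumbel_value expr1n divr1 factS natrM invfM -mulrA mulVf ?mulr1.
have -> : (fun x => \sum_(i < l.+1) i`!%:R^-1 * (expR (- (x - u)) ^+ i * expR (- (1 * expR (- (x - u)))))) =
   (fun x => poisson_cdf l.+1 (expR (- (x - u)))).
  apply/funext => x; apply: eq_bigr => i _; rewrite /psi mul1r; ring.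
by apply => i; apply: renormalizedZ; exact: renormalized_gumbel.
Qed.
End poisson_covariance_integral.

(** * From double sums to the stated covariance formulas *)

Section cross_covariance.
Variable R : realType.
Implicit Types (u v c q : R).

(** Each column [j < l] carries the full binomial distribution and sums to [j%:R^-1], whatever [q]
    is. Only the columns from [l] on keep a dependence on [q], which is why the double sum in
    [cross_cov] starts there. *)
Lemma sum_bin_coef_diag q l :
  \sum_(i < l) \sum_(j < l) bin_coef q i j = \sum_(j < l) j%:R^-1.
Proof.
rewrite exchange_big/=; apply: eq_bigr => j _.
rewrite -[RHS]mulr1 -[X in _ = _ * X](expr1n _ j) -[X in _ = _ * X ^+ _](subrK q 1).
rewrite exprDn mulr_sumr (big_ord_widen l (fun i => j%:R^-1 * ((1 - q) ^+ (j - i) * q ^+ i *+ 'C(j, i)))) ?ltn_ord//.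
rewrite [RHS]big_mkcond/=; apply: eq_bigr => i _; rewrite /bin_coef ltnS.
case: leqP => [_|ji]; last by rewrite bin_small// mulr0 !mul0r.
by rewrite -mulr_natr; ring.
Qed.

Lemma sum_split_col (K : nat -> nat -> R) l n :
  \sum_(i < l) \sum_(j < l + n) K i j =
  \sum_(i < l) \sum_(j < l) K i j + \sum_(0 <= r < n) \sum_(0 <= i < l) K i (l + r)%N.
Proof.
rewrite big_mkord.
under [X in _ = _ + X]eq_bigr do rewrite big_mkord.
rewrite [X in _ = _ + X]exchange_big/= -big_split/=; apply: eq_bigr => i _.
by rewrite big_split_ord/=.
Qed.

Lemma sum_inv_recl l : \sum_(j < l) (j%:R : R)^-1 = \sum_(1 <= j < l) j%:R^-1.
Proof.
case: l => [|l]; first by rewrite big_ord0 big_geq.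
rewrite -(big_mkord xpredT (fun j => (j%:R : R)^-1)) big_ltn// invr0 add0r//.
Qed.

(** [q / (1 + q) ^+ 2] is invariant under inversion of [q]; this is why the covariance depends on
    the absolute value of [u - v] alone. *)
Lemma diag_term_sym (q : R) k : 0 < q ->
  q^-1 ^+ k / (1 + q^-1) ^+ (2 * k) = q ^+ k / (1 + q) ^+ (2 * k).
Proof.
move=> q0; have q0' : q != 0 by rewrite gt_eqF.
have q1 : 1 + q != 0 by rewrite gt_eqF// addr_gt0.
have -> : 1 + q^-1 = (1 + q) / q by field.
rewrite expr_div_n exprVn mul2n -addnn !exprD; field.
by rewrite !expf_neq0.
Qed.

Lemma cov_lE u v (l : nat) (q : R) : q = expR (u - v) \/ q = expR (v - u) ->
  cov_l l u v = ln (1 + expR (- `|u - v|)) + \sum_(j < l) j%:R^-1 -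
    \sum_(i < l) \sum_(j < l) pair_coef q i j.
Proof.
move=> qE; have q0 : 0 < q by case: qE => ->; exact: expR_gt0.
rewrite sum_pair_coef// big_split/= sum_inv_recl /cov_l.
rewrite -addrA; congr (_ + _); rewrite opprD addrA subrr add0r; congr (- _).
apply: eq_bigr => k _.
have -> : expR (- `|u - v| * k%:R) = expR (- `|u - v|) ^+ k by rewrite expRM_natr.
have E : expR (- `|u - v|) = q \/ expR (- `|u - v|) = q^-1.
  have [uv|uv] := leP 0 (u - v).
    by rewrite ger0_norm// opprB; case: qE => ->; [right; rewrite -expRN opprB|left].
  by rewrite ltr0_norm// opprK; case: qE => ->; [left|right; rewrite -expRN opprB].
rewrite invfM !mulrA mulrAC -mulrA; rewrite [RHS]mulrC; apply/esym.
rewrite invfM !mulrA mulrAC [X in X * _ = _]mulrC.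
case: E => ->; first by ring.
have := diag_term_sym k q0 => D.
transitivity ((2 * k - 1)`!%:R / k`!%:R ^+ 2 * (q ^+ k / (1 + q) ^+ (2 * k))); first by ring.
by rewrite -D; ring.
Qed.

Lemma cross_cov_ge u v l n : u <= v ->
  cross_cov l n u v = \sum_(i < l) \sum_(j < l + n) bin_coef (expR (u - v)) i j
   + ln (1 + expR (u - v)) - \sum_(i < l) \sum_(j < l + n) pair_coef (expR (u - v)) i j.
Proof.
move=> uv; rewrite /cross_cov (@cov_lE _ _ _ (expR (u - v))); last by left.
rewrite !sum_split_col sum_bin_coef_diag.
have -> : - `|u - v| = u - v by rewrite ler0_norm ?opprK// subr_le0.
have -> : \sum_(0 <= r < n) \sum_(0 <= i < l)
      ((l + r)%:R^-1 * 'C(l + r, i)%:R * Num.max (1 - expR (u - v)) 0 ^+ (l + r - i) * expR ((u - v) * i%:R) -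
       (l + r + i)%:R^-1 * 'C(l + r + i, i)%:R * expR ((u - v) * i%:R) / (1 + expR (u - v)) ^+ (l + r + i)) =
    \sum_(0 <= r < n) \sum_(0 <= i < l) bin_coef (expR (u - v)) i (l + r) -
    \sum_(0 <= r < n) \sum_(0 <= i < l) pair_coef (expR (u - v)) i (l + r).
  rewrite -sumrB; apply: eq_bigr => r _; rewrite -sumrB; apply: eq_bigr => i _.
  rewrite /bin_coef /pair_coef expRM_natr max_l ?[(l + r + i)%N]addnC//.
  by rewrite subr_ge0 -expR0 ler_expR subr_le0.
ring.
Qed.

Lemma cross_cov_lt u v l n : v < u ->
  cross_cov l n u v = \sum_(i < l) i%:R^-1
   + ln (1 + expR (v - u)) - \sum_(i < l) \sum_(j < l + n) pair_coef (expR (u - v)) i j.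
Proof.
move=> vu; rewrite /cross_cov (@cov_lE _ _ _ (expR (u - v))); last by left.
rewrite !sum_split_col.
have -> : - `|u - v| = v - u by rewrite gtr0_norm ?opprB// subr_gt0.
have -> : \sum_(0 <= r < n) \sum_(0 <= i < l)
      ((l + r)%:R^-1 * 'C(l + r, i)%:R * Num.max (1 - expR (u - v)) 0 ^+ (l + r - i) * expR ((u - v) * i%:R) -
       (l + r + i)%:R^-1 * 'C(l + r + i, i)%:R * expR ((u - v) * i%:R) / (1 + expR (u - v)) ^+ (l + r + i)) =
    - \sum_(0 <= r < n) \sum_(0 <= i < l) pair_coef (expR (u - v)) i (l + r).
  rewrite -sumrN; apply: eq_bigr => r _; rewrite -sumrN; apply: eq_big_nat => i il.
  rewrite max_r; last by rewrite subr_le0 -expR0 ler_expR subr_ge0 ltW.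
  (* The exponent [l + r - i] is positive because [i < l], so the power of the vanishing positive
     part is 0 and not 1. *)
  rewrite expr0n subn_eq0 leqNgt ltn_addr//= mulr0 mul0r sub0r.
  by rewrite /pair_coef expRM_natr [(l + r + i)%N]addnC.
ring.
Qed.

(** The joint probability and the product both have renormalization weight 1, so the counterterm
    drops out of their difference. *)
Lemma has_integral_cross_cov u v l n : has_integral (fun x =>
   (if u <= v then joint_tail l.+1 (l.+1 + n) (expR (- (x - u))) (expR (- (x - v)))
    else poisson_cdf l.+1 (expR (- (x - u)))) -
   poisson_cdf l.+1 (expR (- (x - u))) * poisson_cdf (l.+1 + n) (expR (- (x - v))))
  (cross_cov l.+1 n u v).
Proof.
have vE (x : R) : expR (- (x - v)) = expR (v - u) * expR (- (x - u)) by rewrite -expRD; congr expR; ring.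
have iE : (expR (v - u))^-1 = expR (u - v) by rewrite -expRN opprB.
under eq_fun do rewrite vE.
have [uv|vu] := leP u v.
  have c1 : 1 <= expR (v - u) by rewrite -expR0 ler_expR subr_ge0.
  (* With [c = c0 = expR (v - u)] the logarithm [ln ((1 + c) / c0)] becomes [ln (1 + expR (u - v))].
     In the other case the reference rate is 1. *)
  have := renormalized_sub (renormalized_joint u l (l + n) c1)
    (renormalized_cdf_mul u l (l + n) (expR_gt0 (v - u)) (expR_gt0 (v - u))).
  rewrite sum_gumbel_value_pair ?expR_gt0// iE cross_cov_ge// opprB addrA.
  have -> // : (1 + expR (v - u)) * expR (u - v) = 1 + expR (u - v).
  have vu0 : v - u + (u - v) = 0 by ring.
  by rewrite mulrDl mul1r -expRD vu0 expR0 addrC.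
have := renormalized_sub (renormalized_cdf u l)
    (renormalized_cdf_mul u l (l + n) ltr01 (expR_gt0 (v - u))).
by rewrite sum_gumbel_value_pair ?expR_gt0// iE cross_cov_lt// opprB addrA divr1.
Qed.
End cross_covariance.

(** * Products of independent uniform variables *)

Section first_coordinate.
Variable R : realType.

Definition scons (z : measurableTypeR R * seqR R) : seqR R :=
  fun i => if i is k.+1 then z.2 k else z.1.

Definition cylinder (n : nat) (B : nat -> set R) : set (seqR R) :=
  [set f : seqR R | forall i, (i < n)%N -> B i (f i)].

Lemma measurable_coord (i : nat) : measurable_fun setT (fun f : seqR R => f i).
Proof.
move=> _ B mB; rewrite setTI; apply: sub_sigma_algebra.
by exists i, B.
Qed.

Lemma measurable_scons : measurable_fun setT scons.
Proof.
apply: (@measurability _ _ _ (seqR R) setT scons (@coord_sets R) erefl) => _ [_ [i [B [mB ->]]] <-]; rewrite setTI.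
case: i => [|k].
  have -> : scons @^-1` ((fun f : seq_space R => f 0%N) @^-1` B) = B `*` setT.
    by apply/seteqP; split => [[y f]|[y f]] //= [].
  exact: measurableX.
have -> : scons @^-1` ((fun f : seq_space R => f k.+1) @^-1` B) =
    setT `*` ((fun f : seqR R => f k) @^-1` B).
  by apply/seteqP; split => [[y f]|[y f]] //= [].
apply: measurableX => //; rewrite -[X in measurable X]setTI; exact: measurable_coord.
Qed.

Lemma measurable_cylinder n B : (forall i, measurable (B i)) -> measurable (cylinder n B).
Proof.
move=> mB.
have -> : cylinder n B = \bigcap_(i in [set i | (i < n)%N]) ((fun f : seqR R => f i) @^-1` (B i)).
  by apply/seteqP; split => f /= h i; exact: h.
apply: bigcap_measurableType => i _; rewrite -[X in measurable X]setTI; exact: measurable_coord.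
Qed.

Lemma uniform_prob01 (B : set R) : measurable B ->
  uniform_prob (@ltr01 R) B = lebesgue_measure (B `&` `[0%R, 1%R]).
Proof.
move=> mB; rewrite /uniform_prob integral_uniform_pdf.
rewrite (eq_integral (cst 1%E)).
  by rewrite integral_cst ?mul1e//; exact: measurableI.
move=> x; rewrite inE => -[_ /=]; rewrite in_itv/= /uniform_pdf => ->.
by rewrite subr0 invr1.
Qed.

Lemma iid_uniform_unique (m1 m2 : {measure set (seqR R) -> \bar R}) :
  (m1 setT < +oo)%E ->
  (forall n B, (forall i, measurable (B i)) -> m1 (cylinder n B) = m2 (cylinder n B)) ->
  forall A, measurable A -> m1 A = m2 A.
Proof.
move=> fin m12 A mA.
pose G : set (set (seqR R)) := [set A | exists n B, (forall i, measurable (B i)) /\ A = cylinder n B].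
have cylT : cylinder 0 (fun=> setT) = setT by apply/seteqP; split.
apply: (@g_sigma_algebra_measure_unique _ R (seqR R) G _ (fun=> setT)).
- by move=> _ [n [B [mB ->]]]; exact: measurable_cylinder.
- by move=> _; exists 0%N, (fun=> setT); split => //.
- by apply/seteqP; split => // x _; exists 0%N.
- move=> _ _ [n [B [mB ->]]] [n' [B' [mB' ->]]].
  exists (maxn n n'), (fun i => (if (i < n)%N then B i else setT) `&` (if (i < n')%N then B' i else setT)).
  split; first by move=> i; apply: measurableI; case: ifP.
  apply/seteqP; split => f.
    by move=> [h h'] i _; split; case: ifP => // ?; [exact: h|exact: h'].
  by move=> h; split => i lt; have [] := h i (leq_trans lt _); rewrite ?leq_maxl ?leq_maxr// lt.
- by move=> _ [n [B [mB ->]]]; exact: m12.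
- by [].
apply: (smallest_sub _ _ mA); first exact: smallest_sigma_algebra.
move=> _ [i [B [mB ->]]]; apply: sub_sigma_algebra.
exists i.+1, (fun j => if j == i then B else setT); split; first by move=> j; case: ifP.
apply/seteqP; split => f /=; last by move=> /(_ i (ltnSn i)); rewrite eqxx.
by move=> Bf j _; case: eqP => [->|].
Qed.

Variable P : probability (seqR R) R.
Hypothesis HP : iid_uniform P.

(** Prepending an independent uniform variable to the sequence leaves [P] unchanged, as both
    measures agree on cylinders. Conditioning on the first factor is the engine of every induction
    on the length of a product. *)
Lemma iid_uniform_scons (A : set (seqR R)) : measurable A ->
  (P A = \int[lebesgue_measure]_(y in `[0%R, 1%R]) P [set f | A (scons (y, f))])%E.
Proof.
move=> mA.
pose S : {mfun (measurableTypeR R * seqR R)%type >-> seqR R} :=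
  HB.pack scons (isMeasurableFun.Build _ _ _ _ scons measurable_scons).
have HP' n B : (forall i, measurable (B i)) ->
  P (cylinder n B) = (\prod_(i < n) lebesgue_measure (B i `&` `[0%R, 1%R]))%E by exact: HP.
have -> : P A = pushforward (uniform_prob (@ltr01 R) \x P)%E S A.
  apply: (@iid_uniform_unique P (pushforward (uniform_prob (@ltr01 R) \x P)%E S)) => //.
    by rewrite -ge0_fin_numE//; exact: fin_num_measure.
  move=> n B mB; rewrite [LHS](HP' n B mB).
  transitivity ((uniform_prob (@ltr01 R) \x P)%E (scons @^-1` cylinder n B)); last by [].
  case: n => [|n].
    rewrite big_ord0 (_ : scons @^-1` _ = setT `*` setT); last by apply/seteqP; split.
    rewrite product_measure1E// -[LHS](mule1 1%E).
    by congr (_ * _)%E; apply/esym; exact: probability_setT.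
  rewrite (_ : scons @^-1` _ = B 0%N `*` cylinder n (fun i => B i.+1)).
    rewrite product_measure1E; [|exact: mB|exact: measurable_cylinder].
    rewrite big_ord_recl; congr (_ * _)%E; first by apply/esym/uniform_prob01.
    by apply/esym; exact: (HP' n (fun i => B i.+1)).
  apply/seteqP; split => [[y f]|[y f]] /= h.
    by split; [exact: (h 0%N)|move=> i lt; exact: (h i.+1)].
  by case: h => h0 h [|i] lt //; exact: h.
rewrite -[LHS]/(\int[uniform_prob (@ltr01 R)]_x (P \o xsection (S @^-1` A)) x)%E.
have mSA : measurable (S @^-1` A).
  by rewrite -[X in measurable X]setTI; exact: measurable_scons.
rewrite integral_uniform//; last exact: measurable_fun_xsection.
rewrite subr0 invr1 mul1e; apply: eq_integral => y _ /=; congr (P _).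
by apply/seteqP; split => f; rewrite xsectionE.
Qed.
End first_coordinate.

Section log_integrals.
Variable R : realType.
Local Notation mu := (@lebesgue_measure R).

Lemma is_derive_sum_ln (b : nat -> R) (l : nat) (s y : R) : 0 < y ->
  is_derive y (1 : R) (fun y => \sum_(i < l) b i * (s + ln y) ^+ i.+1)
    (\sum_(i < l) b i * i.+1%:R * (s + ln y) ^+ i / y).
Proof.
move=> y0; elim: l => [|l ih].
  rewrite big_ord0 [X in is_derive _ _ X](_ : _ = cst 0); first exact: is_derive_cst.
  by apply/funext => z; rewrite big_ord0.
rewrite big_ord_recr/= [X in is_derive _ _ X](_ : _ =
   (fun y => \sum_(i < l) b i * (s + ln y) ^+ i.+1) \+ (fun y => b l * (s + ln y) ^+ l.+1)); last first.
  by apply/funext => z; rewrite big_ord_recr.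
have dl := is_derive1_ln y0.
have dX := is_derive_exprS l (s + ln y).
have d2 : is_derive y (1:R) (fun y => s + ln y) (y^-1).
  by have := is_deriveD (is_derive_cst s y (1 : R)) dl; rewrite add0r.
have d1 := @is_derive1_comp R (fun z => z ^+ l.+1) (fun y => s + ln y) y _ _ dX d2.
have d3 : is_derive y (1:R) (fun y => b l * (s + ln y) ^+ l.+1) (b l * l.+1%:R * (s + ln y) ^+ l / y).
  apply: (@is_derive_eq _ _ _ _ _ _ _ _ (is_deriveZ (b l) d1)).
  by rewrite /GRing.scale/=; ring.
exact: is_deriveD.
Qed.

Lemma continuous_sum_ln (a : nat -> R) (l : nat) (s y : R) : 0 < y ->
  {for y, continuous (fun y => \sum_(i < l) a i * (s + ln y) ^+ i / y)}.
Proof.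
move=> y0.
have -> : (fun y => \sum_(i < l) a i * (s + ln y) ^+ i / y) =
   (fun y => (\poly_(i < l) a i).[s + ln y] * y^-1).
  by apply/funext => w; rewrite horner_poly mulr_suml.
apply: cvgM; last by apply: cvgV; [rewrite gt_eqF|exact: cvg_id].
apply: (cvg_comp (fun y => s + ln y) (horner (\poly_(i < l) a i))); last exact: continuous_horner.
by apply: cvgD; [exact: cvg_cst|exact: continuous_ln].
Qed.

Lemma integral_sum_ln (a : nat -> R) (l : nat) (s x z : R) : 0 < x -> x <= z ->
  (\int[mu]_(y in `[x, z]) (\sum_(i < l) a i * (s + ln y) ^+ i / y)%:E =
   (\sum_(i < l) a i / i.+1%:R * ((s + ln z) ^+ i.+1 - (s + ln x) ^+ i.+1))%:E)%E.
Proof.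
move=> x0; rewrite le_eqVlt => /predU1P[<-|xz].
  rewrite set_itv1 integral_set1 big1// => i _.
  by rewrite subrr mulr0.
pose F y := \sum_(i < l) (a i / i.+1%:R) * (s + ln y) ^+ i.+1.
have dF (y : R) : 0 < y -> is_derive y (1:R) F (\sum_(i < l) a i * (s + ln y) ^+ i / y).
  move=> y0; have := is_derive_sum_ln (fun i => a i / i.+1%:R) l s y0.
  move=> H; apply: (@is_derive_eq _ _ _ _ _ _ _ _ H); apply: eq_bigr => i _.
  by rewrite divfK// pnatr_eq0.
have cF (y : R) : 0 < y -> {for y, continuous F}.
  by move=> y0; apply/differentiable_continuous/derivable1_diffP; case: (dF y y0).
have cf (y : R) (y0 : 0 < y) := @continuous_sum_ln a l s y y0.
rewrite (@continuous_FTC2 _ _ F)//.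
- by rewrite -EFinB /F -sumrB; congr EFin; apply: eq_bigr => i _; rewrite mulrBr.
- apply: continuous_in_subspaceT => y; rewrite inE/= in_itv/= => /andP[xy _].
  by apply: cf; exact: lt_le_trans xy.
- split.
  + by move=> y; rewrite in_itv/= => /andP[xy _]; case: (dF y (lt_trans x0 xy)).
  + exact/cvg_at_right_filter/cF.
  + by apply/cvg_at_left_filter/cF; exact: lt_trans xz.
- move=> y; rewrite in_itv/= => /andP[xy _]; rewrite derive1E.
  by have := dF y (lt_trans x0 xy) => ?; exact: derive_val.
Qed.

Lemma ge0_integral_split (g : R -> \bar R) (p q r : R) : p <= q -> q <= r ->
  measurable_fun setT g -> (forall x, 0 <= g x)%E ->
  (\int[mu]_(x in `[p, r]) g x = \int[mu]_(x in `[p, q[) g x + \int[mu]_(x in `[q, r]) g x)%E.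
Proof.
move=> pq qr mg g0.
have -> : `[p, r]%classic = `[p, q[%classic `|` `[q, r]%classic :> set R.
  by rewrite -itv_bndbnd_setU// bnd_simp.
rewrite ge0_integral_setU//.
- exact: measurable_funTS.
- apply/disj_setPS => x []; rewrite /= !in_itv/= => /andP[_ xq] /andP[qx _].
  by have := lt_le_trans xq qx; rewrite ltxx.
Qed.
End log_integrals.

(** * Laws of the partial products *)

Section product_law.
Variables (R : realType) (P : probability (seqR R) R).
Hypothesis HP : iid_uniform P.
Local Notation mu := (@lebesgue_measure R).

Definition sprod (n : nat) (f : seqR R) : R := \prod_(i < n) f i.

Lemma sprod_scons n y f : sprod n.+1 (scons (y, f)) = y * sprod n f.
Proof. by rewrite /sprod big_ord_recl. Qed.

Lemma measurable_sprod n : measurable_fun setT (sprod n).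
Proof.
elim: n => [|n ih].
  by rewrite (_ : sprod 0 = cst 1)//; apply/funext => f; rewrite /sprod big_ord0.
rewrite (_ : sprod n.+1 = (fun f => sprod n f * f n)); last first.
  by apply/funext => f; rewrite /sprod big_ord_recr.
by apply: measurable_funM => //; exact: measurable_coord.
Qed.

Lemma measurable_sprod_lt n (b : R) : measurable [set f | sprod n f < b].
Proof.
rewrite (_ : [set f | _] = sprod n @^-1` `]-oo, b[%classic).
  rewrite -[X in measurable X]setTI; apply: measurable_sprod => //; exact: measurable_itv.
by apply/seteqP; split => f /=; rewrite in_itv.
Qed.

Lemma measurable_section (A : set (seqR R)) (y : R) : measurable A ->
  measurable [set f | A (scons (y, f))].
Proof.
move=> mA; rewrite (_ : [set f | _] = xsection (@scons R @^-1` A) y).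
  by apply: measurable_xsection; rewrite -[X in measurable X]setTI; exact: measurable_scons.
by apply/seteqP; split => f; rewrite xsectionE.
Qed.

Lemma measurable_section_prob (A : set (seqR R)) : measurable A ->
  measurable_fun setT (fun y : R => P [set f | A (scons (y, f))]).
Proof.
move=> mA.
have mSA : measurable (@scons R @^-1` A).
  by rewrite -[X in measurable X]setTI; exact: measurable_scons.
rewrite (_ : (fun y => _) = P \o xsection (@scons R @^-1` A)); first exact: measurable_fun_xsection.
by apply/funext => y /=; congr (P _); apply/seteqP; split => f; rewrite xsectionE.
Qed.

Definition unit_box n : set (seqR R) := [set f | forall i, (i < n)%N -> 0 <= f i <= 1].

Lemma measurable_unit_box n : measurable (unit_box n).
Proof.
rewrite (_ : unit_box n = cylinder n (fun=> `[0, 1]%classic)).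
  by apply: measurable_cylinder => i; exact: measurable_itv.
by apply/seteqP; split => f /= h i /h; rewrite /= in_itv.
Qed.

Lemma unit_box1 n : P (unit_box n) = 1%E.
Proof.
rewrite (_ : unit_box n = cylinder n (fun=> `[0, 1]%classic)).
  have := HP n (B := fun=> `[0, 1]%classic); rewrite -/(cylinder n _) => ->; last first.
    by move=> i; exact: measurable_itv.
  rewrite big1// => i _; rewrite setIid lebesgue_measure_itv/= lte01.
  by rewrite oppr0 adde0.
by apply/seteqP; split => f /= h i /h; rewrite /= in_itv.
Qed.

(** The sample space is all of [seqR R], whereas bounds and monotonicity of the products hold on the
    unit box. Since the box has full measure, events may be compared there. *)
Lemma unit_box_ae n (A B : set (seqR R)) : measurable A -> measurable B ->
  (forall f, unit_box n f -> (A f <-> B f)) -> P A = P B.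
Proof.
move=> mA mB AB.
have mU := measurable_unit_box n.
have PI (C : set (seqR R)) : measurable C -> P C = P (C `&` unit_box n).
  move=> mC; rewrite -[in LHS](setIT C) -(setUv (unit_box n)) setIUr measureU.
  - rewrite [X in (_ + X)%E](_ : _ = 0%E) ?adde0//.
    apply/eqP; rewrite eq_le measure_ge0 andbT.
    apply: (@le_trans _ _ (P (~` unit_box n))).
      apply: le_measure; rewrite ?inE//; [exact: measurableI mC (measurableC mU)|exact: measurableC].
    by rewrite probability_setC// unit_box1 subee.
  - exact: measurableI.
  - by apply: measurableI => //; exact: measurableC.
  - by rewrite setIACA setICr setI0.
rewrite (PI _ mA) (PI _ mB); congr (P _); apply/seteqP; split => f [h u]; split => //; exact/(AB f u).
Qed.

Lemma sprod_bound n f : unit_box n f -> 0 <= sprod n f <= 1.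
Proof.
elim: n => [|n ih] u; first by rewrite /sprod big_ord0 ler01 lexx.
rewrite /sprod big_ord_recr/=.
have /ih/andP[h0 h1] : unit_box n f by move=> i lt; apply: u; exact: ltnW.
have /andP[f0 f1] := u n (ltnSn n).
by rewrite mulr_ge0//= mulr_ile1.
Qed.

Lemma sprod_anti m n f : (m <= n)%N -> unit_box n f -> sprod n f <= sprod m f.
Proof.
move=> /subnK <-; elim: (n - m)%N => [//|k ih] u; rewrite addSn /sprod big_ord_recr/=.
have u' : unit_box (k + m) f by move=> i lt; apply: u; rewrite addSn ltnW.
have /andP[f0 f1] := u (k + m)%N (ltnSn _).
apply: le_trans (ih u'); rewrite ler_piMr//.
by have /andP[] := sprod_bound u'.
Qed.

(** Given the first factor [y], the remaining product has to equal [c / y]. The result discards ties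
    with the thresholds, where the strict and weak inequalities of the kernels differ. *)
Lemma prob_sprod_eq k (c : R) : 0 < c -> P [set f | sprod k.+1 f = c] = 0%E.
Proof.
have mS n (e : R) : measurable [set f | sprod n f = e].
  rewrite (_ : [set f | _] = sprod n @^-1` [set e]); last by apply/seteqP; split.
  by rewrite -[X in measurable X]setTI; apply: measurable_sprod => //; exact: measurable_set1.
elim: k c => [|k ih] c c0; rewrite iid_uniform_scons//.
  transitivity (\int[mu]_(y in `[0%R, 1%R]) (\1_[set c] y)%:E)%E.
    apply: eq_integral => y _; rewrite indicE; case: (boolP (y \in _)) => /= [/set_mem ->|/negP yc].
      rewrite (_ : [set f | _] = setT) ?probability_setT//.
      by apply/seteqP; split => // f _ /=; rewrite sprod_scons /sprod big_ord0 mulr1.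
    rewrite (_ : [set f | _] = set0) ?measure0//.
    apply/seteqP; split => // f /=; rewrite sprod_scons /sprod big_ord0 mulr1 => yE.
    by apply: yc; rewrite inE.
  rewrite integral_indic//.
  apply/eqP; rewrite eq_le measure_ge0 andbT -(lebesgue_measure_set1 c).
  apply: le_measure; rewrite ?inE; [|exact: measurable_set1|exact: subIsetl].
  by apply: measurableI; [exact: measurable_set1|exact: measurable_itv].
rewrite integral0_eq// => y _.
have [y0|y0] := eqVneq y 0.
  rewrite (_ : [set f | _] = set0) ?measure0//.
  by apply/seteqP; split => // f /=; rewrite sprod_scons y0 mul0r => c0'; move: c0; rewrite -c0' ltxx.
(* A negative quotient would force a negative product, which is excluded on the unit box. *)
have [yneg|ypos] := ltP (c / y) 0.
  rewrite (@unit_box_ae k.+1 _ set0) ?measure0//.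
    exact: measurable_section.
  move=> f /sprod_bound/andP[s0 _]; split => // /=; rewrite sprod_scons => h.
  by move: yneg; rewrite -h [y * _]mulrC mulfK// ltNge s0.
rewrite (_ : [set f | _] = [set f | sprod k.+1 f = c / y]).
  by apply: ih; rewrite lt_neqAle ypos andbT eq_sym mulf_neq0 ?invr_eq0// gt_eqF.
by apply/seteqP; split => f /=; rewrite sprod_scons => h; [rewrite -h [y * _]mulrC mulfK|rewrite h mulrC divfK].
Qed.

Lemma measurable_sprod_lt2 l m (a b : R) : measurable [set f | sprod l f < a /\ sprod m f < b].
Proof.
rewrite (_ : [set f | _] = [set f | sprod l f < a] `&` [set f | sprod m f < b])//.
by apply: measurableI; exact: measurable_sprod_lt.
Qed.

Lemma prob_section1 n (A : set (seqR R)) : measurable A ->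
  (forall f, unit_box n f -> A f) -> P A = 1%E.
Proof.
move=> mA h; rewrite -(probability_setT P); apply: (@unit_box_ae n) => // f u.
by split => // _; exact: h.
Qed.

Lemma poisson_cdf_logE m (t y : R) : 0 < y -> poisson_cdf m (t + ln y) =
  \sum_(k < m) (expR (- t) / k`!%:R) * (t + ln y) ^+ k / y.
Proof.
move=> y0; apply: eq_bigr => k _.
rewrite /psi opprD expRD (expRN (ln y)) lnK ?posrE//; ring.
Qed.

(** Condition on the first factor [y]. Below [expR (- t)] the event is certain and contributes
    [psi 0 t]; otherwise [- ln y] is the first Poisson point and [t + ln y] is the time left for the
    other factors. *)
Lemma prob_sprod_lt m (t : R) : 0 <= t ->
  P [set f | sprod m f < expR (- t)] = (poisson_cdf m t)%:E.
Proof.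
elim: m t => [|m ih] t t0.
  rewrite /poisson_cdf big_ord0 (_ : [set f | _] = set0) ?measure0//.
  apply/seteqP; split => // f /=; rewrite /sprod big_ord0 ltNge -expR0 ler_expR oppr_le0 t0//.
have b0 := expR_gt0 (- t).
have b1 : expR (- t) <= 1 by rewrite -expR0 ler_expR oppr_le0.
have mA := measurable_sprod_lt m.+1 (expR (- t)).
rewrite iid_uniform_scons// (@ge0_integral_split _ _ _ (expR (- t)))//; last exact: measurable_section_prob.
have -> : (\int[mu]_(y in `[0%R, expR (- t)[) P [set f | [set f0 | (sprod m.+1 f0 < expR (- t))%R] (scons (y, f))] =
   (expR (- t))%:E)%E.
  transitivity (\int[mu]_(y in `[0%R, expR (- t)[) cst 1%E y)%E; last first.
    rewrite integral_cst//= lebesgue_measure_itv/= lte_fin b0 oppr0 adde0 mul1e//.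
  apply: eq_integral => y; rewrite inE/= in_itv/= => /andP[y0 yb].
  apply: (@prob_section1 m); first exact: (measurable_section y mA).
  move=> f /sprod_bound/andP[s0 s1] /=; rewrite sprod_scons (le_lt_trans _ yb)// ler_piMr//.
transitivity ((expR (- t))%:E + \int[mu]_(y in `[expR (- t), 1%R]) (\sum_(k < m) (expR (- t) / k`!%:R) * (t + ln y) ^+ k / y)%:E)%E.
  congr (_ + _)%E; apply: eq_integral => y; rewrite inE/= in_itv/= => /andP[by_ y1].
  have y0 : 0 < y by exact: lt_le_trans by_.
  rewrite -poisson_cdf_logE// -ih; last by rewrite -lerBlDl sub0r -ler_expR lnK ?posrE.
  congr (P _); apply/seteqP; split => f /=; rewrite sprod_scons opprD expRD (expRN (ln y)) lnK ?posrE//.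
    by rewrite ltr_pdivlMr// mulrC.
  by rewrite ltr_pdivlMr// mulrC.
rewrite (@integral_sum_ln _ (fun k => expR (- t) / k`!%:R))// -EFinD; congr EFin.
rewrite /poisson_cdf big_ord_recl /= {1}/psi expr0 fact0 divr1 mul1r; congr (_ + _).
apply: eq_bigr => k _.
rewrite ln1 addr0 expRK subrr expr0n subr0 /psi /bump/= add1n factS natrM.
have kf : k`!%:R != 0 :> R by rewrite pnatr_eq0 -lt0n fact_gt0.
have k1 : k.+1%:R != 0 :> R by rewrite pnatr_eq0.
by field; rewrite kf addrC natr1 k1.
Qed.

Lemma joint_tail_logE l m (s t y : R) : 0 < y -> joint_tail l m (s + ln y) (t + ln y) =
  \sum_(i < l) (\sum_(j < m) expR (- t) * ('C(j, i)%:R / j`!%:R * (t - s) ^+ (j - i))) * (s + ln y) ^+ i / y.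
Proof.
move=> y0; rewrite /joint_tail opprD expRD (expRN (ln y)) lnK ?posrE// mulr_sumr.
apply: eq_bigr => i _; rewrite mulr_sumr mulr_suml mulr_suml; apply: eq_bigr => j _.
have -> : t + ln y - (s + ln y) = t - s by ring.
ring.
Qed.

(** Same conditioning, with the first Poisson point after [t], between [s] and [t], or before [s].
    In the last case both times drop by the same amount, so [t - s] is preserved and the induction
    applies. *)
Lemma prob_sprod_lt2 l m (s t : R) : (l <= m)%N -> 0 <= s -> s <= t ->
  P [set f | sprod l f < expR (- s) /\ sprod m f < expR (- t)] = (joint_tail l m s t)%:E.
Proof.
elim: l m s t => [|l ih] m s t lm s0 st.
  rewrite /joint_tail big_ord0 mulr0 (_ : [set f | _] = set0) ?measure0//.
  apply/seteqP; split => // f [] /=; rewrite /sprod big_ord0 ltNge -expR0 ler_expR oppr_le0 s0//.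
case: m lm => [//|m] lm.
have t0 : 0 <= t by exact: le_trans st.
have b0 := expR_gt0 (- t); have a0 := expR_gt0 (- s).
have a1 : expR (- s) <= 1 by rewrite -expR0 ler_expR oppr_le0.
have ba : expR (- t) <= expR (- s) by rewrite ler_expR lerN2.
have mA := measurable_sprod_lt2 l.+1 m.+1 (expR (- s)) (expR (- t)).
have mg := measurable_section_prob mA.
set A := [set f : seqR R | _] in mA mg *.
rewrite iid_uniform_scons// (@ge0_integral_split _ _ _ (expR (- s)))//.
(* The first point lies after [s]: the condition on [l.+1] factors holds automatically, and the
   value is the row [i = 0] of [joint_tail]. *)
have E1 : (\int[mu]_(y in `[0%R, expR (- s)[) P [set f | A (scons (y, f))] =
   (expR (- t) + \sum_(k < m) (expR (- t) / k`!%:R) / k.+1%:R * (t - s) ^+ k.+1)%:E)%E.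
  rewrite integral_itv_bndo_bndc; last exact: measurable_funTS.
  rewrite (@ge0_integral_split _ _ _ (expR (- t)))//.
  rewrite EFinD; congr (_ + _)%E.
    transitivity (\int[mu]_(y in `[0%R, expR (- t)[) cst 1%E y)%E; last first.
      by rewrite integral_cst//= lebesgue_measure_itv/= lte_fin b0 oppr0 adde0 mul1e.
    apply: eq_integral => y; rewrite inE/= in_itv/= => /andP[y0 yb].
    apply: (@prob_section1 m); first exact: (measurable_section y mA).
    move=> f u /=; have /andP[p0 p1] := sprod_bound u.
    have /andP[q0 q1] : 0 <= sprod l f <= 1.
      by apply: sprod_bound => i lt; apply: u; exact: leq_trans lt lm.
    rewrite /A /= !sprod_scons; split.
      by rewrite (le_lt_trans _ (lt_le_trans yb ba))// ler_piMr.
    by rewrite (le_lt_trans _ yb)// ler_piMr.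
  rewrite -integral_itv_bndo_bndc; last exact: measurable_funTS.
  transitivity (\int[mu]_(y in `[expR (- t), expR (- s)[) (\sum_(k < m) (expR (- t) / k`!%:R) * (t + ln y) ^+ k / y)%:E)%E.
    apply: eq_integral => y; rewrite inE/= in_itv/= => /andP[by_ ya].
    have y0 : 0 < y by exact: lt_le_trans by_.
    rewrite -poisson_cdf_logE// -prob_sprod_lt; last by rewrite -lerBlDl sub0r -ler_expR lnK ?posrE.
    apply: (@unit_box_ae m); [exact: (measurable_section y mA)|exact: measurable_sprod_lt|].
    move=> f u; rewrite /A /= !sprod_scons opprD expRD (expRN (ln y)) lnK ?posrE// ltr_pdivlMr// (mulrC _ y).
    have /andP[q0 q1] : 0 <= sprod l f <= 1.
      by apply: sprod_bound => i lt; apply: u; exact: leq_trans lt lm.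
    split => [[]//|h]; split => //.
    by rewrite (le_lt_trans _ ya)// ler_piMr// ltW.
  have mlog : measurable_fun `[expR (- t), expR (- s)[ (fun y : R => (\sum_(k < m) (expR (- t) / k`!%:R) * (t + ln y) ^+ k / y)%:E).
    apply/measurable_EFinP; apply: subspace_continuous_measurable_fun => //.
    apply: continuous_in_subspaceT => y; rewrite inE/= in_itv/= => /andP[by_ _].
    apply: (@continuous_sum_ln _ (fun k => expR (- t) / k`!%:R)); exact: lt_le_trans by_.
  rewrite integral_itv_bndo_bndc// (@integral_sum_ln _ (fun k => expR (- t) / k`!%:R))//.
  congr EFin; apply: eq_bigr => k _; rewrite !expRK subrr expr0n /= subr0; congr (_ * _ ^+ _).
rewrite E1.
transitivity ((expR (- t) + \sum_(k < m) (expR (- t) / k`!%:R) / k.+1%:R * (t - s) ^+ k.+1)%:E +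
  \int[mu]_(y in `[expR (- s), 1%R]) (\sum_(i < l) (\sum_(j < m) expR (- t) * ('C(j, i)%:R / j`!%:R * (t - s) ^+ (j - i))) * (s + ln y) ^+ i / y)%:E)%E.
  congr (_ + _)%E; apply: eq_integral => y; rewrite inE/= in_itv/= => /andP[ay y1].
  have y0 : 0 < y by exact: lt_le_trans ay.
  rewrite -joint_tail_logE// -ih//; last 2 first.
  - by rewrite -lerBlDl sub0r -ler_expR lnK ?posrE.
  - by rewrite lerD2r.
  rewrite /A; congr (P _); apply/seteqP; split => f /=;
    by rewrite !sprod_scons !opprD !expRD (expRN (ln y)) lnK ?posrE// !ltr_pdivlMr// ![_ * y]mulrC.
rewrite (@integral_sum_ln _ (fun i => \sum_(j < m) expR (- t) * ('C(j, i)%:R / j`!%:R * (t - s) ^+ (j - i))))//.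
rewrite -EFinD; congr EFin.
rewrite /joint_tail [in RHS]big_ord_recl mulrDr; congr (_ + _).
  rewrite big_ord_recl mulrDr mulr_sumr; congr (_ + _).
    by rewrite bin0 fact0 /= !expr0 divr1 !mulr1.
  apply: eq_bigr => k _; rewrite /= /bump /= add1n bin0 expr0 subn0 factS natrM.
  have kf : k`!%:R != 0 :> R by rewrite pnatr_eq0 -lt0n fact_gt0.
  have k1 : k.+1%:R != 0 :> R by rewrite pnatr_eq0.
  by field; rewrite kf addrC natr1 k1.
rewrite mulr_sumr; apply: eq_bigr => i _.
(* In the rows with at least one point before [s], the column [j = 0] is empty; the remaining
   indices are shifted by one on both sides. *)
rewrite [in RHS]big_ord_recl /= bin0n /= !mul0r add0r mulr_suml mulr_suml mulr_sumr.
apply: eq_bigr => j _; rewrite ln1 addr0 expRK subrr expr0n subr0 /bump /= !add1n subSS.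
have jf : j`!%:R != 0 :> R by rewrite pnatr_eq0 -lt0n fact_gt0.
have j1 : j.+1%:R != 0 :> R by rewrite pnatr_eq0.
have i1 : i.+1%:R != 0 :> R by rewrite pnatr_eq0.
have := mul_bin_diag j.+1 i => /(congr1 (fun n : nat => n%:R : R)); rewrite !natrM /= => E.
have -> : 'C(j.+1, i.+1)%:R = j.+1%:R * 'C(j, i)%:R / i.+1%:R :> R by rewrite E mulrC mulKf.
rewrite -/(factorial j).
move: jf j1 i1; set x := _`!%:R; set y := j.+1%:R; set z := i.+1%:R => jf j1 i1.
by clearbody x y z; field; rewrite jf i1 j1.
Qed.
End product_law.

(** * The covariance of the process *)

Section kernel.
Variables (R : realType) (P : probability (seqR R) R).
Hypothesis HP : iid_uniform P.
Local Notation mu := (@lebesgue_measure R).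

Definition Z_kernel (l : nat) (u : R) (p : R * seqR R) : R :=
  - Z1_integrand u p - \sum_(1 <= k < l) X_integrand k u p.

Lemma Z_kernelS l u p : Z_kernel l.+2 u p = Z_kernel l.+1 u p - X_integrand l.+1 u p.
Proof. by rewrite /Z_kernel big_nat_recr// -[RHS]addrA; congr (_ + _); exact: opprD. Qed.

(** The second hypothesis excludes ties: [Z1_integrand] uses a weak inequality, and the indicator in
    [X_integrand] is strict at both ends. *)
Lemma Z_kernelE l (u x : R) (y : seqR R) : unit_box l.+1 y ->
  (forall k, sprod k.+1 y <> expR (- expR (- (x - u)))) ->
  Z_kernel l.+1 u (x, y) = poisson_cdf l.+1 (expR (- (x - u))) -
    \1_[set f | sprod l.+1 f < expR (- expR (- (x - u)))] y.
Proof.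
set t := expR (- (x - u)) => + ne.
have ind (k : nat) (c : R) : \1_[set f | sprod k f < c] y = (if sprod k y < c then 1 else 0) :> R.
  by rewrite indicE; case: ifPn => h; [rewrite mem_set|rewrite memNset//; exact/negP].
elim: l => [|l ih] ub.
  rewrite /Z_kernel big_geq// subr0 /Z1_integrand /= -/t /poisson_cdf big_ord1.
  rewrite /psi expr0 fact0 divr1 mul1r opprB ind; congr (_ - _).
  have := ne 0%N; rewrite /sprod big_ord1 /= => /eqP ne0.
  by rewrite le_eqVlt (negbTE ne0).
have ubl : unit_box l.+1 y by move=> i il; apply: ub; exact: ltnW.
rewrite Z_kernelS ih//.
have sl : sprod l.+2 y <= sprod l.+1 y by apply: sprod_anti.
rewrite [in RHS]/poisson_cdf big_ord_recr /= -/(poisson_cdf _ _) /X_integrand /= -/t.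
rewrite -![\prod_(i < _) y i]/(sprod _ y) !ind {1 2}/psi expr0 fact0 divr1 mul1r.
(* If the shorter product is already below the threshold, so is the longer one and the new indicator
   vanishes; otherwise the new indicator is that of the longer product being below. *)
have /eqP := ne l; case: (ltgtP (sprod l.+1 y)) => // h _.
  by rewrite (le_lt_trans sl h) andbF; ring.
by rewrite andbT; case: ifP => _ /=; ring.
Qed.

Lemma Z_kernel_ae l (u x : R) :
  \forall y \ae P, Z_kernel l.+1 u (x, y) = poisson_cdf l.+1 (expR (- (x - u))) -
    \1_[set f | sprod l.+1 f < expR (- expR (- (x - u)))] y.
Proof.
have h1 : \forall y \ae P, unit_box l.+1 y.
  exists (~` @unit_box R l.+1); split => //; first by apply: measurableC; exact: measurable_unit_box.
  by rewrite probability_setC ?(unit_box1 HP) ?subee//; exact: (@measurable_unit_box R).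
have h2 : \forall y \ae P, forall k, sprod k.+1 y <> expR (- expR (- (x - u))).
  apply/ae_foralln => k.
  exists [set f : seqR R | sprod k.+1 f = expR (- expR (- (x - u)))]; split.
  - rewrite (_ : [set f : seqR R | _] = @sprod R k.+1 @^-1` [set expR (- expR (- (x - u)))]).
      by rewrite -[X in measurable X]setTI; apply: measurable_sprod.
    by apply/seteqP; split.
  - by apply: prob_sprod_eq => //; exact: expR_gt0.
  - by move=> y /=; apply: contrapT.
by apply: filterS2 h1 h2 => y; exact: Z_kernelE.
Qed.

Lemma integral_centered_indic (d : measure_display) (T : measurableType d)
  (Q : probability T R) (A B : set T) (a b c : R) :
  measurable A -> measurable B -> Q A = a%:E -> Q B = b%:E -> Q (A `&` B) = c%:E ->
  (\int[Q]_y ((a - \1_A y) * (b - \1_B y))%:E = (c - a * b)%:E)%E.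
Proof.
move=> mA mB QA QB QAB.
have mAB : measurable (A `&` B) by exact: measurableI.
transitivity (\int[Q]_y ((\1_(A `&` B) y)%:E + ((- b)%:E * (\1_A y)%:E +
   ((- a)%:E * (\1_B y)%:E + cst (a * b)%:E y))))%E.
  apply: eq_integral => y _; rewrite -!EFinM -!EFinD; congr EFin.
  by rewrite indicI /=; ring.
have iA := integrable_indic Q mA; have iB := integrable_indic Q mB.
have iAB := integrable_indic Q mAB.
have ic : Q.-integrable setT (cst (a * b)%:E) by exact: finite_measure_integrable_cst.
rewrite integralD//; last by do 2!(apply: integrableD => //; first exact: integrableZl).
rewrite integralD//; [|exact: integrableZl|by apply: integrableD => //; exact: integrableZl].
rewrite integralD//; [|exact: integrableZl].
rewrite (integralZl _ iA)// (integralZl _ iB)//.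
have eC (C : set T) (e : R) : measurable C -> Q C = e%:E -> (\int[Q]_y (\1_C y)%:E = e%:E)%E.
  by move=> mC QC; rewrite (integral_indic _ _ mC)// setIT; exact: QC.
rewrite (eC _ _ mA QA) (eC _ _ mB QB) (eC _ _ mAB QAB) integral_cst//.
rewrite [X in ((a * b)%:E * X)%E](_ : _ = 1%E); last exact: probability_setT.
rewrite mule1.
by rewrite -!EFinM -!EFinD; congr EFin; ring.
Qed.

Lemma integral_Z_kernel_mul l n u v (x : R) :
  measurable_fun [set: measurableTypeR R * seqR R] (Z_kernel l.+1 u) ->
  measurable_fun [set: measurableTypeR R * seqR R] (Z_kernel (l.+1 + n) v) ->
  (\int[P]_y (Z_kernel l.+1 u (x, y) * Z_kernel (l.+1 + n) v (x, y))%:E =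
   ((if u <= v
     then joint_tail l.+1 (l.+1 + n) (expR (- (x - u))) (expR (- (x - v)))
     else poisson_cdf l.+1 (expR (- (x - u)))) -
    poisson_cdf l.+1 (expR (- (x - u))) *
    poisson_cdf (l.+1 + n) (expR (- (x - v))))%:E)%E.
Proof.
move=> mK mL.
set A := [set f : seqR R | sprod l.+1 f < expR (- expR (- (x - u)))].
set B := [set f : seqR R | sprod (l.+1 + n) f < expR (- expR (- (x - v)))].
have mA : measurable A by exact: measurable_sprod_lt.
have mB : measurable B by exact: measurable_sprod_lt.
rewrite (@ae_eq_integral _ _ _ _ _ (fun y => ((poisson_cdf l.+1 (expR (- (x - u))) - \1_A y) *
  (poisson_cdf (l.+1 + n) (expR (- (x - v))) - \1_B y))%:E))//.
- apply: integral_centered_indic => //; rewrite ?(prob_sprod_lt HP) ?expR_ge0//.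
  case: ifPn => uv.
    rewrite -(prob_sprod_lt2 HP) ?expR_ge0 ?leq_addr//.
    by rewrite ler_expR lerN2 lerD2l lerN2.
  (* For [v < u] the longer product has the larger threshold, so [A] is contained in [B] on the unit
     box and the intersection has the probability of [A]. *)
  rewrite -(prob_sprod_lt HP) ?expR_ge0//; apply: (@unit_box_ae _ _ HP (l.+1 + n)) => //.
    exact: measurableI.
  move=> f ub; rewrite /A /B /=; split => [[]//|h]; split => //.
  apply: (le_lt_trans (sprod_anti (leq_addr n l.+1) ub)).
  apply: (lt_le_trans h); rewrite ler_expR lerN2 ler_expR lerN2 lerD2l lerN2.
  by rewrite ltW// ltNge.
- apply/measurable_EFinP; apply: measurable_funM.
    exact: (measurableT_comp mK (pair1_measurable x)).
  exact: (measurableT_comp mL (pair1_measurable x)).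
- by apply/measurable_EFinP; apply: measurable_funM; apply: measurable_funB => //; exact: measurable_indic.
- apply: filterS2 (Z_kernel_ae l u x) (Z_kernel_ae (l + n) v x) => y h1 h2 _.
  by rewrite h1 -/A; rewrite addSn in h2 *; rewrite h2.
Qed.

Lemma Z_kernel_cov l n u v :
  measurable_fun [set: measurableTypeR R * seqR R] (Z_kernel l.+1 u) ->
  measurable_fun [set: measurableTypeR R * seqR R] (Z_kernel (l.+1 + n) v) ->
  (\int[mu \x P]_p (Z_kernel l.+1 u p ^+ 2)%:E < +oo)%E ->
  (\int[mu \x P]_p (Z_kernel (l.+1 + n) v p ^+ 2)%:E < +oo)%E ->
  (\int[mu \x P]_p (Z_kernel l.+1 u p * Z_kernel (l.+1 + n) v p)%:E =
   (cross_cov l.+1 n u v)%:E)%E.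
Proof.
move=> mK mL iK iL.
have iKL := L2_mul_integrable mK mL iK iL.
rewrite -(integral12_prod_meas1 iKL).
case: (has_integral_cross_cov u v l n) => _ <-.
by apply: eq_integral => x _; rewrite /fubini_F integral_Z_kernel_mul.
Qed.

End kernel.

Section covariance_bounds.
Variable R : realType.

Lemma cov_l0 l (u : R) : cov_l l u u = ln 2 - \sum_(1 <= k < l) ((2 * k - 1)`!%:R / (k`!%:R ^+ 2 * 2 ^+ (2 * k))).
Proof.
rewrite /cov_l subrr normr0 oppr0 expR0; congr (_ - _).
by apply: eq_bigr => k _; rewrite mul0r expR0 mulr1.
Qed.

Lemma cov_l_shift l (u v h : R) : cov_l l (u + h) (v + h) = cov_l l u v.
Proof. by rewrite /cov_l (_ : u + h - (v + h) = u - v)//; ring. Qed.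

(** The logarithm alone already satisfies the bound, through [ln (1 + x) <= x] and [1 - h <= q]. The
    finite sum enters with a favourable sign, as [q / (1 + q) ^+ 2] is largest at [q = 1]. *)
Lemma cov_l_modulus l (u v : R) : cov_l l u u - cov_l l u v <= `|u - v|.
Proof.
rewrite cov_l0 /cov_l; set h := `|u - v|; set q := expR (- h).
have h0 : 0 <= h by exact: normr_ge0.
have q0 : 0 < q by exact: expR_gt0.
have q1 : 0 < 1 + q by rewrite addr_gt0.
have qh : 1 - h <= q by exact: expR_ge1Dx.
have qle1 : q <= 1 by rewrite /q -expR0 ler_expR oppr_le0.
have l2 : ln 2 - ln (1 + q) <= h.
  rewrite -ln_div ?posrE//.
  have -> : 2 / (1 + q) = 1 + (1 - q) / (1 + q) by field; rewrite gt_eqF.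
  apply: (le_trans (le_ln1Dx _)).
    by rewrite (lt_le_trans (ltrN10 _))// divr_ge0 ?subr_ge0// ltW.
  by rewrite ler_pdivrMr//; nra.
have ls : \sum_(1 <= k < l) ((2 * k - 1)`!%:R * expR (- h * k%:R)) / (k`!%:R ^+ 2 * (1 + q) ^+ (2 * k)) <=
  \sum_(1 <= k < l) ((2 * k - 1)`!%:R / (k`!%:R ^+ 2 * 2 ^+ (2 * k))) :> R.
  apply: ler_sum => k _.
  have kf : 0 < k`!%:R :> R by rewrite ltr0n fact_gt0.
  have c4 : q / (1 + q) ^+ 2 <= 2^-1 ^+ 2.
    rewrite ler_pdivrMr ?exprn_gt0//; nra.
  have : (q / (1 + q) ^+ 2) ^+ k <= (2^-1 ^+ 2) ^+ k.
    by rewrite lerXn2r// nnegrE ?sqr_ge0// divr_ge0 ?sqr_ge0// ltW.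
  rewrite expr_div_n -!exprM exprVn -expRM_natr => ck.
  have fk : 0 <= (2 * k - 1)`!%:R / k`!%:R ^+ 2 :> R by rewrite divr_ge0 ?exprn_ge0 ?ler0n.
  have := ler_wpM2l fk ck; rewrite mulrACA -invfM.
  by rewrite -[_ * _^-1 * _^-1]mulrA -invfM.
have E (a b c e : R) : a - b - (c - e) = a - c - (b - e) by ring.
by rewrite E; apply: le_trans l2; rewrite gerBl subr_ge0.
Qed.

End covariance_bounds.

Section process.
Variables (R : realType) (d : measure_display) (Om : measurableType d).
Variables (Prob : probability Om R) (P : probability (seqR R) R).
Hypothesis HP : iid_uniform P.
Variable W : set (R * seqR R) -> Om -> R.
Hypothesis HW : gaussian_white_noise Prob (lebesgue_measure \x P)%E W.
Variables (I1 : R -> Om -> R) (X : nat -> R -> Om -> R).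
Hypothesis HI1 : forall u : R,
  wiener_integral Prob (lebesgue_measure \x P)%E W (Z1_integrand u) (I1 u).
Hypothesis HX : forall (k : nat) (u : R), (1 <= k)%N ->
  wiener_integral Prob (lebesgue_measure \x P)%E W (X_integrand k u) (X k u).
Local Notation isonormal := (L2_isonormal Prob (lebesgue_measure \x P)%E W).

Lemma Z_isonormal l u : isonormal (Z_kernel l.+1 u) (Zproc I1 X l.+1 u).
Proof.
elim: l => [|l ih].
  have := isonormal_linear HW (-1) (isonormal0 _ _ _) (wiener_isonormal (HI1 u)).
  rewrite (_ : (fun p => _) = Z_kernel 1 u); last first.
    by apply/funext => p; rewrite /Z_kernel big_geq// subr0 add0r mulN1r.
  rewrite (_ : (fun w => _) = Zproc I1 X 1 u)//.
  by apply/funext => p; rewrite /Zproc big_geq// subr0 add0r mulN1r.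
have := isonormal_linear HW (-1) ih (wiener_isonormal (HX u (ltn0Sn l))).
rewrite (_ : (fun p => _) = Z_kernel l.+2 u); last first.
  by apply/funext => p; rewrite Z_kernelS mulN1r.
rewrite (_ : (fun w => _) = Zproc I1 X l.+2 u)//.
by apply/funext => w; rewrite mulN1r /Zproc [in RHS]big_nat_recr//= opprD addrA.
Qed.

Lemma Z_comb_isonormal l (s : seq (R * R)) :
  isonormal (fun p => \sum_(q <- s) q.1 * Z_kernel l.+1 q.2 p)
            (fun w => \sum_(q <- s) q.1 * Zproc I1 X l.+1 q.2 w).
Proof.
elim: s => [|q s ih].
  rewrite (_ : (fun p => _) = cst 0); last by apply/funext => p; rewrite big_nil.
  rewrite (_ : (fun w => _) = cst 0); last by apply/funext => p; rewrite big_nil.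
  exact: isonormal0.
have := isonormal_linear HW q.1 ih (Z_isonormal l q.2).
rewrite (_ : (fun p => _) = fun p => \sum_(q <- q :: s) q.1 * Z_kernel l.+1 q.2 p); last first.
  by apply/funext => p; rewrite big_cons addrC.
rewrite (_ : (fun w => _) = fun w => \sum_(q <- q :: s) q.1 * Zproc I1 X l.+1 q.2 w)//.
by apply/funext => p; rewrite big_cons addrC.
Qed.

Lemma Z_cross_cov l n u v :
  (\int[Prob]_w (Zproc I1 X l.+1 u w * Zproc I1 X (l.+1 + n) v w)%:E = (cross_cov l.+1 n u v)%:E)%E.
Proof.
have iu := Z_isonormal l u; have iv := Z_isonormal (l + n) v.
rewrite -addSn in iv; rewrite (isonormal_mul HW iu iv).
by case: iu => m1 i1 _ _; case: iv => m2 i2 _ _; exact (Z_kernel_cov HP m1 m2 i1 i2).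
Qed.

Lemma Z_cov l u v :
  (\int[Prob]_w (Zproc I1 X l.+1 u w * Zproc I1 X l.+1 v w)%:E = (cov_l l.+1 u v)%:E)%E.
Proof. by have := Z_cross_cov l 0 u v; rewrite addn0 /cross_cov big_geq// addr0. Qed.

Lemma Z_gaussian l : gaussian_process Prob (Zproc I1 X l.+1).
Proof.
move=> s; have := isonormal_gaussian HW (Z_comb_isonormal l s).
set s2 := fine _ => g; exists 0, s2; split; last exact: g.
by apply/fine_ge0/integral_ge0 => p _; rewrite lee_fin sqr_ge0.
Qed.

Lemma Z_increment l u v : exists s2 : R, [/\ 0 <= s2, s2 <= 2 * `|u - v| &
  gaussian_rv Prob (fun w => Zproc I1 X l.+1 u w - Zproc I1 X l.+1 v w) 0 s2].
Proof.
have iu := Z_isonormal l u; have iv := Z_isonormal l v.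
have iuv := isonormal_linear HW (-1) iu iv.
have := isonormal_gaussian HW iuv.
rewrite (_ : (fun w => _) = fun w => Zproc I1 X l.+1 u w - Zproc I1 X l.+1 v w); last first.
  by apply/funext => w; rewrite mulN1r.
set s2 := fine _ => g; exists s2; split => //.
  by apply/fine_ge0/integral_ge0 => p _; rewrite lee_fin sqr_ge0.
have -> : s2 = 2 * (cov_l l.+1 u u - cov_l l.+1 u v); last first.
  by rewrite ler_wpM2l// cov_l_modulus.
rewrite /s2 -(isonormal_sq HW iuv).
have cov_int a b : Prob.-integrable setT (fun w => (Zproc I1 X l.+1 a w * Zproc I1 X l.+1 b w)%:E).
  have L2 c : measurable_fun setT (Zproc I1 X l.+1 c) /\ (\int[Prob]_w (Zproc I1 X l.+1 c w ^+ 2)%:E < +oo)%E.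
    have ic := Z_isonormal l c; split; first by case: ic.
    by rewrite (isonormal_sq HW ic); case: ic.
  by apply: L2_mul_integrable; [case: (L2 a)|case: (L2 b)|case: (L2 a)|case: (L2 b)].
transitivity (fine (\int[Prob]_w ((Zproc I1 X l.+1 u w * Zproc I1 X l.+1 u w)%:E +
   ((-2)%:E * (Zproc I1 X l.+1 u w * Zproc I1 X l.+1 v w)%:E +
    (Zproc I1 X l.+1 v w * Zproc I1 X l.+1 v w)%:E)))%E).
  congr fine; apply: eq_integral => w _; rewrite -EFinM -!EFinD; congr EFin; ring.
rewrite integralD//; last by apply: integrableD => //; exact: integrableZl.
rewrite integralD//; last exact: integrableZl.
rewrite integralZl// !Z_cov -EFinM -!EFinD /= !cov_l0; ring.
Qed.

End process.

(** * Hoelder continuous version *)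

Section dyadic_chaining.
Variable R : realType.
Implicit Types (u s t T : R) (g : R -> R).

Definition dyadic (n : nat) (k : int) : R := k%:~R / 2 ^+ n.
Definition dyadic_floor (n : nat) u : R := dyadic n (Num.floor (u * 2 ^+ n)).

Lemma dyadic_floorP n u : 0 <= u - dyadic_floor n u < 2 ^- n.
Proof.
have p0 : 0 < 2 ^+ n :> R by rewrite exprn_gt0.
have /andP[h1 h2] := floor_itv (u * 2 ^+ n).
rewrite /dyadic_floor /dyadic; apply/andP; split.
  by rewrite subr_ge0 ler_pdivrMr.
rewrite ltrBlDr -[X in X + _]mul1r -mulrDl ltr_pdivlMr// addrC.
by move: h2; rewrite intrD.
Qed.

Lemma dyadicS n k : dyadic n.+1 (2 * k) = dyadic n k.
Proof. by rewrite /dyadic intrM exprS invfM mulrACA divff ?mul1r// pnatr_eq0. Qed.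

Lemma floor_double (x : R) :
  Num.floor (x * 2) = 2 * Num.floor x \/ Num.floor (x * 2) = 2 * Num.floor x + 1.
Proof.
have /andP[h1 h2] := floor_itv x; rewrite intrD in h2.
have [h|h] := ltP (x * 2) ((2 * Num.floor x + 1)%:~R).
  by left; apply: floor_def; rewrite h andbT intrM mulrC ler_wpM2r.
right; apply: floor_def; rewrite h /= !intrD intrM; move: h2 => /=; lra.
Qed.

Lemma floor_near (x y : R) : x <= y -> y <= x + 1 ->
  Num.floor y = Num.floor x \/ Num.floor y = Num.floor x + 1.
Proof.
move=> xy yx; have /andP[h1 h2] := floor_itv x; rewrite intrD in h2.
have [h|h] := ltP y ((Num.floor x + 1)%:~R).
  by left; apply: floor_def; rewrite h andbT (le_trans h1).
by right; apply: floor_def; rewrite h /= !intrD; move: h2 => /=; lra.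
Qed.

(* The factor [n.+1] makes the Gaussian tails summable against the number of dyadic
   intervals; 160 is any constant for which the tail bound telescopes from [n = 3] on. *)
Definition oscillation (n : nat) : R := 8 * n.+1%:R * Num.sqrt 2^-1 ^+ n.
Definition oscillation_tail (n : nat) : R := 160 * n.+1%:R * Num.sqrt 2^-1 ^+ n.

Let r : R := Num.sqrt 2^-1.
Let r0 : 0 < r. Proof. by rewrite sqrtr_gt0 invr_gt0. Qed.
Let r2 : r ^+ 2 = 2^-1. Proof. by rewrite sqr_sqrtr// invr_ge0. Qed.
Let r34 : r <= 3 / 4. Proof. by move: r2 r0; nra. Qed.

Lemma oscillation_gt0 n : 0 < oscillation n.
Proof. by rewrite /oscillation !mulr_gt0// exprn_gt0. Qed.

Lemma oscillation_le n : oscillation n <= oscillation_tail n.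
Proof.
rewrite /oscillation /oscillation_tail -!mulrA ler_wpM2r ?mulr_ge0 ?exprn_ge0 ?ltW//.
by lra.
Qed.

Lemma oscillation_tail_ge0 n : 0 <= oscillation_tail n.
Proof. exact: le_trans (ltW (oscillation_gt0 n)) (oscillation_le n). Qed.

(** With the ratio bounded by [3 / 4], the claim reads [126 * (n + 2) <= 160 * (n + 1)], which holds
    from [n = 3] on. *)
Lemma oscillation_step n : (3 <= n)%N ->
  oscillation n.+1 + oscillation_tail n.+1 <= oscillation_tail n.
Proof.
move=> n3; rewrite /oscillation /oscillation_tail -/r exprS.
have rn : 0 < r ^+ n by rewrite exprn_gt0.
have n3' : 3 <= n%:R :> R by rewrite (ler_nat R 3).
rewrite !mulrA -mulrDl; apply: ler_wpM2r; rewrite ?(ltW rn)// -mulrDl.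
rewrite -[n.+2]addn2 -[n.+1]addn1 !natrD.
have n5 : 0 <= 8 * (n%:R + 2) + 160 * (n%:R + 2) :> R by lra.
by apply: (le_trans (ler_wpM2l n5 r34)); lra.
Qed.

(** The range of [k] covers [[-n, n]], which grows with [n], so a single [n0] serves every bounded
    interval. *)
Definition slow (g : R -> R) (n0 : nat) := forall n (k : int), (n0 <= n)%N ->
  `|k%:~R| <= n%:R * 2 ^+ n :> R -> `|g (dyadic n (k + 1)) - g (dyadic n k)| < oscillation n.

Lemma floor_bound n u T : `|u| <= T -> T + 1 <= n%:R ->
  `|(Num.floor (u * 2 ^+ n))%:~R| <= n%:R * 2 ^+ n :> R.
Proof.
rewrite ler_norml => /andP[u1 u2] Tn.
have p1 : 1 <= 2 ^+ n :> R by rewrite exprn_ege1// ler1n.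
have /andP[h1 h2] := floor_itv (u * 2 ^+ n); rewrite intrD in h2.
rewrite ler_norml; apply/andP; split; last by apply: (le_trans h1); nra.
(* The unit of slack in [T + 1 <= n] absorbs the loss of less than 1 in the floor. *)
by move: h2; rewrite /=; nra.
Qed.

Lemma slow_near g n0 n s t T : slow g n0 -> (n0 <= n)%N -> T + 1 <= n%:R ->
  `|s| <= T -> `|t| <= T -> `|s - t| <= 2 ^- n ->
  `|g (dyadic_floor n s) - g (dyadic_floor n t)| <= oscillation n.
Proof.
move=> sg n0n Tn; wlog st : s t / s <= t.
  move=> H sT tT st; have [h|/ltW h] := leP s t; first exact: H.
  by rewrite distrC; apply: H => //; rewrite distrC.
move=> sT tT; rewrite distrC ger0_norm ?subr_ge0// lerBlDl => d.
have p0 : 0 < 2 ^+ n :> R by rewrite exprn_gt0.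
rewrite /dyadic_floor distrC.
have h1 : s * 2 ^+ n <= t * 2 ^+ n by rewrite ler_pM2r.
have h2 : t * 2 ^+ n <= s * 2 ^+ n + 1.
  by rewrite -ler_pdivlMr// mulrDl mulfK ?gt_eqF// mul1r.
have [->|->] := floor_near h1 h2.
- by rewrite subrr normr0 ltW// oscillation_gt0.
- by apply/ltW/sg => //; exact: floor_bound sT Tn.
Qed.

(** Passing to the finer grid, the floor of [u] stays at the same point or moves one fine step to
    the right. *)
Lemma slow_step g n0 n u T : slow g n0 -> (n0 <= n)%N -> T + 1 <= n%:R -> `|u| <= T ->
  `|g (dyadic_floor n.+1 u) - g (dyadic_floor n u)| <= oscillation n.+1.
Proof.
move=> sg n0n Tn uT; rewrite /dyadic_floor -(dyadicS n) exprSr mulrA.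
have [->|->] := floor_double (u * 2 ^+ n).
  by rewrite subrr normr0 ltW// oscillation_gt0.
apply/ltW/sg; first exact: leqW.
rewrite intrM normrM exprS mulrCA (@ger0_norm _ 2%:~R)// ler_pM2l//.
apply: (le_trans (floor_bound uT Tn)); rewrite ler_pM2r ?exprn_gt0//.
by rewrite ler_nat.
Qed.

Lemma slow_chain g n0 n m u T : slow g n0 -> (n0 <= n)%N -> (3 <= n)%N -> T + 1 <= n%:R ->
  `|u| <= T ->
  `|g (dyadic_floor (n + m) u) - g (dyadic_floor n u)| <= oscillation_tail n - oscillation_tail (n + m).
Proof.
move=> sg n0n n3 Tn uT; elim: m => [|m ih]; first by rewrite addn0 !subrr normr0.
rewrite addnS.
have hh : `|g (dyadic_floor (n + m).+1 u) - g (dyadic_floor (n + m) u)| <= oscillation (n + m).+1.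
  apply: (slow_step sg _ _ uT); first exact: leq_trans n0n (leq_addr _ _).
  by apply: (le_trans Tn); rewrite ler_nat leq_addr.
have h2 := oscillation_step (leq_trans n3 (leq_addr m n)).
rewrite (_ : g _ - g _ = (g (dyadic_floor (n + m).+1 u) - g (dyadic_floor (n + m) u)) +
   (g (dyadic_floor (n + m) u) - g (dyadic_floor n u))); last by ring.
apply: (le_trans (ler_normD _ _)); apply: (le_trans (lerD hh ih)); lra.
Qed.

Lemma linear_geometric (p b : R) : 0 < p -> p < b ->
  exists2 C : R, 0 <= C & forall n, n.+1%:R * p ^+ n <= C * b ^+ n.
Proof.
move=> p0 pb; have bp : 0 < b - p by rewrite subr_gt0.
have b0 : 0 < b := lt_trans p0 pb.
have C0 : 0 <= p / (b - p) by rewrite divr_ge0// ltW.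
(* With this [C], [C * b = p * C + (b - p) + p]; the last term pays for the increment of the linear
   factor. *)
exists (1 + p / (b - p)); first by rewrite addr_ge0.
elim=> [|n ih]; first by rewrite !expr0 !mulr1 lerDl.
have pn : p ^+ n <= b ^+ n by rewrite lerXn2r// ?nnegrE ltW.
have bn : 0 < b ^+ n by rewrite exprn_gt0.
rewrite -natr1 mulrDl mul1r !exprS.
have h1 : p * (n.+1%:R * p ^+ n) <= p * ((1 + p / (b - p)) * b ^+ n) by rewrite ler_pM2l.
have h2 : p * p ^+ n <= p * b ^+ n by rewrite ler_pM2l.
have h3 : (1 + p / (b - p)) * (b * b ^+ n) = p * ((1 + p / (b - p)) * b ^+ n) + (b - p) * b ^+ n + p * b ^+ n.
  by field; rewrite gt_eqF.
have h4 : 0 <= (b - p) * b ^+ n by rewrite mulr_ge0// ltW.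
by rewrite h3 mulrCA; move: h1 h2 h4; lra.
Qed.

Lemma oscillation_tail_cvg : oscillation_tail @ \oo --> (0 : R).
Proof.
have [|C C0 HC] := @linear_geometric r (4 / 5) r0; first by apply: (le_lt_trans r34); lra.
apply: (@squeeze_cvgr _ _ _ _ (cst 0) (geometric (160 * C) (4 / 5))).
- near=> n; rewrite /oscillation_tail !mulr_ge0 ?exprn_ge0 ?(ltW r0)//=.
  by rewrite -!mulrA ler_pM2l.
- exact: cvg_cst.
- by apply: cvg_geometric; rewrite ger0_norm; lra.
Unshelve. all: by end_near. Qed.

Definition dyadic_limit (g : R -> R) u : R := limn (fun n => g (dyadic_floor n u)).

Lemma slow_cvg g n0 u : slow g n0 -> cvgn (fun n => g (dyadic_floor n u)).
Proof.
move=> sg.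
pose N := maxn n0 (maxn 3 (Num.truncn (`|u| + 1)).+1).
have n0N : (n0 <= N)%N by rewrite leq_maxl.
have N3 : (3 <= N)%N by rewrite !leq_max leqnn orbT.
have NT : `|u| + 1 <= N%:R.
  have /andP[_ /ltW h] := truncn_itv (addr_ge0 (normr_ge0 u) ler01).
  by apply: (le_trans h); rewrite ler_nat /N !leq_max leqnn !orbT.
(* Adding the tail makes the sequence nonincreasing, by [oscillation_step]. It is bounded below by
   [slow_chain], and the tail tends to 0, so the original sequence converges. *)
pose x m := g (dyadic_floor (m + N) u) + oscillation_tail (m + N).
have cx : cvgn x.
  apply: nonincreasing_is_cvgn.
    apply/nonincreasing_seqP => m; rewrite /x addSn.
    have := @slow_step g n0 (m + N) u _ sg (leq_trans n0N (leq_addl _ _)) _ (lexx _).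
    have le : `|u| + 1 <= (m + N)%:R by apply: (le_trans NT); rewrite ler_nat leq_addl.
    move=> /(_ le); rewrite ler_norml => /andP[_ h].
    have := oscillation_step (leq_trans N3 (leq_addl m N)); move: h; lra.
  exists (g (dyadic_floor N u) - oscillation_tail N) => _ [m _ <-].
  have := slow_chain m sg n0N N3 NT (lexx _).
  rewrite addnC ler_norml => /andP[h _]; have := oscillation_tail_ge0 (m + N).
  by rewrite /x; move: h; lra.
have ct : oscillation_tail (m + N) @[m --> \oo] --> (0 : R).
  by rewrite cvg_shiftn; exact: oscillation_tail_cvg.
apply/cvg_ex; exists (limn x - 0); rewrite -(cvg_shiftn N).
rewrite (_ : (fun n => _) = x \- (fun m => oscillation_tail (m + N))); first exact: cvgB.
by apply/funext => m; rewrite /x /= addrK.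
Qed.

Lemma slow_limit g n0 n u T : slow g n0 -> (n0 <= n)%N -> (3 <= n)%N -> T + 1 <= n%:R ->
  `|u| <= T -> `|dyadic_limit g u - g (dyadic_floor n u)| <= oscillation_tail n.
Proof.
move=> sg n0n n3 Tn uT; have cg := @slow_cvg g n0 u sg.
have near m : (n <= m)%N -> `|g (dyadic_floor m u) - g (dyadic_floor n u)| <= oscillation_tail n.
  move=> nm; rewrite -(subnKC nm); apply: (le_trans (slow_chain _ sg n0n n3 Tn uT)).
  by rewrite gerBl oscillation_tail_ge0.
rewrite ler_distl; apply/andP; split.
  apply: limr_ge => //; exists n => // m /= nm.
  by have := near m nm; rewrite ler_distl => /andP[].
apply: limr_le => //; exists n => // m /= nm.
by have := near m nm; rewrite ler_distl => /andP[].
Qed.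

Lemma slow_limit_near g n0 n s t T : slow g n0 -> (n0 <= n)%N -> (3 <= n)%N -> T + 1 <= n%:R ->
  `|s| <= T -> `|t| <= T -> `|s - t| <= 2 ^- n ->
  `|dyadic_limit g s - dyadic_limit g t| <= 3 * oscillation_tail n.
Proof.
move=> sg n0n n3 Tn sT tT st.
have h1 := slow_limit sg n0n n3 Tn sT; have h2 := slow_limit sg n0n n3 Tn tT.
have h3 := le_trans (slow_near sg n0n Tn sT tT st) (oscillation_le n).
move: h1 h2 h3; rewrite !ler_distl => /andP[a1 a2] /andP[b1 b2] /andP[c1 c2].
by apply/andP; split; lra.
Qed.

Lemma dyadic_scale (x : R) n : 0 < x -> x <= 2 ^- n ->
  exists m, [/\ (n <= m)%N, x <= 2 ^- m & 2 ^- m.+1 < x].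
Proof.
move=> x0 xn.
have ex : exists m, 2 ^- m < x.
  have [m _ h] := near_infty_natSinv_expn_lt (PosNum x0).
  by exists m; have := h m (leqnn m); rewrite div1r.
case: (ex_minnP ex) => -[|m] hm min.
  by move: (lt_le_trans hm xn); rewrite expr0 invr1 ltNge invf_le1 ?exprn_ege1 ?exprn_gt0// ler1n.
exists m; split => //.
  rewrite leqNgt; apply/negP => mn; move: (lt_le_trans hm xn).
  by rewrite ltNge lef_pV2 ?posrE ?exprn_gt0// ler_eXn2l// ?mn// (ltr1n R 2).
by rewrite leNgt; apply/negP => /min; rewrite ltnn.
Qed.

(** Close points are treated at the dyadic scale of their distance. Points further apart are joined
    by a fixed number of equal steps, which multiplies the constant. *)
Lemma slow_hoelder g n0 a : slow g n0 -> 0 < a < 2^-1 -> locally_hoelder (dyadic_limit g) a.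
Proof.
move=> sg /andP[a0 a12] T T0.
pose N := maxn n0 (maxn 3 (Num.truncn (T + 1)).+1).
have n0N : (n0 <= N)%N by rewrite leq_maxl.
have N3 : (3 <= N)%N by rewrite !leq_max leqnn orbT.
have NT : T + 1 <= N%:R.
  have /andP[_ /ltW h] := truncn_itv (addr_ge0 (ltW T0) ler01).
  by apply: (le_trans h); rewrite ler_nat /N !leq_max leqnn !orbT.
pose b : R := 2^-1 `^ a.
have b0 : 0 < b by rewrite powR_gt0// invr_gt0.
(* This is where [a < 2^-1] enters: the strict gap between [r] and [b] absorbs the linear factor of
   [oscillation_tail]. *)
have rb : r < b.
  rewrite /r -powR12_sqrt ?invr_ge0// /b /powR invr_eq0 pnatr_eq0 /=.
  by rewrite ltr_expR ltr_nM2r// ln_lt0// invr_gt0 ltr0n invf_lt1// ltr1n.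
have [C C0 HC] : exists2 C : R, 0 <= C & forall m, 3 * oscillation_tail m <= C * b ^+ m.+1.
  have [C C0 HC] := linear_geometric r0 rb.
  have [c c0 ce] : exists2 c : R, 0 <= c & forall m, 3 * oscillation_tail m = c * (m.+1%:R * r ^+ m).
    by exists 480; [exact: ler0n|move=> m; rewrite /oscillation_tail -/r; ring].
  exists (c * (C / b)) => [|m]; first by rewrite mulr_ge0// divr_ge0// ltW.
  rewrite ce exprS -[X in _ <= X]mulrA ler_wpM2l//.
  by rewrite (_ : C / b * (b * b ^+ m) = C * b ^+ m)//; field; rewrite gt_eqF.
have bE m : b ^+ m = (2 ^- m) `^ a.
  have h0 : 0 <= 2^-1 :> R by rewrite invr_ge0.
  by rewrite -exprVn -(powR_mulrn m (ltW b0)) -(powR_mulrn m h0) powRAC.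
have loc s t : `|s| <= T -> `|t| <= T -> `|s - t| <= 2 ^- N ->
    `|dyadic_limit g s - dyadic_limit g t| <= C * `|s - t| `^ a.
  move=> sT tT; have [->|st] := eqVneq s t.
    by rewrite !subrr normr0 mulr_ge0 ?powR_ge0.
  have st0 : 0 < `|s - t| by rewrite normr_gt0 subr_eq0.
  move=> /(dyadic_scale st0)[m [Nm h1 h2]].
  apply: (le_trans (slow_limit_near sg (leq_trans n0N Nm) (leq_trans N3 Nm) _ sT tT h1)).
    by apply: (le_trans NT); rewrite ler_nat.
  have h3 : b ^+ m.+1 <= `|s - t| `^ a.
    by rewrite bE ge0_ler_powR ?nnegrE ?invr_ge0 ?exprn_ge0// ?ltW.
  by apply: (le_trans (HC m)); rewrite ler_wpM2l.
(* Enough equal pieces to bring any two points of [[-T, T]] within the local scale [2 ^- N]. *)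
pose K := (Num.truncn (2 * T * 2 ^+ N)).+1.
have K0 : 0 < K%:R :> R by rewrite ltr0n.
have KT : 2 * T / K%:R <= 2 ^- N.
  have TN0 : 0 <= 2 * T * 2 ^+ N by rewrite !mulr_ge0 ?exprn_ge0 ?ltW.
  have /andP[_ /ltW h] := truncn_itv TN0.
  by rewrite ler_pdivrMr// [X in _ <= X]mulrC ler_pdivlMr ?exprn_gt0.
exists (K%:R * C) => s t sT tT.
pose q (j : nat) := s + (t - s) * (j%:R / K%:R).
have qT j : (j <= K)%N -> `|q j| <= T.
  move=> jK; move: sT tT; rewrite !ler_norml => /andP[s1 s2] /andP[t1 t2].
  have c1 : 0 <= j%:R / K%:R :> R by rewrite divr_ge0.
  have c2 : j%:R / K%:R <= 1 :> R by rewrite ler_pdivrMr// mul1r ler_nat.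
  by rewrite /q; apply/andP; split; nra.
have qd j : `|q j - q j.+1| = `|s - t| / K%:R.
  rewrite /q (_ : _ - _ = (s - t) / K%:R); last by rewrite -natr1; field; rewrite gt_eqF.
  by rewrite normrM normfV (@ger0_norm _ K%:R).
have q0 : q 0%N = s by rewrite /q mul0r mulr0 addr0.
have qK : q K = t by rewrite /q divff ?gt_eqF// mulr1 addrC subrK.
have ind j : (j <= K)%N -> `|dyadic_limit g s - dyadic_limit g (q j)| <=
    j%:R * (C * `|s - t| `^ a).
  elim: j => [|j ih] jK; first by rewrite q0 subrr normr0 mul0r.
  apply: (le_trans (ler_distD (dyadic_limit g (q j)) _ _)).
  rewrite -natr1 mulrDl mul1r; apply: lerD; first exact/ih/ltnW.
  apply: (le_trans (loc _ _ (qT _ (ltnW jK)) (qT _ jK) _)).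
    rewrite qd; apply: le_trans KT; rewrite ler_pM2r ?invr_gt0//.
    apply: (le_trans (ler_normB _ _)); lra.
  rewrite qd ler_wpM2l//.
  rewrite ge0_ler_powR ?nnegrE ?divr_ge0 ?(ltW a0)//.
  by rewrite ler_pdivrMr// ler_peMr// ler1n.
by have := ind K (leqnn _); rewrite qK mulrA.
Qed.
End dyadic_chaining.

Section continuous_version.
Variables (R : realType) (d : measure_display) (Om : measurableType d).
Variables (Prob : probability Om R) (Z : R -> Om -> R).
Hypothesis mZ : forall u, measurable_fun setT (Z u).
Hypothesis Zinc : forall u v : R, exists s2 : R, [/\ 0 <= s2, s2 <= 2 * `|u - v| &
  gaussian_rv Prob (fun w => Z u w - Z v w) 0 s2].

Lemma measurable_increment u v (c : R) : measurable [set w | (c <= `|Z u w - Z v w|)%R].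
Proof.
have mD : measurable_fun setT (fun w => `|Z u w - Z v w|).
  by apply: measurableT_comp => //; exact: measurable_funB.
rewrite (_ : [set w | _] = (fun w => `|Z u w - Z v w|) @^-1` `[c, +oo[%classic).
  by rewrite -[X in measurable X]setTI; exact: mD.
by apply/seteqP; split => w /=; rewrite in_itv/= andbT.
Qed.

Lemma increment_tail n (u v : R) : `|u - v| <= 2 ^- n ->
  (Prob [set w | (oscillation R n <= `|Z u w - Z v w|)%R] <= (2 * 2^-1 ^+ (4 * n.+1))%:E)%E.
Proof.
move=> uv; have [s2 [s0 s2le g]] := Zinc u v.
have t0 : 0 < 2 * 2 ^- n :> R by rewrite mulr_gt0// invr_gt0 exprn_gt0.
have st : s2 <= 2 * 2 ^- n by apply: (le_trans s2le); rewrite ler_pM2l.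
apply: (le_trans (gaussian_rv_tail s0 st t0 (oscillation_gt0 R n) g)).
rewrite lee_fin; apply: ler_pM; rewrite ?sqrtr_ge0 ?expR_ge0//.
  by have := sqr_sqrtr (ler0n R 2); have := sqrtr_ge0 (2 : R); nra.
have e1 : expR (-1) <= 2^-1 :> R.
  rewrite expRN lef_pV2 ?posrE ?expR_gt0//; exact: expR_ge1Dx.
have e4 : expR (- 1) ^+ (4 * n.+1) <= 2^-1 ^+ (4 * n.+1) :> R.
  by rewrite lerXn2r// nnegrE ?expR_ge0// invr_ge0.
apply: le_trans e4; rewrite -expRM_natr ler_expR mulN1r lerN2.
have p0 : 2 ^+ n != 0 :> R by rewrite expf_neq0// pnatr_eq0.
(* The factor 8 in [oscillation] yields this exponent, which is at least [4 * n.+1]; with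
   [expR (-1) <= 2^-1] the tail is at most a power of one half. *)
have -> : oscillation R n ^+ 2 / (4 * (2 * 2 ^- n)) = 8 * n.+1%:R ^+ 2.
  rewrite /oscillation exprMn -exprM mulnC exprM sqr_sqrtr ?invr_ge0// exprVn.
  by field; rewrite p0.
have n1 : 1 <= n.+1%:R :> R by rewrite ler1n.
by rewrite natrM; nra.
Qed.

Definition large_increment (n : nat) (k : int) : set Om :=
  [set w | (oscillation R n <= `|Z (dyadic R n (k + 1)) w - Z (dyadic R n k) w|)%R].

Definition bad_increments (n : nat) : set Om :=
  \big[setU/set0]_(i < (2 * (n * 2 ^ n)).+1)
    large_increment n (i%:Z - (n * 2 ^ n)%:Z).

Lemma measurable_bad_increments n : measurable (bad_increments n).
Proof. by apply: bigsetU_measurable => i _; exact: measurable_increment. Qed.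

Lemma bad_increments_prob n : (Prob (bad_increments n) <= (1 / (2 ^ n.+1)%:R)%:E)%E.
Proof.
pose F (i : nat) := large_increment n (i%:Z - (n * 2 ^ n)%:Z).
have mF i : measurable (F i) by exact: measurable_increment.
apply: (le_trans (@Boole_inequality _ _ _ Prob F _ (fun i _ => mF i))).
apply: (@le_trans _ _ (\sum_(i < (2 * (n * 2 ^ n)).+1) (2 * 2^-1 ^+ (4 * n.+1))%:E)%E).
  apply: lee_sum => i _; apply: increment_tail.
  rewrite /dyadic intrD -mulrBl addrAC subrr add0r mul1r ger0_norm// invr_ge0 exprn_ge0//.
rewrite sumEFin lee_fin sumr_const card_ord -[X in X <= _]mulr_natl div1r.
(* The number of intervals costs at most [3 * n.+1] of the [4 * n.+1] powers of one half; the
   remaining [n.+1] make the bound summable. *)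
have nn : (2 * (n * 2 ^ n)).+1%:R * 2 <= 2 ^+ (3 * n.+1) :> R.
  rewrite -natrM -natrX ler_nat.
  have h : (n.+1 <= 2 ^ n)%N by exact: ltn_expl.
  apply: (@leq_trans ((2 * (2 ^ n * 2 ^ n)) * 2)).
    rewrite leq_mul2r /=; apply: (@leq_trans (2 * (n.+1 * 2 ^ n))).
      by rewrite ltn_pmul2l// ltn_pmul2r// expn_gt0.
    by rewrite leq_mul2l/= leq_mul2r h orbT.
  by rewrite -expnD -expnS -expnSr leq_exp2l// addnn -mul2n !mulnS; lia.
rewrite mulrA; apply: (@le_trans _ _ (2 ^+ (3 * n.+1) * 2^-1 ^+ (4 * n.+1))).
  by rewrite ler_wpM2r// exprn_ge0// invr_ge0.
rewrite (_ : 4 * n.+1 = 3 * n.+1 + n.+1)%N; last by lia.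
by rewrite exprD mulrA -exprMn divff ?pnatr_eq0// expr1n mul1r exprVn natrX.
Qed.

Lemma bad_increments_limsup : Prob (lim_sup_set bad_increments) = 0%E.
Proof.
apply: lim_sup_set_cvg0; first exact: measurable_bad_increments.
apply: (@le_lt_trans _ _ (\sum_(0 <= i <oo) (1 / (2 ^ i.+1)%:R)%:E)%E).
  by apply: lee_nneseries => // n _; exact: bad_increments_prob.
exact: le_lt_trans (epsilon_trick0 xpredT ler01) (ltry _).
Qed.

Lemma good_slow w : ~ lim_sup_set bad_increments w -> exists n0, slow (Z^~ w) n0.
Proof.
move=> /existsNP[n0 /not_implyP[_ h]].
exists n0 => n k n0n kn; rewrite ltNge; apply/negP => b; apply: h.
exists n => //.
rewrite /bad_increments -(bigcup_mkord _ (fun i : nat => large_increment n (i%:Z - (n * 2 ^ n)%:Z))).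
have kz : `|k| <= (n * 2 ^ n)%:Z.
  by move: kn; rewrite -intr_norm -natrX -natrM -(ler_int R) /= => /le_trans; apply.
move: kz; rewrite ler_norml => /andP[k1 k2].
have ik : (absz (k + (n * 2 ^ n)%:Z))%:Z = k + (n * 2 ^ n)%:Z by rewrite gez0_abs// -lerBlDr sub0r.
exists (absz (k + (n * 2 ^ n)%:Z)) => /=.
  by rewrite ltnS -lez_nat ik; move: k2; lia.
by rewrite ik addrK.
Qed.

Lemma limsup_measurable (F : nat -> set Om) : (forall n, measurable (F n)) -> measurable (lim_sup_set F).
Proof. by move=> mF; apply: bigcap_measurable => // n _; apply: bigcup_measurable => k _. Qed.

(** A separate Borel-Cantelli argument at the fixed point [u], for the increment between [u] and its
    dyadic floor. It identifies the chaining limit with [Z u], off a null set that may depend on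
    [u]. *)
Lemma dyadic_limit_ae u : exists N : set Om, [/\ measurable N, Prob N = 0%E &
  forall w, ~ N w -> Z (dyadic_floor n u) w @[n --> \oo] --> Z u w].
Proof.
pose F n := [set w | (oscillation R n <= `|Z (dyadic_floor n u) w - Z u w|)%R].
have mF n : measurable (F n) by exact: measurable_increment.
exists (lim_sup_set F); split; first exact: limsup_measurable.
  apply: lim_sup_set_cvg0 => //.
  apply: (@le_lt_trans _ _ (\sum_(0 <= i <oo) (1 / (2 ^ i.+1)%:R)%:E)%E); last first.
    exact: le_lt_trans (epsilon_trick0 xpredT ler01) (ltry _).
  apply: lee_nneseries => // n _.
  apply: (le_trans (@increment_tail n _ _ _)).
    by have /andP[h1 /ltW h2] := dyadic_floorP n u; rewrite distrC ger0_norm.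
  rewrite lee_fin div1r natrX -exprVn (_ : 4 * n.+1 = n.+1 + (3 * n).+2.+1)%N; last by lia.
  rewrite exprD [X in _ * (_ * X)]exprS mulrCA mulVKf ?pnatr_eq0//.
  by rewrite ler_piMr ?exprn_ge0 ?invr_ge0// exprn_ile1 ?invr_ge0// invf_le1// ler1n.
move=> w /existsNP[n0 /not_implyP[_ h]].
apply/cvgrPdist_le => e e0.
have [N _ HN] : \forall n \near \oo, oscillation_tail R n < e.
  by apply: (cvgr_lt _ (@oscillation_tail_cvg R)).
exists (maxn n0 N) => // n /=; rewrite geq_max => /andP[n0n Nn].
rewrite distrC; apply: (le_trans _ (ltW (HN n Nn))); apply: le_trans (oscillation_le R n).
by rewrite leNgt; apply/negP => b; apply: h; exists n => //; exact: ltW.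
Qed.

Lemma hoelder_version : exists Y : R -> Om -> R,
  (forall u : R, measurable_fun setT (Y u) /\ Prob [set w | Y u w != Z u w] = 0%E) /\
  (forall (w : Om) (a : R), 0 < a < 2^-1 -> locally_hoelder (fun u => Y u w) a).
Proof.
pose E := lim_sup_set bad_increments.
have mE : measurable E by apply: limsup_measurable; exact: measurable_bad_increments.
(* The exceptional set [E] depends neither on [u] nor on the exponent. Setting whole paths to 0
   there makes every path Hoelder, for all exponents at once. *)
pose Y u w := \1_(~` E) w * dyadic_limit (Z^~ w) u.
have YE u w : E w -> Y u w = 0.
  by move=> Ew; rewrite /Y indicE memNset ?mul0r// => /(_ Ew).
have YN u w : ~ E w -> Y u w = dyadic_limit (Z^~ w) u.
  by move=> Ew; rewrite /Y indicE mem_set ?mul1r.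
have mY u : measurable_fun setT (Y u).
  apply: (@measurable_fun_cvg _ _ _ _ (fun n w => \1_(~` E) w * Z (dyadic_floor n u) w)).
    by move=> n; apply: measurable_funM => //; apply: measurable_indic; exact: measurableC.
  move=> w _; have [Ew|Ew] := pselect (E w).
    rewrite YE// (_ : (fun n => _) = cst 0); first exact: cvg_cst.
    by apply/funext => n; rewrite indicE memNset ?mul0r// => /(_ Ew).
  apply: cvgM; first exact: cvg_cst.
  by have [n0 sl] := good_slow Ew; exact: (slow_cvg (u := u) sl).
exists Y; split=> [u|w a a0]; last first.
  have [Ew|Ew] := pselect (E w); last first.
    have [n0 sl] := good_slow Ew.
    by under eq_fun do rewrite YN//; exact: slow_hoelder sl a0.
  by move=> T T0; exists 0 => s t _ _; rewrite !YE// subrr normr0 mul0r.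
split => //.
have [N [mN N0 HN]] := dyadic_limit_ae u.
have EN : Prob.-negligible (E `|` N).
  by apply: negligibleU; apply/negligibleP => //; exact: bad_increments_limsup.
apply: measure_negligible.
- rewrite (_ : [set w | _] = ~` [set w | Y u w = Z u w]).
    apply: measurableC; rewrite (_ : [set w | _] = (Y u \- Z u) @^-1` [set 0]).
      by rewrite -[X in measurable X]setTI; exact: measurable_funB.
    by apply/seteqP; split => w /= => [->|/eqP]; rewrite ?subrr// subr_eq0 => /eqP.
  by apply/seteqP; split => w /= /eqP.
- apply: negligibleS EN => w /= ne; have [Ew|Ew] := pselect (E w); first by left.
  right; apply: contrapT => Nw; move/eqP: ne; apply.
  by rewrite YN//; apply: cvg_lim => //; exact: HN.
Qed.
End continuous_version.

Theorem theorem1p8 (R : realType) (d : measure_display) (Om : measurableType d)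
  (Prob : probability Om R) (P : probability (seqR R) R)
  (HP : iid_uniform P)
  (W : set (R * seqR R) -> Om -> R)
  (HW : gaussian_white_noise Prob (lebesgue_measure \x P)%E W)
  (I1 : R -> Om -> R) (X : nat -> R -> Om -> R)
  (HI1 : forall u : R,
     wiener_integral Prob (lebesgue_measure \x P)%E W (Z1_integrand u) (I1 u))
  (HX : forall (k : nat) (u : R), (1 <= k)%N ->
     wiener_integral Prob (lebesgue_measure \x P)%E W (X_integrand k u) (X k u)) :
  forall l : nat, (1 <= l)%N ->
  [/\ gaussian_process Prob (Zproc I1 X l)
      /\ centered Prob (Zproc I1 X l)
      /\ stationary_cov Prob (Zproc I1 X l),
      (forall u v : R,
         (\int[Prob]_w (Zproc I1 X l u w * Zproc I1 X l v w)%:E)%E = (cov_l l u v)%:E),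
      (forall (n : nat) (u v : R),
         (\int[Prob]_w (Zproc I1 X l u w * Zproc I1 X (l + n) v w)%:E)%E
           = (cross_cov l n u v)%:E) &
      exists Y : R -> Om -> R,
        (forall u : R, measurable_fun setT (Y u) /\
           Prob [set w | Y u w != Zproc I1 X l u w] = 0%E) /\
        (forall (w : Om) (a : R), 0 < a < 2^-1 ->
           locally_hoelder (fun u => Y u w) a)].
Proof.
case=> [//|l] _; split.
- split; first exact: (Z_gaussian HW HI1 HX).
  split=> [u|h u v]; first exact: (isonormal_centered HW (Z_isonormal HW HI1 HX l u)).
  by rewrite !(Z_cov HP HW HI1 HX) cov_l_shift.
- by move=> u v; exact: (Z_cov HP HW HI1 HX).
- by move=> n u v; exact: (Z_cross_cov HP HW HI1 HX).
- apply: hoelder_version => [u|u v]; last exact: (Z_increment HP HW HI1 HX).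
  by case: (Z_isonormal HW HI1 HX l u).
Qed.
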